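(* Let $t\ge 1$, and let $F=\bigcup_{j=1}^t F_j$ be a spider forest (vertex-disjoint union of spiders) which is not a (single) star. For $1\le j\le t$, let $F_j=S(\ell_{1,j},\ell_{2,j},\dots,\ell_{k_j,j})$ with centre $v_j$, where $\ell_{1,j},\dots,\ell_{k_j,j}\ge 1$. Let $r_j$ be the number of legs of $F_j$ with length $1$. Assume that $r_j\le 1$ for $1\le j\le s$ and $r_j\ge 2$ for $s<j\le t$, for some $0\le s\le t$. Let \[ k:=\sum_{j=1}^t k_j,\quad m:=\min_{1\le j\le s}k_j\ \text{ if } s\ge 1,\quad r:=\sum_{j=1}^t r_j,\quad \alpha:=\min_{1\le j\le t}k_j. \] Let $p>1$ be a real number. Then $\tau(F)=\sum_{j=1}^t\tau(F_j)$, where for $1\le j\le t$ \[ \tau(F_j)=\begin{cases}\sum_{i=1}^{k_j}\frac{\ell_{i,j}}{2}, & \text{if } F_j \text{ is even-legged};\\ \sum_{i=1}^{k_j}\big\lfloor\frac{\ell_{i,j}}{2}\big\rfloor+1, & \text{if } F_j\text{ is odd-legged or mixed parity},\end{cases} \] and there exists $n_0=n_0(F,p)$ such that, if $G$ is an $F$-free graph on $n\ge n_0$ vertices with $e_p(G)=\mathrm{ex}_p(n,F)$, then - $G\in\mathcal L(n,t-1,\alpha-1)$, if $F$ is a star forest, i.e. $r=k$; - $G=K_{t+k-r-1}\vee L'$, if $\ell_{i,j}\in\{1,3\}$ for all $i,j$, and $s\ge 1$, $m\ge 2$, $r\le k-1$; - $G=L(n,t+k-r-1,1)$, if $\ell_{i,j}\in\{1,3\}$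 for all $i,j$, and $s=0$, $r\le k-1$; - $G=L(n,\tau(F)-1,0)$, if for some $j_1$, $F_{j_1}$ is either mixed parity or is an odd length path; - $G=E(n,\tau(F)-1)$, otherwise; where $L'$ is the graph on $n-t-k+r+1$ vertices that consists of a matching of size $m-1$ and isolated vertices. Moreover, in the case when $F$ is a star forest, every graph of $\mathcal L(n,t-1,\alpha-1)$ (with $n\ge n_0$) is an extremal graph for $\mathrm{ex}_p(n,F)$.
   Context: All graphs are finite, simple and undirected; equality of graphs is up to isomorphism. A graph is $F$-free if it does not contain $F$ as a (not necessarily induced) subgraph. For real $p>0$, $e_p(G)=\sum_{v\in V(G)}d_G(v)^p$ (with $0^p=0$), and $\mathrm{ex}_p(n,F)$ is the maximum of $e_p(G)$ over all $F$-free graphs $G$ on $n$ vertices; an extremal graph is an $F$-free graph on $n$ vertices attaining this maximum. For a bipartite graph $F$, $\tau(F)$ is the minimum size of an independent set of vertices meeting every edge of $F$. Spiders: for $k\ge 1$ and $\ell_1,\dots,\ell_k\ge 1$, the spider $S(\ell_1,\dots,\ell_k)$ is formed by attaching $k$ paths of lengths $\ell_1,\dots,\ell_k$ (the legs; length is the number of edges) to a centre vertex $v$. Stars ($K_{1,q}$, $q\ge 1$) and paths are special cases. Convention for unique notation (up to permutation of $\ell_1,\dots,\ell_k$): the path $P_{\ell+1}$ on $\ell+1$ vertices is always written $S(\ell)$ (so $k=1$, and the centre is an end-vertex) if $\ell\ne 2$, and the path $P_3$ is always written $S(1,1)$; hence any spider with $k=2$ is $S(1,1)$, and $S(2)$ is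 not used. Under this convention, $S(\ell_1,\dots,\ell_k)$ is even-legged if every $\ell_i$ is even, odd-legged if every $\ell_i$ is odd, and mixed parity otherwise. An odd length path is a path with an odd number of edges. Graphs: The join $G\vee H$ is obtained from vertex-disjoint copies of $G$ and $H$ by adding all edges between them. A graph $L$ on $m$ vertices is near $\ell$-regular if it is $\ell$-regular when $\ell m$ is even, and otherwise has $m-1$ vertices of degree $\ell$ and one vertex of degree $\ell-1$. $\mathcal L(n,q,\ell)$ is the family of all graphs $K_q\vee L$ with $L$ a near $\ell$-regular graph on $n-q$ vertices. For $\ell\in\{0,1\}$, $L(n,q,\ell)$ is the unique member of $\mathcal L(n,q,\ell)$ (so $L(n,q,0)$ is the join of $K_q$ with an edgeless graph on $n-q$ vertices, and $L(n,q,1)$ is the join of $K_q$ with a maximum matching on $n-q$ vertices). $E(n,q)=K_q\vee E^+_{n-q}$, where $E^+_m$ is the graph on $m$ vertices with exactly one edge. *)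

(* Defs.v *)
From mathcomp Require Import all_boot all_order all_algebra.
From mathcomp Require Import reals exp.

Set Implicit Arguments.
Unset Strict Implicit.
Unset Printing Implicit Defensive.

Import Order.TTheory GRing.Theory Num.Theory.

Local Open Scope nat_scope.

(* The minimum of f over P; equal to 0 when P is empty. *)
Definition nat_min (I : finType) (P : pred I) (f : I -> nat) : nat :=
  \big[minn/(\max_(i | P i) f i)]_(i | P i) f i.

Record sgraph := SGraph {
  vertex :> finType;
  adj : rel vertex;
  adj_sym : symmetric adj;
  adj_irrefl : irreflexive adj }.

Definition deg (G : sgraph) (v : G) : nat := #|[set u | adj v u]|.

Definition iso (G H : sgraph) : Prop :=
  exists2 f : G -> H, bijective f & {mono f : x y / adj x y}.

(* Not necessarily induced. *)
Definition contains (F G : sgraph) : bool :=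
  [exists f : {ffun F -> G}, injectiveb f &&
    [forall x, forall y, adj x y ==> adj (f x) (f y)]].

Definition free (F G : sgraph) : bool := ~~ contains F G.

Definition indep_cover (G : sgraph) (A : {set G}) : bool :=
  [forall x, forall y, adj x y ==> ~~ ((x \in A) && (y \in A))] &&
  [forall x, forall y, adj x y ==> ((x \in A) || (y \in A))].

(* Meaningful for bipartite graphs only: otherwise there is no such set. *)
Definition tau (G : sgraph) : nat :=
  nat_min (@indep_cover G) (fun A => #|A|).

Section EdgeSet.
Variables (n : nat) (E : {set {set 'I_n}}).

Definition edge_set_adj : rel 'I_n :=
  fun x y => (x != y) && ([set x; y] \in E).

Fact edge_set_sym : symmetric edge_set_adj.
Proof. by move=> x y; rewrite /edge_set_adj eq_sym setUC. Qed.

Fact edge_set_irrefl : irreflexive edge_set_adj.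
Proof. by move=> x; rewrite /edge_set_adj eqxx. Qed.

(* Members of E that are not pairs are ignored. *)
Definition edge_set_graph : sgraph := SGraph edge_set_sym edge_set_irrefl.
End EdgeSet.

Section DegreePower.
Variables (R : realType) (p : R).
Local Open Scope ring_scope.

(* Isolated vertices contribute 0 since 0 `^ p = 0 for p != 0. *)
Definition e_p (G : sgraph) : R := \sum_(v : G) (deg v)%:R `^ p.

(* Every graph on n vertices is isomorphic to some edge_set_graph E with
   E : {set {set 'I_n}}. The default value 0 is harmless: e_p is nonnegative,
   and the edgeless graph is F-free whenever F has an edge. *)
Definition ex_p (n : nat) (F : sgraph) : R :=
  \big[Num.max/0]_(E : {set {set 'I_n}} | free F (edge_set_graph E))
     e_p (edge_set_graph E).

Definition extremal (n : nat) (F G : sgraph) : Prop :=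
  [/\ #|G| = n, free F G & e_p G = ex_p n F].
End DegreePower.

Section Complete.
Variable n : nat.

Definition complete_adj : rel 'I_n := fun x y => x != y.

Fact complete_sym : symmetric complete_adj.
Proof. by move=> x y; rewrite /complete_adj eq_sym. Qed.

Fact complete_irrefl : irreflexive complete_adj.
Proof. by move=> x; rewrite /complete_adj eqxx. Qed.

Definition complete : sgraph := SGraph complete_sym complete_irrefl.
End Complete.

Section Edgeless.
Variable n : nat.

Definition edgeless_adj : rel 'I_n := fun _ _ => false.

Fact edgeless_sym : symmetric edgeless_adj.
Proof. by []. Qed.

Fact edgeless_irrefl : irreflexive edgeless_adj.
Proof. by []. Qed.

Definition edgeless : sgraph := SGraph edgeless_sym edgeless_irrefl.
End Edgeless.

Section Matching.
Variables (n q : nat).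

Definition matching_adj : rel 'I_n :=
  fun x y => [&& x != y, x./2 == y./2 & x./2 < q].

Fact matching_sym : symmetric matching_adj.
Proof.
move=> x y; rewrite /matching_adj eq_sym (eq_sym x./2).
by case: (y./2 =P x./2) => [->|_].
Qed.

Fact matching_irrefl : irreflexive matching_adj.
Proof. by move=> x; rewrite /matching_adj eqxx. Qed.

(* For q.*2 <= n, the q edges {2i, 2i+1}, i < q, and isolated vertices. *)
Definition matching : sgraph := SGraph matching_sym matching_irrefl.
End Matching.

Section Path.
Variable n : nat.

Definition path_adj : rel 'I_n := fun x y => (x.+1 == y) || (y.+1 == x).

Fact path_adj_sym : symmetric path_adj.
Proof. by move=> x y; rewrite /path_adj orbC. Qed.

Fact path_adj_irrefl : irreflexive path_adj.
Proof. by move=> x; rewrite /path_adj orbb gtn_eqF. Qed.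

Definition path_graph : sgraph := SGraph path_adj_sym path_adj_irrefl.
End Path.

Section Join.
Variables (G H : sgraph).

Definition gjoin_adj : rel (G + H)%type := fun x y =>
  match x, y with
  | inl u, inl v => adj u v
  | inr u, inr v => adj u v
  | _, _ => true
  end.

Fact gjoin_sym : symmetric gjoin_adj.
Proof. by case=> x [] y //=; rewrite adj_sym. Qed.

Fact gjoin_irrefl : irreflexive gjoin_adj.
Proof. by case=> x /=; rewrite adj_irrefl. Qed.

Definition gjoin : sgraph := SGraph gjoin_sym gjoin_irrefl.
End Join.

Section DisjointUnion.
Variables (I : finType) (G : I -> sgraph).

Definition gunion_adj : rel {i : I & G i} := fun x y =>
  (tag x == tag y) && adj (tagged x) (tagged_as x y).

Fact gunion_sym : symmetric gunion_adj.
Proof.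
move=> [i x] [j y]; rewrite /gunion_adj /= [j == i]eq_sym.
by case: eqP => //= eq_ij; case: j / eq_ij y => y; rewrite !tagged_asE adj_sym.
Qed.

Fact gunion_irrefl : irreflexive gunion_adj.
Proof. by move=> [i x]; rewrite /gunion_adj tagged_asE adj_irrefl andbF. Qed.

Definition gunion : sgraph := SGraph gunion_sym gunion_irrefl.
End DisjointUnion.

(* K_{1,q} *)
Definition star (q : nat) : sgraph := gjoin (complete 1) (edgeless q).

Definition is_star (G : sgraph) : Prop :=
  exists2 q, 1 <= q & iso G (star q).

Definition is_odd_path (G : sgraph) : Prop :=
  exists2 l, odd l & iso G (path_graph l.+1).

Section Spider.
Variable ls : seq nat.

(* None is the centre, and Some (Tagged _ j) with tag i is the vertex at
   distance j.+1 from the centre on the i-th leg. *)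
Definition spider_vertex : finType :=
  option {i : 'I_(size ls) & 'I_(nth 0 ls i)}.

Definition spider_succ (x y : spider_vertex) : bool :=
  match x, y with
  | None, Some v => tagged v == 0 :> nat
  | Some u, Some v => (tag u == tag v) && ((tagged u).+1 == tagged v :> nat)
  | _, None => false
  end.

Definition spider_adj : rel spider_vertex :=
  fun x y => spider_succ x y || spider_succ y x.

Fact spider_sym : symmetric spider_adj.
Proof. by move=> x y; rewrite /spider_adj orbC. Qed.

Fact spider_irrefl : irreflexive spider_adj.
Proof.
by case=> [[i j]|]; rewrite /spider_adj //= orbb eqxx /= gtn_eqF.
Qed.

Definition spider : sgraph := SGraph spider_sym spider_irrefl.
End Spider.

(* The convention making the notation S(l_1, ..., l_k) unique: a path with l
   edges is written S(l) if l <> 2, and S(1,1) if l = 2. *)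
Definition spider_notation (ls : seq nat) : bool :=
  [&& 0 < size ls, all (fun l => 0 < l) ls,
      ls != [:: 2] & (size ls == 2) ==> (ls == [:: 1; 1])].

Definition even_legged (ls : seq nat) : bool := all (fun l => ~~ odd l) ls.
Definition odd_legged (ls : seq nat) : bool := all odd ls.
Definition mixed_parity (ls : seq nat) : bool :=
  ~~ even_legged ls && ~~ odd_legged ls.

Definition near_regular (l : nat) (L : sgraph) : Prop :=
  if odd (l * #|L|)
  then exists2 v : L, deg v = l - 1 & forall u : L, u != v -> deg u = l
  else forall u : L, deg u = l.

Definition in_calL (n q l : nat) (G : sgraph) : Prop :=
  exists L : sgraph,
    [/\ #|L| = n - q, near_regular l L & iso G (gjoin (complete q) L)].

(* L(n,q,0), L(n,q,1) and E(n,q) *)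
Definition L0 (n q : nat) : sgraph := gjoin (complete q) (edgeless (n - q)).
Definition L1 (n q : nat) : sgraph :=
  gjoin (complete q) (matching (n - q) (n - q)./2).
Definition Eplus (n q : nat) : sgraph :=
  gjoin (complete q) (matching (n - q) 1).

(* Main.v *)
(* Let b = tau(F) - 1. An extremal graph G has at least the power sum of
   K_b joined to an edgeless graph. As an F-free graph has O(n) edges and contains
   no K_{b+1,|F|}, and as p > 1, almost all of e_p(G) must come from b vertices of
   degree close to n; let B be the set of these vertices. A vertex outside B
   missing a neighbour in B could be joined to exactly B instead: this creates no
   copy of F, gains about n^{p-1} and loses only a small fraction of that.
   Hence every vertex of B is joined to all of V(G) \ B, and it remains to
   maximise the power sum of L = G - B. Deleting from F an independent set of b
   vertices may leave a small star or a small matching, which L must then avoid;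
   this bounds the degrees or the number of edges of L. Conversely, an analysis of
   the legs of the spiders shows that K_b joined to the densest such L is F-free. *)

Require Import Defs.
From mathcomp Require Import all_boot all_order all_algebra.
From mathcomp Require Import reals exp.
From mathcomp Require Import zify ring lra.

Set Implicit Arguments.
Unset Strict Implicit.
Unset Printing Implicit Defensive.

Import Order.TTheory GRing.Theory Num.Theory.

Local Open Scope nat_scope.

(** * Subgraphs, joins and induced subgraphs *)

Section Injections.
Variables (S T : finType).

Lemma inj_between (A : {set S}) (B : {set T}) : #|A| <= #|B| -> A != set0 ->
  exists g : S -> T, {in A &, injective g} /\ {in A, forall x, g x \in B}.
Proof.
move=> leAB /set0Pn[a0 a0A].
have [b0 b0B] : exists b, b \in B.
  apply/set0Pn; rewrite -card_gt0; apply: leq_trans leAB.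
  by rewrite card_gt0; apply/set0Pn; exists a0.
pose g x := nth b0 (enum B) (index x (enum A)).
have ltg x : x \in A -> index x (enum A) < size (enum B).
  move=> xA; rewrite -cardE; apply: leq_trans leAB.
  by rewrite cardE index_mem mem_enum.
exists g; split=> [x y xA yA /eqP|x xA]; last first.
  by rewrite -mem_enum mem_nth // ltg.
rewrite nth_uniq ?ltg ?enum_uniq // => /eqP exy.
by rewrite -[x](nth_index x (s := enum A)) ?mem_enum // exy nth_index ?mem_enum.
Qed.

Lemma extend_injection (D : {set S}) (X : {set T}) (h : S -> T) :
    {in D &, injective h} -> {in D, forall x, h x \in X} -> #|S| <= #|X| ->
  exists h' : S -> T,
    [/\ injective h', {in D, h' =1 h} & forall x, h' x \in X].
Proof.
move=> hinj hX leSX.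
have [DT|/set0Pn[c]] := eqVneq (~: D) set0.
  have allD x : x \in D by rewrite -[D]setCK DT setC0 inE.
  by exists h; split=> // [x y|x]; [apply: hinj|apply: hX].
rewrite inE => cD.
have [||g [ginj gX]] := @inj_between (~: D) (X :\: h @: D).
  - rewrite cardsCs setCK cardsD (setIidPr _) ?card_in_imset // ?leq_sub2r //.
    by apply/subsetP=> _ /imsetP[x xD ->]; apply: hX.
  - by apply/set0Pn; exists c; rewrite inE.
have gE x : x \notin D -> g x \in X :\: h @: D by move=> xD; rewrite gX ?inE.
exists (fun x => if x \in D then h x else g x); split=> [x y|x ->//|x].
- case: ifP => xD; case: ifP => yD.
  + exact: hinj.
  + by move=> e; have := gE y (negbT yD); rewrite -e inE imset_f.
  + by move=> e; have := gE x (negbT xD); rewrite e inE imset_f.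
  + by apply: ginj; rewrite inE ?xD ?yD.
- by case: ifP => [/hX //|/negbT/gE]; rewrite inE => /andP[].
Qed.

End Injections.

Lemma card_set_sig (T : finType) (A : {set T}) (Q : pred T) :
  #|[set u : {x | x \in A} | Q (val u)]| = #|[set x in A | Q x]|.
Proof.
rewrite -(card_imset _ val_inj); apply: eq_card => x; rewrite !inE.
apply/imsetP/andP=> [[u]|[xA Qx]]; first by rewrite inE => Qu ->; rewrite (valP u).
by exists (Sub x xA); rewrite ?inE /= ?SubK.
Qed.

Section Graphs.

Lemma adj_neq (G : sgraph) (x y : G) : adj x y -> x != y.
Proof. by apply: contraTneq => ->; rewrite adj_irrefl. Qed.

Lemma containsP (F G : sgraph) :
  reflect (exists f : F -> G, injective f /\
             forall x y, adj x y -> adj (f x) (f y)) (contains F G).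
Proof.
apply: (iffP existsP) => [[f /andP[/injectiveP finj /forallP fh]]|[f [finj fh]]].
  by exists f; split=> // x y; have /forallP/(_ y)/implyP := fh x.
exists [ffun x => f x]; apply/andP; split.
  by apply/injectiveP=> x y; rewrite !ffunE => /finj.
by apply/forallP=> x; apply/forallP=> y; apply/implyP=> /fh; rewrite !ffunE.
Qed.

Lemma contains_trans (F G H : sgraph) :
  contains F G -> contains G H -> contains F H.
Proof.
move=> /containsP[f [fi fh]] /containsP[g [gi gh]]; apply/containsP.
exists (g \o f); split; first exact: inj_comp.
by move=> x y /fh/gh.
Qed.

Lemma iso_contains (F G : sgraph) : iso F G -> contains F G.
Proof.
case=> f /bij_inj fi fm; apply/containsP; exists f; split=> // x y.
by rewrite fm.
Qed.

Lemma iso_sym (F G : sgraph) : iso F G -> iso G F.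
Proof.
case=> f [g fK gK] fm; exists g; first by exists f.
by move=> x y; rewrite -fm !gK.
Qed.

Lemma iso_trans (F G H : sgraph) : iso F G -> iso G H -> iso F H.
Proof.
case=> f fb fm [g gb gm]; exists (g \o f); first exact: bij_comp.
by move=> x y; rewrite gm fm.
Qed.

Lemma iso_card (F G : sgraph) : iso F G -> #|F| = #|G|.
Proof. by case=> f /bij_eq_card. Qed.

Lemma free_iso (F G H : sgraph) : iso G H -> Defs.free F G -> Defs.free F H.
Proof.
move=> isoGH; apply: contra => FH; apply: contains_trans FH _.
exact/iso_contains/iso_sym.
Qed.

Lemma deg_hom (F G : sgraph) (f : F -> G) (x : F) : injective f ->
  (forall y, adj x y -> adj (f x) (f y)) -> deg x <= deg (f x).
Proof.
move=> fi fh; rewrite /deg -(card_imset _ fi); apply: subset_leq_card.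
by apply/subsetP=> _ /imsetP[y + ->]; rewrite !inE; apply: fh.
Qed.

Lemma deg_iso (F G : sgraph) (f : F -> G) (x : F) : bijective f ->
  {mono f : x y / adj x y} -> deg (f x) = deg x.
Proof.
move=> fb fm; rewrite /deg -(card_imset _ (bij_inj fb)).
apply: eq_card => y; rewrite !inE; case: fb => g fK gK.
apply/idP/imsetP=> [h|[z + ->]]; last by rewrite inE fm.
by exists (g y); rewrite ?gK // inE -fm gK.
Qed.

Lemma sum_deg_iso (M : nmodType) (F G : sgraph) (w : nat -> M) : iso F G ->
  (\sum_(x : F) w (deg x) = \sum_(y : G) w (deg y))%R.
Proof.
case=> f fb fm; rewrite (reindex f); last exact/onW_bij.
by apply: eq_bigr => x _; rewrite (deg_iso x fb fm).
Qed.

Lemma deg_sum (G : sgraph) (v : G) : deg v = \sum_u adj v u.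
Proof. by rewrite /deg cardsE -sum1_card big_mkcond. Qed.

Lemma ltn_deg_card (G : sgraph) (v : G) : deg v < #|G|.
Proof.
rewrite /deg -cardsT (cardsD1 v [set: G]) inE ltnS; apply: subset_leq_card.
by apply/subsetP=> u; rewrite !inE andbT eq_sym => /adj_neq.
Qed.

Lemma odd_sum_deg (G : sgraph) : odd (\sum_(v : G) deg v) = false.
Proof.
under eq_bigr do rewrite deg_sum.
pose lt (x y : G) := enum_rank x < enum_rank y.
have split_adj (x y : G) : adj x y = (lt x y && adj x y) + (lt y x && adj x y) :> nat.
  by rewrite /lt; case: ltngtP => [_|_|/ord_inj/enum_rank_inj ->];
    rewrite /= ?addn0 ?adj_irrefl.
under eq_bigr => x _ do (under eq_bigr => y _ do rewrite split_adj; rewrite big_split).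
rewrite big_split /= [X in _ + X]exchange_big /= oddD.
by under [X in _ (+) odd X]eq_bigr do under eq_bigr do rewrite adj_sym; rewrite addbb.
Qed.

Section Induced.
Variables (G : sgraph) (A : {set G}).

Definition induced_adj : rel {x : G | x \in A} := fun x y => adj (val x) (val y).
Fact induced_sym : symmetric induced_adj.
Proof. by move=> x y; rewrite /induced_adj adj_sym. Qed.
Fact induced_irrefl : irreflexive induced_adj.
Proof. by move=> x; rewrite /induced_adj adj_irrefl. Qed.
Definition induced : sgraph := SGraph induced_sym induced_irrefl.

Lemma card_induced : #|induced| = #|A|.
Proof. by rewrite card_sig; apply: eq_card => x; rewrite inE. Qed.

Definition deg_in (v : G) : nat := #|[set u in A | adj v u]|.

Lemma deg_induced (x : induced) : deg x = deg_in (val x).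
Proof. exact: (card_set_sig A (adj (val x))). Qed.

End Induced.

Lemma deg_in_sum (G : sgraph) (A : {set G}) (v : G) :
  deg_in A v = \sum_(u in A) adj v u.
Proof. by rewrite /deg_in cardsE -sum1_card big_mkcondr. Qed.

Lemma deg_in_le_card (G : sgraph) (A : {set G}) (v : G) : deg_in A v <= #|A|.
Proof. by apply: subset_leq_card; apply/subsetP=> u; rewrite !inE => /andP[]. Qed.

Lemma deg_inU (G : sgraph) (A B : {set G}) (v : G) : [disjoint A & B] ->
  deg_in (A :|: B) v = deg_in A v + deg_in B v.
Proof. by move=> dAB; rewrite !deg_in_sum -bigU //=; apply: eq_bigl => x; rewrite !inE. Qed.

Lemma deg_inT (G : sgraph) (v : G) : deg_in [set: G] v = deg v.
Proof. by apply: eq_card => u; rewrite !inE. Qed.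

Lemma deg_in_split (G : sgraph) (A : {set G}) (v : G) :
  deg v = deg_in A v + deg_in (~: A) v.
Proof. by rewrite -deg_inU ?setUCr ?deg_inT // disjoints_subset setCK. Qed.

Lemma sum_deg_in_exchange (G : sgraph) (A B : {set G}) :
  \sum_(v in A) deg_in B v = \sum_(u in B) deg_in A u.
Proof.
under eq_bigr do rewrite deg_in_sum.
rewrite exchange_big; apply: eq_bigr => u _; rewrite deg_in_sum.
by apply: eq_bigr => v _; rewrite adj_sym.
Qed.

Definition nonisolated (G : sgraph) : {set G} := [set x : G | 0 < deg x].

Lemma deg_gt0 (G : sgraph) (x y : G) : adj x y -> 0 < deg x.
Proof. by move=> axy; apply/card_gt0P; exists y; rewrite inE. Qed.

Lemma contains_max_deg (F G : sgraph) d : contains F G ->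
  (forall y : G, deg y <= d) -> forall x : F, deg x <= d.
Proof.
case/containsP=> f [fi fh] dG x.
by apply: leq_trans (dG (f x)); apply: deg_hom => // y; apply: fh.
Qed.

Lemma contains_nonisolated (F G : sgraph) : contains F G ->
  #|nonisolated F| <= #|nonisolated G|.
Proof.
case/containsP=> f [fi fh]; rewrite -(card_imset _ fi).
apply: subset_leq_card; apply/subsetP=> _ /imsetP[x + ->]; rewrite !inE.
by move=> dx; apply: leq_trans dx _; apply: deg_hom => // y; apply: fh.
Qed.

Lemma iso_nonisolated (F G : sgraph) : iso F G -> #|nonisolated F| = #|nonisolated G|.
Proof.
move=> h; apply/eqP; rewrite eqn_leq.
by rewrite !contains_nonisolated // iso_contains //; apply: iso_sym.
Qed.

Definition joined (G : sgraph) (B : {set G}) : Prop :=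
  forall x y, x \in B -> y \notin B -> adj x y.

Definition indep (G : sgraph) (S : {set G}) : Prop :=
  forall x y, x \in S -> y \in S -> ~~ adj x y.

(* Since S is independent, no edge inside B is needed: this applies to an
   extremal G before B is known to be a clique. *)
Lemma contains_joined (F G : sgraph) (S : {set F}) (B : {set G}) :
    joined B -> indep S -> #|S| <= #|B| ->
    contains (induced (~: S)) (induced (~: B)) -> contains F G.
Proof.
move=> jB iS leSB /containsP[f [fi fh]].
have [b0|] := pickP (mem G); last first.
  move=> G0; apply/containsP.
  have F0 (x : F) : False.
    have [xS|xS] := boolP (x \in S).
      have : 0 < #|B| by apply: leq_trans leSB; apply/card_gt0P; exists x.
      by case/card_gt0P=> b; have := G0 b; rewrite inE.
    have xS' : x \in ~: S by rewrite inE.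
    by have := G0 (val (f (Sub x xS'))); rewrite inE.
  by exists (fun x => match F0 x with end); split=> x; case: (F0 x).
move=> _; apply/containsP.
have [g [gi gB]] : exists g : F -> G,
    {in S &, injective g} /\ {in S, forall x, g x \in B}.
  have [->|S0] := eqVneq S set0; last exact: inj_between.
  by exists (fun=> b0); split=> x; rewrite inE.
pose h x : G := oapp (fun u => val (f u)) (g x) (insub x).
have hS x : x \in S -> h x = g x.
  by move=> xS; rewrite /h insubF // inE xS.
have hC x (xS : x \in ~: S) : h x = val (f (Sub x xS)).
  by rewrite /h insubT.
exists h; split.
  move=> x y; have [xS|xS] := boolP (x \in S); have [yS|yS] := boolP (y \in S).
  - by rewrite !hS //; apply: gi.
  - have yS' : y \in ~: S by rewrite inE.
    rewrite hS // hC => e; have := valP (f (Sub y yS')).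
    by rewrite -e inE gB.
  - have xS' : x \in ~: S by rewrite inE.
    rewrite (hS y) // hC => e; have := valP (f (Sub x xS')).
    by rewrite e inE gB.
  - have xS' : x \in ~: S by rewrite inE.
    have yS' : y \in ~: S by rewrite inE.
    by rewrite !hC => /val_inj/fi [].
move=> x y; have [xS|xS] := boolP (x \in S); have [yS|yS] := boolP (y \in S).
- by move/negP: (iS _ _ xS yS).
- have yS' : y \in ~: S by rewrite inE.
  move=> _; rewrite hS // hC; apply: jB; first exact: gB.
  by have := valP (f (Sub y yS')); rewrite inE.
- have xS' : x \in ~: S by rewrite inE.
  move=> _; rewrite (hS y) // hC adj_sym; apply: jB; first exact: gB.
  by have := valP (f (Sub x xS')); rewrite inE.
- have xS' : x \in ~: S by rewrite inE.
  have yS' : y \in ~: S by rewrite inE.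
  by move=> axy; rewrite !hC; apply: (fh (Sub x xS') (Sub y yS')).
Qed.

Lemma contains_join_complete (F H : sgraph) b :
    contains F (gjoin (complete b) H) ->
  exists2 S : {set F}, #|S| <= b & contains (induced (~: S)) H.
Proof.
case/containsP=> f [fi fh].
pose isl (x : 'I_b + H) := if x is inl _ then true else false.
exists [set x | isl (f x)].
  have [b0|] := pickP (mem [set x | isl (f x)]); last first.
    by move=> /eq_card0 ->.
  move=> hb0; have [i0 _] : exists i0, f b0 = inl i0.
    by move: hb0; rewrite /= inE; case: (f b0) => // i; exists i.
  pose g x := if f x is inl i then i else i0.
  rewrite -[b]card_ord -(@card_in_imset _ _ g) ?max_card //.
  move=> x y; rewrite !inE /g; case ex: (f x) => [i|//]; case ey: (f y) => [j|//].
  by move=> _ _ eij; apply: fi; rewrite ex ey eij.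
have gP (u : induced (~: [set x | isl (f x)])) : exists v, f (val u) == inr v.
  case: u => x /=; rewrite !inE; case: (f x) => // v _; by exists v.
pose g u := xchoose (gP u).
have gE u : f (val u) = inr (g u) by apply/eqP/(xchooseP (gP u)).
apply/containsP; exists g; split=> [u v e|u v].
  by apply/val_inj/fi; rewrite !gE e.
by rewrite /= /induced_adj => /fh; rewrite !gE.
Qed.

End Graphs.

(** * Forests in graphs of large minimum degree *)

Definition forest_depth (F : sgraph) (dp : F -> nat) : Prop :=
  forall x y z, adj x y -> adj x z -> dp y <= dp x -> dp z <= dp x -> y = z.

Section ForestEmbedding.
Variables (F G : sgraph) (dp : F -> nat).
Hypothesis dpF : forest_depth dp.

Lemma greedy_embedding (X : {set G}) : X != set0 ->
  (forall v, v \in X -> #|F| <= deg_in X v) -> contains F G.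
Proof.
move=> /set0Pn[v0 v0X] degX.
suff emb n : forall D : {set F}, #|D| = n -> exists f : F -> G,
    [/\ {in D &, injective f}, {in D, forall x, f x \in X}
      & {in D &, forall x y, adj x y -> adj (f x) (f y)}].
  have [f [fi _ fh]] := emb _ setT erefl; apply/containsP; exists f.
  by split=> [x y|x y]; [apply: fi|apply: fh].
elim: n => [|n IHn] D cD.
  exists (fun=> v0); have -> : D = set0 by apply/eqP; rewrite -cards_eq0 cD.
  by split=> x; rewrite inE.
have /card_gt0P[x0 x0D] : 0 < #|D| by rewrite cD.
case: (arg_maxnP dp x0D) => x xD dpx.
have [|f [fi fX fh]] := IHn (D :\ x).
  by move: cD; rewrite (cardsD1 x D) (xD : x \in D) add1n => -[].
have cf : #|f @: (D :\ x)| < #|F|.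
  apply: leq_ltn_trans (leq_imset_card _ _) _.
  by apply: leq_trans (max_card (mem D)); rewrite [X in _ <= X](cardsD1 x D) (xD : x \in D).
have outside (Y : {set G}) : #|F| <= #|Y| -> exists2 v, v \in Y & v \notin f @: (D :\ x).
  move=> leY; have : 0 < #|Y :\: f @: (D :\ x)|.
    rewrite cardsD subn_gt0; apply: leq_ltn_trans (leq_trans cf leY).
    exact/subset_leq_card/subsetIr.
  by case/card_gt0P=> v; rewrite inE => /andP[vf vY]; exists v.
have [v [vX vf vadj]] : exists v, [/\ v \in X, v \notin f @: (D :\ x) &
    forall z, z \in D :\ x -> adj x z -> adj (f z) v].
  have [y /andP[yD axy]|noy] := pickP [pred y | (y \in D :\ x) && adj x y].
    have [v] := outside _ (degX _ (fX _ yD)).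
    rewrite inE => /andP[vX av] vf; exists v; split=> // z zD axz.
    suff <- : y = z by [].
    by apply: (dpF axy axz); apply: dpx;
      [move: yD|move: zD]; rewrite inE => /andP[].
  have [v vX vf] := outside X (leq_trans (degX _ v0X) (deg_in_le_card _ _)).
  exists v; split=> // z zD axz; move: (noy z); by rewrite /= zD axz.
have inD y : y \in D -> y != x -> y \in D :\ x by move=> yD yx; rewrite !inE yx.
exists (fun y => if y == x then v else f y); split.
- move=> y z yD zD; case: eqVneq => [->|yx]; case: eqVneq => [->//|zx].
  + by move=> e; case/negP: vf; rewrite e imset_f ?inD.
  + by move=> e; case/negP: vf; rewrite -e imset_f ?inD.
  + by apply: fi; apply: inD.
- by move=> y yD; case: eqVneq => // yx; apply: fX; apply: inD.
- move=> y z yD zD; case: eqVneq => [->|yx]; case: eqVneq => [->|zx].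
  + by rewrite adj_irrefl.
  + by move=> axz; rewrite adj_sym vadj ?inD.
  + by rewrite adj_sym => axz; rewrite vadj ?inD.
  + by apply: fh; apply: inD.
Qed.

Lemma sum_deg_in_forest_free : Defs.free F G ->
  forall X : {set G}, \sum_(v in X) deg_in X v <= 2 * #|F| * #|X|.
Proof.
move=> freeF X; have [n] := ubnP #|X|; elim: n X => // n IHn X ltXn.
have [->|X0] := eqVneq X set0; first by rewrite big_set0.
have [x /andP[xX dx]|big] := pickP [pred x | (x \in X) && (deg_in X x < #|F|)]; last first.
  case/negP: freeF; apply: (greedy_embedding X0) => v vX.
  by rewrite leqNgt; apply/negP => h; have := big v; rewrite /= vX h.
have eX : X = x |: (X :\ x) by rewrite setD1K.
have split_x v : deg_in X v = adj v x + deg_in (X :\ x) v.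
  by rewrite !deg_in_sum (bigD1 x) //=; congr (_ + _); apply: eq_bigl => u; rewrite !inE andbC.
have dxx : deg_in X x = deg_in (X :\ x) x by rewrite split_x adj_irrefl.
rewrite (bigD1 x) //= (eq_bigl (mem (X :\ x))); last by move=> u; rewrite !inE andbC.
under eq_bigr do rewrite split_x.
rewrite big_split /= (eq_bigr (fun v => nat_of_bool (adj x v))); last by move=> *; rewrite adj_sym.
rewrite -deg_in_sum -dxx.
have := IHn (X :\ x); rewrite (cardsD1 x X) xX in ltXn *.
move=> /(_ ltXn) le1; rewrite mulnDr muln1.
apply: leq_trans (leq_add (leqnn _) (leq_add (leqnn _) le1)) _.
by rewrite addnA leq_add2r mul2n -addnn leq_add // ltnW.
Qed.

End ForestEmbedding.

Lemma contains_complete_bipartite (F G : sgraph) (T : {set F}) (A Y : {set G}) :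
    indep_cover T -> #|T| <= #|A| -> #|F| <= #|Y| -> T != set0 ->
    (forall a y, a \in A -> y \in Y -> adj a y) -> contains F G.
Proof.
case/andP=> /forallP iT /forallP cT leTA leFY T0 aAY; apply/containsP.
have F0 : [set: F] != set0 by case/set0Pn: T0 => x _; apply/set0Pn; exists x; rewrite inE.
have [g [gi gA]] := inj_between leTA T0.
have [|h [hi hY]] := @inj_between _ _ [set: F] Y _ F0; first by rewrite cardsT.
have gh x y : x \in T -> g x != h y.
  by move=> xT; apply/adj_neq/aAY; [apply: gA|apply: hY; rewrite inE].
exists (fun x => if x \in T then g x else h x); split.
  move=> x y; case: ifP => xT; case: ifP => yT.
  - exact: gi.
  - by move=> e; have := gh x y xT; rewrite e eqxx.
  - by move=> e; have := gh y x yT; rewrite e eqxx.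
  - by apply: hi; rewrite inE.
move=> x y axy.
have /forallP/(_ y)/implyP/(_ axy) := iT x; have /forallP/(_ y)/implyP/(_ axy) := cT x.
case: ifP => xT; case: ifP => yT //= _ _.
  by apply: aAY; [apply: gA|apply: hY; rewrite inE].
by rewrite adj_sym; apply: aAY; [apply: gA|apply: hY; rewrite inE].
Qed.

(** * Power functions *)

Section CoverCount.
Variables (F G : sgraph) (T : {set F}).
Hypotheses (coverT : indep_cover T) (T0 : T != set0) (freeF : Defs.free F G).

Lemma few_rich_vertices (A : {set G}) :
  #|[set u | #|T| <= deg_in A u]| <= 2 ^ #|A| * #|F|.
Proof.
pose rich := [set u | #|T| <= deg_in A u].
have -> : #|rich| = \sum_(X in powerset A) #|[set u in rich | [set v in A | adj u v] == X]|.
  rewrite -sum1_card (partition_big (fun u => [set v in A | adj u v]) (mem (powerset A))) /=; last first.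
    by move=> u _; rewrite inE; apply/subsetP=> v; rewrite inE => /andP[].
  by apply: eq_bigr => X _; rewrite sum1dep_card; apply: eq_card => u; rewrite !inE.
rewrite -card_powerset -sum_nat_const; apply: leq_sum => X _.
rewrite leqNgt; apply/negP => ltFX.
case/negP: freeF; have [u uX] : exists u, u \in [set u in rich | [set v in A | adj u v] == X].
  by apply/set0Pn; rewrite -card_gt0; apply: leq_trans ltFX.
move: (uX); rewrite !inE => /andP[leT /eqP eX].
apply: (contains_complete_bipartite (A := X) coverT _ (ltnW ltFX)) => //.
  by rewrite -eX.
move=> a y aX; rewrite !inE => /andP[_ /eqP eyX].
by move: aX; rewrite -eyX inE adj_sym => /andP[].
Qed.

Lemma sum_deg_le_cover (A : {set G}) b : #|T| = b.+1 ->
  \sum_(v in A) deg v <= b * #|G| + #|A| * (2 ^ #|A| * #|F|).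
Proof.
move=> cT; under eq_bigr do rewrite -deg_inT.
rewrite sum_deg_in_exchange.
apply: (@leq_trans (\sum_(u : G) (b + #|A| * (#|T| <= deg_in A u)))).
  rewrite (eq_bigl xpredT); last by move=> u; rewrite inE.
  apply: leq_sum => u _; rewrite cT; case: (leqP b.+1 (deg_in A u)) => h; last by rewrite muln0 addn0 -ltnS.
  by rewrite muln1; apply: leq_trans (deg_in_le_card _ _) (leq_addl _ _).
rewrite big_split sum_nat_const -big_distrr /= [#|G| * b]mulnC leq_add2l leq_mul2l.
apply/orP; right; apply: leq_trans (few_rich_vertices A).
apply: eq_leq; rewrite -sum1dep_card [RHS]big_mkcond /=.
by apply: eq_bigr => u _; case: leq.
Qed.

End CoverCount.

Section PowerFunction.
Local Open Scope ring_scope.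
Variables (R : realType) (p : R).
Hypothesis p_gt1 : 1 < p.

Definition dpow (x : nat) : R := x%:R `^ p.
Definition dpow1 (x : nat) : R := x%:R `^ (p - 1).

Let q_gt0 : 0 < p - 1. Proof. by rewrite subr_gt0. Qed.

Lemma dpowE x : dpow x = x%:R * dpow1 x.
Proof. by rewrite /dpow /dpow1 mulr_powRB1 // (lt_trans _ p_gt1). Qed.

Lemma dpow1_ge0 x : 0 <= dpow1 x. Proof. exact: powR_ge0. Qed.

Lemma dpow_ge0 x : 0 <= dpow x. Proof. exact: powR_ge0. Qed.

Lemma dpow1_gt0 x : (0 < x)%N -> 0 < dpow1 x.
Proof. by move=> x0; rewrite powR_gt0 // ltr0n. Qed.

Lemma dpow1_le x y : (x <= y)%N -> dpow1 x <= dpow1 y.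
Proof.
by move=> xy; apply: ge0_ler_powR; rewrite ?nnegrE ?ler_nat // ltW.
Qed.

Lemma dpow1_lt x y : (x < y)%N -> dpow1 x < dpow1 y.
Proof. by move=> xy; apply: gt0_ltr_powR; rewrite ?nnegrE ?ltr_nat. Qed.

Lemma dpow_lt x y : (x < y)%N -> dpow x < dpow y.
Proof.
by move=> xy; apply: gt0_ltr_powR; rewrite ?nnegrE ?ltr_nat ?(lt_trans _ p_gt1).
Qed.

Lemma dpow_le x y : (x <= y)%N -> dpow x <= dpow y.
Proof. by rewrite leq_eqVlt => /predU1P[->//|/dpow_lt/ltW]. Qed.

Lemma dpow1M x y : dpow1 (x * y) = dpow1 x * dpow1 y.
Proof. by rewrite /dpow1 natrM powRM. Qed.

Lemma dpow1_unbounded (K : R) : exists M, (1 < M)%N /\ K <= dpow1 M.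
Proof.
pose y := (Num.max K 0) `^ (p - 1)^-1.
exists (Num.bound y + 2)%N; split; first by rewrite addn2.
apply: (@le_trans _ _ (Num.max K 0)); first by rewrite le_max lexx.
have -> : Num.max K 0 = y `^ (p - 1).
  by rewrite -powRrM mulVf ?gt_eqF // powRr1 // le_max lexx orbT.
apply: ge0_ler_powR; rewrite ?nnegrE ?powR_ge0 ?ler0n // ?ltW //.
apply: (@lt_le_trans _ _ (Num.bound y)%:R); last by rewrite ler_nat leq_addr.
by apply: archi_boundP; apply: powR_ge0.
Qed.

Lemma dpow1_pred (Q n : nat) : p - 1 <= Q%:R -> (1 < n)%N ->
  (n%:R - Q%:R) * dpow1 n <= n%:R * dpow1 n.-1.
Proof.
move=> leQ n1; have n0 : (0 : R) < n%:R by rewrite ltr0n ltnW.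
have n1R : (1 : R) < n%:R by rewrite ltr1n.
pose x : R := 1 - n%:R^-1.
have x0 : 0 < x by rewrite subr_gt0 invf_lt1.
have x1 : x <= 1 by rewrite lerBlDr lerDl invr_ge0 ltW.
have -> : dpow1 n.-1 = dpow1 n * x `^ (p - 1).
  rewrite -powRM ?ltW //; congr (_ `^ _).
  by rewrite mulrBr mulr1 mulfV ?gt_eqF // -subn1 natrB // ltnW.
have bern m : 1 - m%:R / n%:R <= x ^+ m.
  elim: m => [|m IH]; first by rewrite mul0r subr0 expr0.
  rewrite exprSr; apply: le_trans (_ : (1 - m%:R / n%:R) * x <= _); last first.
    by rewrite ler_pM2r.
  rewrite /x -addn1 natrD mulrDl mul1r.
  have : 0 <= m%:R / n%:R * n%:R^-1 :> R by rewrite !mulr_ge0 ?invr_ge0 ?ler0n ?(ltW n0).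
  by nra.
rewrite mulrCA [leLHS]mulrC; apply: ler_wpM2l; first exact: dpow1_ge0.
apply: (@le_trans _ _ (n%:R * x ^+ Q)).
  have -> : n%:R - Q%:R = n%:R * (1 - Q%:R / n%:R) :> R by field; rewrite gt_eqF.
  by rewrite ler_pM2l.
by rewrite ler_pM2l // -powR_mulrn ?(ltW x0) // ger_powR // x0.
Qed.

End PowerFunction.

(** * Vertices of almost full degree *)

Lemma subset_of_card (T : finType) (A : {set T}) k : k <= #|A| ->
  exists2 B : {set T}, B \subset A & #|B| = k.
Proof.
move=> leA; exists [set x in take k (enum A)].
  by apply/subsetP=> x; rewrite inE => /mem_take; rewrite mem_enum.
rewrite cardsE (card_uniqP _) ?take_uniq ?enum_uniq // size_take -cardE.
by case: ltngtP leA.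
Qed.

Section LargeDegrees.
Variables (R : realType) (p : R) (F : sgraph) (dp : F -> nat) (T : {set F}) (b : nat).
Hypotheses (p_gt1 : (1 < p)%R) (dpF : forest_depth dp).
Hypotheses (coverT : indep_cover T) (cardT : #|T| = b.+1) (b_gt0 : 0 < b).

Let T0 : T != set0. Proof. by rewrite -card_gt0 cardT. Qed.
Let f_gt0 : 0 < #|F|.
Proof. by apply: leq_trans (max_card (mem T)); rewrite cardT. Qed.

Lemma large_degree_vertices (M : nat) : 1 < M -> exists n1, forall G : sgraph,
    n1 <= #|G| -> Defs.free F G -> (b%:R * dpow p #|G|.-1 <= e_p p G)%R ->
  exists2 B : {set G}, #|B| = b & forall v, v \in B -> M * (#|G| - deg v) <= #|G|.
Proof.
move=> M1; set f := #|F|.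
have M0 : 0 < M by apply: ltnW.
pose th : R := (dpow1 p M.-1 / dpow1 p M)%R.
have wM0 : (0 < dpow1 p M)%R := dpow1_gt0 p M0.
have th1 : (th < 1)%R.
  by rewrite ltr_pdivrMr // mul1r; apply: dpow1_lt => //; rewrite prednK.
have th0 : (0 <= th)%R by rewrite divr_ge0 ?dpow1_ge0.
pose eta : R := ((1 - th) / 3)%R.
have eta0 : (0 < eta)%R by rewrite divr_gt0 // subr_gt0.
have f0 : (0 < f%:R :> R)%R by rewrite ltr0n.
have [M' [M'1 leM']] := dpow1_unbounded p_gt1 (2 * f%:R / eta)%R.
have M'0 : 0 < M' by apply: ltnW.
have wM'0 : (0 < dpow1 p M')%R := dpow1_gt0 p M'0.
pose Q := Num.bound (p - 1)%R.
have leQ : (p - 1 <= Q%:R)%R.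
  by apply/ltW/archi_boundP; rewrite subr_ge0 ltW.
pose a := 2 * f * M'; have [C eC] : exists C, C = a * (2 ^ a * f) by eexists.
pose K : R := ((C%:R + b%:R * (Q%:R + 1)) / (2 * eta))%R.
exists (Num.bound K + 2) => G; set n := #|G| => len freeF lee.
have n1 : 1 < n by apply: leq_trans len; rewrite addn2.
have n0 : 0 < n by apply: ltnW.
have Kn : (K < n%:R)%R.
  apply: (@lt_le_trans _ _ (Num.bound K)%:R)%R; last first.
    by rewrite ler_nat (leq_trans _ len) ?leq_addr.
  apply/archi_boundP/divr_ge0; last by rewrite mulr_ge0 // ltW.
  by rewrite addr_ge0 ?mulr_ge0 ?addr_ge0 ?ler0n.
pose H := [set v : G | M * (n - deg v) <= n].
have [leb|ltb] := leqP b #|H|.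
  have [B /subsetP sBH cB] := subset_of_card leb.
  by exists B => // v /sBH; rewrite inE.
exfalso.
pose A := [set v : G | n <= M' * deg v].
have sHA : H \subset A.
  apply/subsetP=> v; rewrite !inE => leM.
  have : 2 * (n - deg v) <= n by apply: leq_trans leM; rewrite leq_mul2r M1 orbT.
  move=> h; apply: (@leq_trans (2 * deg v)); last by rewrite leq_mul2r M'1 orbT.
  by have := leq_add (leqnn (2 * deg v)) h; rewrite -mulnDr subnKC ?(ltnW (ltn_deg_card v)) // mul2n -addnn leq_add2r.
have sumT : \sum_(v : G) deg v <= 2 * f * n.
  have := sum_deg_in_forest_free dpF freeF [set: G]; rewrite cardsT.
  under eq_bigr do rewrite deg_inT.
  by rewrite (eq_bigl xpredT) // => v; rewrite inE.
have cA : #|A| <= a.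
  rewrite -(leq_pmul2r n0) -sum_nat_const /a mulnAC.
  apply: (@leq_trans (\sum_(v in A) M' * deg v)).
    by apply: leq_sum => v; rewrite inE.
  rewrite -big_distrr /= mulnC leq_mul2r; apply/orP; right.
  by apply: leq_trans sumT; rewrite [X in _ <= X](bigID (mem A)) leq_addr.
have sumA : \sum_(v in A) deg v <= b * n + C.
  apply: leq_trans (sum_deg_le_cover coverT T0 freeF A cardT) _.
  by rewrite leq_add2l eC leq_mul // leq_mul // leq_pexp2l.
have sumH : \sum_(v in H) deg v <= b.-1 * n.
  apply: (@leq_trans (\sum_(v in H) n)).
    by apply: leq_sum => v _; apply/ltnW/ltn_deg_card.
  by rewrite sum_nat_const leq_mul2r -ltnS prednK // ltb orbT.
have wn0 : (0 < dpow1 p n)%R := dpow1_gt0 p n0.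
have bound v : (dpow p (deg v) <= dpow1 p n * (th * ((v \in A) * deg v)%:R
    + (1 - th) * ((v \in H) * deg v)%:R + eta / (2 * f%:R) * (deg v)%:R))%R.
  rewrite dpowE //; set d := deg v.
  have d0 : (0 <= d%:R :> R)%R by [].
  have c0 : (0 <= eta / (2 * f%:R) * d%:R)%R.
    by apply: mulr_ge0 => //; apply: divr_ge0; [exact: ltW|exact: mulr_ge0].
  have wdn : (dpow1 p d <= dpow1 p n)%R by apply: dpow1_le => //; apply/ltnW/ltn_deg_card.
  have [vH|vH] := boolP (v \in H).
    rewrite (subsetP sHA _ vH) !mul1n -mulrDl [(th + _)%R]addrC subrK mul1r mulrC.
    by apply: ler_pM; rewrite ?dpow1_ge0 // lerDl.
  have [vA|vA] := boolP (v \in A).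
    rewrite mul1n mul0n mulr0 addr0.
    suff h : (dpow1 p d <= dpow1 p n * th)%R.
      rewrite mulrDr mulrA mulrC; apply: ler_wpDr; first by rewrite mulr_ge0 // ltW.
      exact: ler_wpM2r.
    rewrite mulrA ler_pdivlMr // -!dpow1M; apply: dpow1_le => //.
    move: vH; rewrite inE -ltnNge -/d; have := ltn_deg_card v; rewrite -/n -/d.
    move=> ltdn ltnM; rewrite [d * M]mulnC -(leq_add2r n) addnC -[X in _ <= X]addnC -mulnS prednK // [n * M]mulnC addnC.
    apply: leq_trans (leq_add (leqnn _) (ltnW ltnM)) _.
    by rewrite -mulnDr subnKC // ltnW.
  rewrite !mul0n !mulr0 !add0r mulrA mulrC; apply: ler_wpM2r => //.
  apply: (@le_trans _ _ (dpow1 p n / dpow1 p M')%R).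
    rewrite ler_pdivlMr // -dpow1M; apply: dpow1_le => //.
    by move: vA; rewrite inE -ltnNge -/d mulnC => /ltnW.
  apply: ler_wpM2l; first exact: ltW.
  rewrite -[leRHS]invf_div lef_pV2 ?posrE //.
  by apply: divr_gt0 => //; apply: mulr_gt0.
have upper : (e_p p G <= dpow1 p n * (b%:R * n%:R - 2 * eta * n%:R + C%:R))%R.
  apply: (@le_trans _ _ (dpow1 p n * (th * (\sum_(v in A) deg v)%:R
    + (1 - th) * (\sum_(v in H) deg v)%:R + eta / (2 * f%:R) * (\sum_(v : G) deg v)%:R))%R).
    rewrite (big_mkcond (mem A)) (big_mkcond (mem H)) /= !natr_sum !mulr_sumr -!big_split mulr_sumr.
    apply: ler_sum => v _; apply: le_trans (bound v) _.
    apply: ler_wpM2l; first exact: ltW.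
    by rewrite /=; case: (v \in A); case: (v \in H); rewrite ?mul1n ?mul0n.
  apply: ler_wpM2l; first exact: ltW.
  move: sumA sumH sumT; rewrite -!(ler_nat R) natrD !natrM.
  move: (\sum_(v in A) deg v)%:R%R (\sum_(v in H) deg v)%:R%R (\sum_v deg v)%:R%R.
  move=> SA SH S hA hH hS.
  have hS' : (eta / (2 * f%:R) * S <= eta * n%:R)%R.
    by rewrite mulrAC ler_pdivrMr ?mulr_gt0 // -[leRHS]mulrA ler_wpM2l ?(ltW eta0) // [leRHS]mulrC.
  have eb : (b%:R = b.-1%:R + 1 :> R)%R by rewrite -[in LHS](prednK b_gt0) -addn1 natrD.
  have h1 : (th * SA <= th * (b%:R * n%:R + C%:R))%R by rewrite ler_wpM2l.
  have h2 : ((1 - th) * SH <= (1 - th) * (b.-1%:R * n%:R))%R.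
    by rewrite ler_wpM2l // subr_ge0 ltW.
  have h3 : (th * C%:R <= C%:R)%R by rewrite ler_piMl // ltW.
  have e3 : (1 - th = 3 * eta)%R by rewrite /eta mulrC divfK // pnatr_eq0.
  have e4 : (th * (b%:R * n%:R + C%:R) + (1 - th) * (b.-1%:R * n%:R)
      = b%:R * n%:R - (1 - th) * n%:R + th * C%:R)%R by rewrite eb; ring.
  have e5 : ((1 - th) * n%:R = 3 * (eta * n%:R))%R by rewrite mulrA -e3.
  have e6 : (2 * eta * n%:R = 2 * (eta * n%:R))%R by rewrite mulrA.
  rewrite e6; clear -h1 h2 h3 hS' e4 e5.
  by clearbody eta th; lra.
have := le_trans lee upper; rewrite dpowE //.
have pr := dpow1_pred leQ n1.
have en : (n.-1%:R = n%:R - 1 :> R)%R by rewrite -subn1 natrB.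
have nR : (1 < n%:R :> R)%R by rewrite ltr1n.
move=> low; have : (b%:R * (n%:R - 1) * (n%:R - Q%:R) * dpow1 p n <=
    n%:R * (b%:R * n%:R - 2 * eta * n%:R + C%:R) * dpow1 p n)%R.
  apply: (@le_trans _ _ (b%:R * (n%:R - 1) * (n%:R * dpow1 p n.-1))%R).
    rewrite -[leLHS]mulrA; apply: ler_wpM2l => //.
    by rewrite mulr_ge0 // subr_ge0 ltW.
  have := low; rewrite en -(ler_pM2l (lt_trans ltr01 nR)); congr (_ <= _)%R; ring.
rewrite ler_pM2r // => fin.
have b0R : (0 < b%:R :> R)%R by rewrite ltr0n.
have Q0 : (0 <= Q%:R :> R)%R by [].
have : (2 * eta * n%:R <= C%:R + b%:R * (Q%:R + 1))%R.
  have h : (n%:R * (2 * eta * n%:R) <= n%:R * (C%:R + b%:R * (Q%:R + 1)))%R.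
    have : (0 <= b%:R * Q%:R :> R)%R by rewrite mulr_ge0 // ltW.
    by nra.
  by move: h; rewrite ler_pM2l // (lt_trans ltr01 nR).
rewrite leNgt => /negP; apply.
move: Kn; rewrite /K ltr_pdivrMr; last by rewrite mulr_gt0.
by rewrite [(n%:R * _)%R]mulrC.
Qed.

End LargeDegrees.

(** * Completing the join *)

Section Rejoin.
Variables (G : sgraph) (B W : {set G}).

Definition rejoin_adj : rel G := fun x y =>
  [|| [&& x \in B, y \in B & adj x y], (x \in B) (+) (y \in B)
    | [&& x \in W, y \in W & adj x y]].
Fact rejoin_sym : symmetric rejoin_adj.
Proof.
move=> x y; rewrite /rejoin_adj adj_sym addbC.
by rewrite [in RHS]andbCA [X in [|| _, _ | X]]andbCA.
Qed.
Fact rejoin_irrefl : irreflexive rejoin_adj.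
Proof. by move=> x; rewrite /rejoin_adj adj_irrefl !andbF addbb. Qed.
Definition rejoin : sgraph := SGraph rejoin_sym rejoin_irrefl.

Hypothesis dBW : [disjoint B & W].
Hypothesis BW : forall x y, x \in B -> y \in W -> adj x y.

Let notB y : y \in W -> y \notin B.
Proof. by move=> yW; apply: contraTN yW => /(disjointFr dBW) ->. Qed.

(* A vertex outside B and W has only B as its neighbourhood in the rejoined
   graph, so it can be exchanged for an unused vertex of W. *)
Lemma rejoin_free (F : sgraph) : #|F| <= #|W| ->
  Defs.free F G -> Defs.free F rejoin.
Proof.
move=> leFW; apply: contra => /containsP[f [fi fh]].
pose D := [set x | f x \in B :|: W].
have [|||h [hi hD hX]] := @extend_injection F G D (f @: D :|: W) f.
- by move=> x y _ _; apply: fi.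
- by move=> x xD; rewrite inE imset_f.
- by apply: leq_trans leFW _; apply/subset_leq_card/subsetUr.
have hW x : x \notin D -> h x \in W.
  move=> xD; have := hX x; rewrite inE => /orP[/imsetP[y yD]|//].
  by rewrite -hD // => /hi exy; rewrite exy yD in xD.
have hDP x : x \in D -> (f x \in B) || (f x \in W) by rewrite !inE.
have fB x : x \notin D -> f x \notin B by rewrite !inE negb_or => /andP[].
have fW x : x \notin D -> f x \notin W by rewrite !inE negb_or => /andP[].
apply/containsP; exists h; split=> // x y /fh; rewrite /= /rejoin_adj.
case/or3P=> [/and3P[xB yB axy]|fxy|/and3P[xW yW axy]].
- by rewrite !hD // inE ?xB ?yB !inE ?xB ?yB.
- wlog xB : x y fxy / f x \in B.
    move=> th; case/addbP: (fxy); case xB: (f x \in B) => /esym yB.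
      exact: th.
    by rewrite adj_sym; apply: th; rewrite // addbC.
  move: fxy; rewrite xB /= => yB.
  have xD : x \in D by rewrite !inE xB.
  have [yD|/hW yW] := boolP (y \in D); last by rewrite hD // BW.
  by rewrite !hD // BW //; have := hDP _ yD; rewrite (negPf yB).
- by rewrite !hD // !inE ?xW ?yW orbT.
Qed.

Lemma deg_rejoin v : v \in B -> deg (v : rejoin) = deg_in B v + #|~: B|.
Proof.
move=> vB; rewrite deg_sum (bigID (mem B)) /= deg_in_sum -sum1_card; congr (_ + _).
  apply: eq_bigr => u uB; rewrite /rejoin_adj vB uB /=.
  by rewrite (disjointFr dBW vB) orbF.
rewrite (eq_bigl (mem (~: B))) => [|u]; last by rewrite !inE.
by apply: eq_bigr => u; rewrite !inE => uB; rewrite /rejoin_adj vB (negPf uB).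
Qed.

Lemma deg_rejoin_out v : v \in W ->
  deg (v : rejoin) = deg v - deg_in (~: (B :|: W)) v.
Proof.
move=> vW; have vB := notB vW.
have -> : deg v = deg_in (B :|: W) v + deg_in (~: (B :|: W)) v by apply: deg_in_split.
rewrite addnK deg_sum deg_in_sum [RHS]big_mkcond /=; apply: eq_bigr => u _.
rewrite /rejoin_adj (negPf vB) /= vW inE.
have [uB|uB] /= := boolP (u \in B); first by rewrite adj_sym BW.
by case: (u \in W).
Qed.

End Rejoin.

Section Joined.
Variables (R : realType) (p : R) (F : sgraph) (dp : F -> nat) (T : {set F}) (b : nat).
Hypotheses (p_gt1 : (1 < p)%R) (dpF : forest_depth dp).
Hypotheses (coverT : indep_cover T) (cardT : #|T| = b.+1) (b_gt0 : 0 < b).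

Definition ep_maximal (G : sgraph) : Prop :=
  forall G' : sgraph, #|G'| = #|G| -> Defs.free F G' -> (e_p p G' <= e_p p G)%R.

Let f := #|F|.
Let c := b + f.

Lemma few_unjoined_vertices (G : sgraph) (B : {set G}) (M : nat) : #|B| = b ->
    (forall v, v \in B -> M * (#|G| - deg v) <= #|G|) ->
  M * #|[set u in ~: B | ~~ [forall v in B, adj v u]]| <= b * #|G|.
Proof.
move=> cB hB; set U := [set u in ~: B | _].
apply: (@leq_trans (M * \sum_(v in B) (#|G| - deg v))); last first.
  by rewrite big_distrr /= -cB -sum_nat_const; apply: leq_sum.
rewrite leq_mul2l; apply/orP; right.
apply: (@leq_trans (\sum_(v in B) \sum_(u in U) ~~ adj v u)).
  rewrite exchange_big -sum1_card; apply: leq_sum => u; rewrite inE => /andP[_].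
  by case/forall_inPn=> v vB nuv; rewrite (bigD1 v) //= nuv.
apply: leq_sum => v _; rewrite deg_sum -sum1_card -sumnB; last by move=> i _; case: adj.
rewrite [leqRHS](bigID (mem U)) /=; apply: leq_trans (leq_addr _ _).
by apply: leq_sum => u _; case: adj.
Qed.

Lemma maximal_joined (K : nat) (G : sgraph) (B : {set G}) :
    let C := c + 2 * f + c.+1 * f in
    (C%:R < dpow1 p K)%R -> 2 * K * c + 2 * b + 2 * f <= #|G| -> 1 < K ->
    Defs.free F G -> ep_maximal G -> #|B| = b ->
    (forall v, v \in B -> 2 * K * b * (#|G| - deg v) <= #|G|) ->
  joined B.
Proof.
move=> C ltCK; set n := #|G| => len K1 freeF maxG cB hB.
pose U := [set u in ~: B | ~~ [forall v in B, adj v u]].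
pose W := [set u in ~: B | [forall v in B, adj v u]].
have BW x y : x \in B -> y \in W -> adj x y.
  by move=> xB; rewrite inE => /andP[_ /forall_inP]; apply.
have dBW : [disjoint B & W].
  by rewrite disjoint_sym disjoints_subset; apply/subsetP=> u; rewrite inE => /andP[].
have dUW : [disjoint U & W].
  by rewrite disjoints_subset; apply/subsetP=> u; rewrite !inE => /andP[-> /negPf ->].
have UE : ~: (B :|: W) = U.
  by apply/setP=> u; rewrite !inE; case: (u \in B).
have BE : ~: B = U :|: W.
  by apply/setP=> u; rewrite !inE -andb_orr orNb andbT.
have cU : 2 * K * #|U| <= n.
  rewrite -(leq_pmul2l b_gt0) mulnA [b * _]mulnC.
  exact: few_unjoined_vertices cB hB.
have cn : b + (#|U| + #|W|) = n.
  by rewrite /n -(cardsC B) cB BE cardsU disjoint_setI0 // cards0 subn0.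
have leFW : f <= #|W|.
  have : 2 * #|U| <= n by apply: leq_trans cU; rewrite leq_mul2r leq_pmulr ?orbT // ltnW.
  by move: len cn; rewrite -/n; clear; lia.
suff U0 : U = set0.
  move=> x y xB yB; apply: BW => //.
  by have := in_set0 y; rewrite -U0 !inE yB /= => /negbFE.
apply/eqP; rewrite -cards_eq0; apply/negPn/negP; rewrite -lt0n => U_gt0.
have degW v : v \notin B -> deg_in W v <= f.
  move=> vB; rewrite leqNgt; apply/negP => ltf; case/negP: freeF.
  apply: (contains_complete_bipartite (A := v |: B) (Y := [set u in W | adj v u]) coverT).
  - by rewrite cardT cardsU1 vB cB.
  - exact: ltnW.
  - by rewrite -card_gt0 cardT.
  - by move=> a y /setU1P[->|aB]; rewrite inE => /andP[yW av] //; apply: BW.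
have degC v : v \notin B -> deg v <= c + deg_in U v.
  move=> vB; rewrite (deg_in_split B) BE deg_inU // addnA addnAC.
  by rewrite leq_add2r leq_add ?degW // -cB deg_in_le_card.
have freeG' := rejoin_free BW leFW freeF.
have := maxG (rejoin B W) erefl freeG'.
pose W1 := [set w in W | 0 < deg_in U w].
have W1E v : (v \in W1) = (v \in W) && (v \in W1).
  have : W1 \subset W by apply/subsetP=> w; rewrite inE => /andP[].
  by move=> /subsetP/(_ v); case: (v \in W1) => [->|] //; rewrite andbF.
have c_gt0 : 0 < c by rewrite addn_gt0 b_gt0.
have cu_gt0 : 0 < c + #|U| by rewrite addn_gt0 c_gt0.
set w1 := dpow1 p (c + #|U|).
have w1_gt0 : (0 < w1)%R by apply: dpow1_gt0.
have gainB v : v \in B -> (dpow p (deg v) + (\sum_(u in U) ~~ adj v u)%:R * dpow1 p (n - b)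
    <= dpow p (deg (v : rejoin B W)))%R.
  move=> vB; rewrite deg_rejoin //.
  have cCB : #|~: B| = n - b by rewrite -cB cardsCs setCK.
  rewrite cCB.
  have eU : \sum_(u in U) ~~ adj v u + deg v = deg_in B v + (n - b).
    rewrite (deg_in_split B) addnCA -cCB BE deg_inU // cardsU disjoint_setI0 // cards0 subn0.
    have -> : deg_in W v = #|W|.
      by apply: eq_card => u; rewrite inE; case uW : (u \in W); rewrite //= BW.
    congr (_ + _); rewrite addnA; congr (_ + _); rewrite deg_in_sum -big_split -sum1_card.
    by apply: eq_bigr => u _ /=; case: adj.
  rewrite -eU !dpowE // natrD mulrDl addrC lerD //.
    apply: ler_wpM2l => //; apply: dpow1_le => //.
    by rewrite eU leq_addl.
  by apply: ler_wpM2l => //; apply: dpow1_le => //; rewrite leq_addl.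
have lossU v : v \in U -> (dpow p (deg v) <= dpow p (deg (v : rejoin B W)) + (deg v)%:R * w1)%R.
  move=> vU; apply: ler_wpDl; first exact: dpow_ge0.
  rewrite dpowE //; apply: ler_wpM2l => //; apply: dpow1_le => //.
  have vB : v \notin B by move: vU; rewrite !inE => /andP[].
  by apply: leq_trans (degC v vB) _; rewrite leq_add2l deg_in_le_card.
have lossW v : v \in W -> (dpow p (deg v) <= dpow p (deg (v : rejoin B W))
    + ((v \in W1) * deg v)%:R * w1)%R.
  move=> vW; have vB : v \notin B by move: vW; rewrite !inE => /andP[].
  have [vW1|] := boolP (v \in W1).
    rewrite mul1n; apply: ler_wpDl; first exact: dpow_ge0.
    rewrite dpowE //; apply: ler_wpM2l => //; apply: dpow1_le => //.
    by apply: leq_trans (degC v vB) _; rewrite leq_add2l deg_in_le_card.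
  rewrite inE vW /= -eqn0Ngt mul0n mul0r addr0 => /eqP dU0.
  by rewrite deg_rejoin_out // UE dU0 subn0.
have total : \sum_(v in U) deg v + \sum_(v in W1) deg v <= C * #|U|.
  have sU : \sum_(v in U) deg_in U v <= 2 * f * #|U| := sum_deg_in_forest_free dpF freeF U.
  have sW : \sum_(v in W) deg_in U v <= f * #|U|.
    rewrite sum_deg_in_exchange mulnC -sum_nat_const; apply: leq_sum => v.
    by rewrite !inE => /andP[vB _]; apply: degW.
  have h1 : \sum_(v in U) deg v <= c * #|U| + 2 * f * #|U|.
    apply: leq_trans (leq_add (leqnn _) sU); rewrite mulnC -sum_nat_const -big_split.
    by apply: leq_sum => v; rewrite !inE => /andP[vB _]; apply: degC.
  have h2 : \sum_(v in W1) deg v <= c.+1 * (f * #|U|).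
    apply: leq_trans (_ : c.+1 * \sum_(v in W) deg_in U v <= _); last by rewrite leq_mul2l sW orbT.
    rewrite big_distrr /= [leqRHS](bigID (mem W1)) /=; apply: leq_trans (leq_addr _ _).
    rewrite (eq_bigl [pred v | (v \in W) && (v \in W1)]) => [|v]; last exact: W1E.
    apply: leq_sum => v; rewrite !inE => /andP[_ /andP[/andP[vB _] d0]].
    apply: leq_trans (degC v vB) _; rewrite mulSn addnC leq_add2l.
    by rewrite leq_pmulr.
  by apply: leq_trans (leq_add h1 h2) _; rewrite /C !mulnDl -(mulnA _ f).
rewrite /e_p leNgt => /negP; apply.
have nb : (K * (c + #|U|) <= n - b)%N.
  have : 2 * (K * (c + #|U|)) <= 2 * (n - b).
    rewrite mulnA mulnDr; move: len cU; move: (2 * K * c) (2 * K * #|U|) => X Y.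
    by clearbody n; clear; lia.
  by rewrite leq_pmul2l.
have key : ((C * #|U|)%:R * w1 < #|U|%:R * dpow1 p (n - b))%R.
  rewrite mulnC natrM -mulrA ltr_pM2l ?ltr0n //.
  apply: lt_le_trans (dpow1_le p_gt1 nb); rewrite dpow1M -/w1.
  by rewrite ltr_pM2r.
have splitV (g : G -> R) : (\sum_v g v = \sum_(v in B) g v + (\sum_(v in U) g v + \sum_(v in W) g v))%R.
  rewrite (bigID (mem B)) /=; congr (_ + _)%R; rewrite -bigU //=.
  by apply: eq_bigl => v; rewrite -[LHS]in_setC BE !inE.
rewrite !splitV.
have gB : (\sum_(v in B) dpow p (deg v) + #|U|%:R * dpow1 p (n - b)
    <= \sum_(v in B) dpow p (deg (v : rejoin B W)))%R.
  apply: (le_trans _ (ler_sum _ gainB)); rewrite /= big_split /= lerD2l -mulr_suml.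
  apply: ler_wpM2r; first exact: dpow1_ge0.
  rewrite -natr_sum ler_nat exchange_big -sum1_card; apply: leq_sum => u.
  rewrite inE => /andP[_] /forall_inPn[v vB nuv].
  by rewrite (bigD1 v) //= nuv.
have gU := ler_sum (index_enum G) lossU; have gW := ler_sum (index_enum G) lossW.
move: gU gW; rewrite /= !big_split /= -!mulr_suml -!natr_sum.
have -> : \sum_(v in W) (v \in W1) * deg v = \sum_(v in W1) deg v.
  rewrite [RHS](eq_bigl [pred v | (v \in W) && (v \in W1)]) => [|v]; last exact: W1E.
  rewrite big_mkcondr /=; apply: eq_bigr => v _.
  by case: (v \in W1); rewrite ?mul1n.
move=> gU gW.
have tR : ((\sum_(v in U) deg v)%:R * w1 + (\sum_(v in W1) deg v)%:R * w1 <= (C * #|U|)%:R * w1)%R.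
  by rewrite -mulrDl -natrD ler_pM2r // ler_nat.
rewrite /= in gU gW gB *; rewrite -!/(dpow p _).
move: gB gU gW tR key; clear; rewrite /dpow; lra.
Qed.

Lemma maximal_joined_exists : exists n0, forall G : sgraph, n0 <= #|G| ->
    Defs.free F G -> (b%:R * dpow p #|G|.-1 <= e_p p G)%R -> ep_maximal G ->
  exists2 B : {set G}, #|B| = b & joined B.
Proof.
have [K [K1 leK]] := dpow1_unbounded p_gt1 ((c + 2 * f + c.+1 * f).+1%:R)%R.
have ltK : ((c + 2 * f + c.+1 * f)%:R < dpow1 p K)%R.
  by apply: lt_le_trans leK; rewrite ltr_nat.
have M1 : 1 < 2 * K * b.
  by rewrite -mulnA (@leq_mul 2 1) // muln_gt0 b_gt0 ltnW.
have [n1 hn1] := large_degree_vertices p_gt1 dpF coverT cardT b_gt0 M1.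
exists (n1 + (2 * K * c + 2 * b + 2 * f)) => G len freeF low maxG.
have [|B cB hB] := hn1 G _ freeF low; first by apply: leq_trans len; apply: leq_addr.
exists B => //; apply: maximal_joined ltK _ K1 freeF maxG cB hB.
by apply: leq_trans len; apply: leq_addl.
Qed.

End Joined.

(** * Extremal graphs and power sums of joins *)

Section ExtremalNumber.
Variables (R : realType) (p : R).

Lemma iso_edge_set n (G : sgraph) : #|G| = n ->
  exists E : {set {set 'I_n}}, iso G (edge_set_graph E).
Proof.
move=> cG; pose f (x : G) := cast_ord cG (enum_rank x).
have fi : injective f by move=> x y /cast_ord_inj/enum_rank_inj.
exists [set e | [exists x : G, exists y : G, adj x y && (e == [set f x; f y])]].
exists f; first by apply: inj_card_bij; rewrite // card_ord cG.
move=> x y; rewrite /= /edge_set_adj inE (inj_eq fi).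
apply/andP/idP => [[nxy /existsP[x' /existsP[y' /andP[axy /eqP e]]]]|axy]; last first.
  rewrite adj_neq //; split=> //.
  by apply/existsP; exists x; apply/existsP; exists y; rewrite axy eqxx.
have : f x \in [set f x'; f y'] by rewrite -e !inE eqxx.
have : f y \in [set f x'; f y'] by rewrite -e !inE eqxx orbT.
rewrite !inE !(inj_eq fi) => /orP[]/eqP ey /orP[]/eqP ex; subst => //.
- by rewrite eqxx in nxy.
- by rewrite adj_sym.
- by rewrite eqxx in nxy.
Qed.

Lemma e_p_iso (G H : sgraph) : iso G H -> e_p p G = e_p p H.
Proof. exact: (sum_deg_iso (fun d => (d%:R `^ p)%R)). Qed.

Lemma e_p_ge0 (G : sgraph) : (0 <= e_p p G)%R.
Proof. by apply: sumr_ge0 => v _; apply: powR_ge0. Qed.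

Lemma e_p_le_ex_p n (F G : sgraph) : #|G| = n -> Defs.free F G ->
  (e_p p G <= ex_p p n F)%R.
Proof.
move=> cG freeF; have [E isoE] := iso_edge_set cG.
rewrite (e_p_iso isoE); apply: (@le_bigmax_cond _ _ _ _ E).
exact: free_iso freeF.
Qed.

Lemma ex_p_attained n (F G : sgraph) : #|G| = n -> Defs.free F G ->
  exists H, extremal p n F H.
Proof.
move=> cG freeF; have [E0 isoE] := iso_edge_set cG.
have fE0 := free_iso isoE freeF.
pose P := [pred E : {set {set 'I_n}} | Defs.free F (edge_set_graph E)].
case: (@arg_maxP _ R _ E0 P (fun E => e_p p (edge_set_graph E)) fE0) => E PE leE.
exists (edge_set_graph E); split; rewrite ?card_ord //.
apply/eqP; rewrite eq_le e_p_le_ex_p ?card_ord //=.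
by apply: bigmax_le => [|E' PE']; [apply: e_p_ge0|apply: leE].
Qed.

Lemma extremal_maximal n (F G : sgraph) : extremal p n F G -> ep_maximal p F G.
Proof. by case=> cG _ eG G' cG' freeG'; rewrite eG e_p_le_ex_p // cG'. Qed.

End ExtremalNumber.

Section Joins.

Lemma card_join_complete b (H : sgraph) : #|gjoin (complete b) H| = b + #|H|.
Proof. by rewrite card_sum card_ord. Qed.

Lemma deg_join_inl b (H : sgraph) (i : complete b) :
  deg (inl i : gjoin (complete b) H) = (b + #|H|).-1.
Proof.
rewrite -card_join_complete deg_sum -cardsT (cardsD1 (inl i : gjoin (complete b) H)) inE add1n /=.
rewrite -sum1_card [RHS]big_mkcond; apply: eq_bigr => -[j|y] _; rewrite !inE //=.
by rewrite /complete_adj eq_sym andbT; case: eqVneq => [->|/eqP ne]; rewrite ?eqxx //=; case: eqVneq => // -[].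
Qed.

Lemma deg_join_inr b (H : sgraph) (y : H) :
  deg (inr y : gjoin (complete b) H) = b + deg y.
Proof.
rewrite !deg_sum big_sumType /=; congr (_ + _).
by rewrite sum_nat_const muln1 card_ord.
Qed.

Lemma iso_join_complete (G : sgraph) (B : {set G}) b (H : sgraph) :
    #|B| = b -> joined B -> (forall v, v \in B -> deg v = #|G|.-1) ->
    iso (induced (~: B)) H -> iso G (gjoin (complete b) H).
Proof.
move=> cB jB fullB /iso_sym[g gb gm].
pose h (u : gjoin (complete b) H) : G := match u with
  | inl i => enum_val (cast_ord (esym cB) i)
  | inr y => val (g y) end.
have hB i : h (inl i) \in B by apply: enum_valP.
have hC y : h (inr y) \notin B by have := valP (g y); rewrite inE.
have hi : injective h.
  move=> [i|y] [j|z] e.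
  - by move: e => /enum_val_inj/cast_ord_inj ->.
  - by have := hC z; rewrite -e hB.
  - by have := hC y; rewrite e hB.
  - by move: e => /val_inj/(bij_inj gb) ->.
apply: iso_sym; exists h.
  apply: inj_card_bij => //; rewrite card_join_complete.
  by rewrite (bij_eq_card gb) card_induced -cB cardsC.
have adjB v u : v \in B -> adj v u = (v != u).
  move=> vB; apply/idP/idP; first exact: adj_neq.
  have : [set w | adj v w] = [set: G] :\ v.
    apply/eqP; rewrite eqEcard; apply/andP; split.
      by apply/subsetP=> w; rewrite !inE andbT eq_sym => /adj_neq.
    have -> : #|[set: G] :\ v| = #|G|.-1 by rewrite -cardsT [in RHS](cardsD1 v) inE.
    by rewrite -[leqRHS]/(deg v) fullB.
  by move=> /setP/(_ u); rewrite !inE andbT eq_sym => ->.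
move=> [i|y] [j|z].
- by rewrite adjB // (inj_eq hi).
- by rewrite jB.
- by rewrite adj_sym jB.
- exact: gm.
Qed.

End Joins.

Section JoinedPowerSum.
Variables (R : realType) (p : R).
Local Open Scope ring_scope.

Lemma e_p_join_complete b (H : sgraph) : e_p p (gjoin (complete b) H) =
  b%:R * dpow p (b + #|H|).-1 + \sum_(y : H) dpow p (b + deg y).
Proof.
rewrite /e_p big_sumType /=; congr (_ + _); last first.
  by apply: eq_bigr => y _; rewrite deg_join_inr.
under eq_bigr do rewrite deg_join_inl.
by rewrite sumr_const card_ord mulr_natl.
Qed.

Lemma e_p_joined (G : sgraph) (B : {set G}) : joined B -> e_p p G =
  \sum_(v in B) dpow p (deg v)
    + \sum_(x : induced (~: B)) dpow p (#|B| + deg x)%N.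
Proof.
move=> jB; rewrite /e_p (bigID (mem B)) /=; congr (_ + _).
have -> : \sum_(x : induced (~: B)) dpow p (#|B| + deg x)%N =
    \sum_(x : induced (~: B)) dpow p (deg (val x)).
  apply: eq_bigr => x _; rewrite deg_induced (deg_in_split B (val x)); congr (dpow p (_ + _)%N).
  apply: eq_card => u; rewrite inE; case uB: (u \in B) => //=.
  by rewrite adj_sym jB //; have := valP x; rewrite inE.
rewrite (eq_bigl (mem (~: B))) => [|v]; last by rewrite !inE.
exact: (big_sub (mem (~: B))).
Qed.

Variable F : sgraph.

Lemma maximal_join (G : sgraph) (B : {set G}) b (H : sgraph) : 1 < p ->
    joined B -> #|B| = b -> (b + #|H|)%N = #|G| ->
    Defs.free F (gjoin (complete b) H) -> ep_maximal p F G ->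
    \sum_(x : induced (~: B)) dpow p (b + deg x)%N
      <= \sum_(y : H) dpow p (b + deg y)%N ->
  (forall v, v \in B -> deg v = #|G|.-1) /\
  \sum_(x : induced (~: B)) dpow p (b + deg x)%N
    = \sum_(y : H) dpow p (b + deg y)%N.
Proof.
move=> p1 jB cB cG freeH maxG leS.
have := maxG _ (etrans (card_join_complete b H) cG) freeH.
rewrite e_p_join_complete (e_p_joined jB) cB cG => le1.
have le2 v : v \in B -> dpow p (deg v) <= dpow p #|G|.-1.
  move=> _; apply: dpow_le => //; rewrite -ltnS; apply: leq_trans (ltn_deg_card v) _.
  exact: leqSpred.
have eB : b%:R * dpow p #|G|.-1 = \sum_(v in B) dpow p #|G|.-1.
  by rewrite sumr_const cB mulr_natl.
have le3 := ler_sum (index_enum G) le2; rewrite /= -eB in le3.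
have eqS : \sum_(x : induced (~: B)) dpow p (b + deg x)%N
    = \sum_(y : H) dpow p (b + deg y)%N by apply/eqP; rewrite eq_le leS /=; lra.
split=> // v vB; apply/eqP; rewrite eqn_leq -ltnS.
rewrite (leq_trans (ltn_deg_card v) (leqSpred _)) /= leqNgt; apply/negP => ltv.
have : \sum_(v in B) dpow p (deg v) < b%:R * dpow p #|G|.-1.
  rewrite eB (bigD1 v) //= [X in _ < X](bigD1 v) //=; apply: ltr_leD.
    exact: dpow_lt.
  by apply: ler_sum => u /andP[uB _]; apply: le2.
lra.
Qed.

End JoinedPowerSum.

(** * Graphs of maximum degree one *)

Definition partner (i : nat) : nat := if odd i then i.-1 else i.+1.

Lemma partner_half i : (partner i)./2 = i./2.
Proof. by rewrite /partner; case: ifP => oi; lia. Qed.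

Lemma partner_neq i : partner i != i.
Proof. by rewrite /partner; case: ifP => oi; lia. Qed.

Lemma partnerP i j : i != j -> i./2 = j./2 -> j = partner i.
Proof. by rewrite /partner => nij eij; case: ifP => oi; lia. Qed.

Lemma ltn_partner i e : (partner i < e.*2) = (i < e.*2).
Proof. by rewrite /partner; case: ifP => oi; lia. Qed.

Section Matching.

Lemma matching_deg n e (x : matching n e) : e.*2 <= n -> deg x = (x < e.*2).
Proof.
move=> len; have [ltx|gex] := ltnP x e.*2; last first.
  apply/eqP; rewrite cards_eq0; apply/eqP/setP=> y; rewrite !inE /= /matching_adj.
  by rewrite ltn_half_double ltnNge gex !andbF.
have lty : partner x < n by apply: leq_trans len; rewrite ltn_partner.
apply/eqP/cards1P; exists (Ordinal lty : matching n e); apply/setP=> y.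
rewrite !inE /= /matching_adj ltn_half_double ltx andbT.
apply/andP/eqP=> [[nxy /eqP exy]|->]; first by apply/val_inj; apply: partnerP.
by rewrite /= partner_half eqxx -val_eqE eq_sym partner_neq.
Qed.

Lemma card_nonisolated_matching n e : e.*2 <= n ->
  #|nonisolated (matching n e)| = e.*2.
Proof.
move=> len.
transitivity #|[set x : 'I_n | x < e.*2]|.
  by apply: eq_card => x; rewrite !inE matching_deg // lt0b.
have : #|[set i : 'I_n | i < e.*2]| = \sum_(i < n | i < e.*2) 1 by rewrite sum1dep_card.
by move->; rewrite -(big_ord_widen n (fun=> 1) len) sum1_card card_ord.
Qed.

Lemma contains_matching n n' e e' : n' <= n -> e' <= e ->
  contains (matching n' e') (matching n e).
Proof.
move=> len lee; apply/containsP; exists (widen_ord len).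
split=> [x y /(congr1 val)/= /val_inj //|x y /and3P[nxy exy ltx]].
by apply/and3P; split=> //=; apply: leq_trans ltx lee.
Qed.

Lemma deg_le1_uniq (G : sgraph) (x y z : G) : deg x <= 1 -> adj x y -> adj x z -> y = z.
Proof.
by move=> /card_le1_eqP d axy axz; apply: d; rewrite inE.
Qed.

Variable L : sgraph.
Hypothesis deg1 : forall x : L, deg x <= 1.

Lemma matching_pair_list (x0 : L) (D : {set L}) :
    (forall x y, x \in D -> adj x y -> y \in D) ->
    (forall x, x \in D -> 0 < deg x) ->
  exists s e, [/\ uniq s, s =i D, size s = e.*2
    & forall i, i < e -> adj (nth x0 s i.*2) (nth x0 s i.*2.+1)].
Proof.
have [n] := ubnP #|D|; elim: n D => // n IHn D ltD clD posD.
have [->|/set0Pn[x xD]] := eqVneq D set0.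
  by exists [::], 0; split=> // x; rewrite !inE.
have /card_gt0P[y] := posD x xD; rewrite inE => axy.
have yD := clD x y xD axy; have nxy := adj_neq axy.
have ayx : adj y x by rewrite adj_sym.
have [|||s [e [us sD ss adjs]]] := IHn (D :\ x :\ y).
- rewrite (cardsD1 x D) xD (cardsD1 y) !inE eq_sym nxy yD /= in ltD.
  by move: ltD; rewrite !add1n ltnS; apply: ltnW.
- move=> z u; rewrite !inE => /and3P[nzy nzx zD] azu; rewrite (clD z) // andbT.
  rewrite adj_sym in azu; apply/andP; split; apply/eqP => eu; rewrite eu in azu.
    by case/eqP: nzx; apply: (deg_le1_uniq (deg1 y)).
  by case/eqP: nzy; apply: (deg_le1_uniq (deg1 x)).
- by move=> z; rewrite !inE => /and3P[_ _ /posD].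
exists [:: x, y & s], e.+1; split.
- by rewrite /= us inE !sD !inE !eqxx (negPf nxy) ?andbF.
- move=> z; rewrite !inE sD !inE; case: eqVneq => [->|_] /=; first by rewrite xD.
  by case: eqVneq => [->|_] /=; first by rewrite yD.
- by rewrite /= ss doubleS.
- by case=> [|i] lti //=; apply: adjs.
Qed.

Lemma matching_normal_form : exists e, e.*2 <= #|L| /\ iso L (matching #|L| e).
Proof.
have [|] := pickP (mem L); last first.
  move=> L0; have cL : #|L| = 0 by apply: eq_card0.
  exists 0; split=> //; exists (fun x : L => match notF (esym (L0 x)) with end).
    by apply: inj_card_bij => [x|]; [have := L0 x|rewrite card_ord cL].
  by move=> x; have := L0 x.
move=> x0 _.
have [||s [e [us sD ss adjs]]] := @matching_pair_list x0 (nonisolated L).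
- by move=> x y _ axy; rewrite inE (@deg_gt0 _ y x) // adj_sym.
- by move=> x; rewrite inE.
pose s' := s ++ enum (~: nonisolated L).
have sizes : size s' = #|L|.
  rewrite size_cat -cardE -(cardsC (nonisolated L)); congr (_ + _).
  by rewrite -(card_uniqP us); apply: eq_card.
have us' : uniq s'.
  rewrite cat_uniq us enum_uniq andbT; apply/hasPn=> x.
  by rewrite mem_enum !inE => h; rewrite /= sD inE.
have le2 : e.*2 <= #|L| by rewrite -sizes size_cat ss leq_addr.
exists e; split=> //; apply: iso_sym.
pose f (i : 'I_#|L|) := nth x0 s' i.
have fi : injective f.
  by move=> i j /eqP; rewrite /f nth_uniq ?sizes // => /eqP/val_inj.
have adjp i : i < e.*2 -> adj (nth x0 s' i) (nth x0 s' (partner i)).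
  move=> lti; rewrite !nth_cat ss ltn_partner lti /partner.
  have := adjs i./2; rewrite ltn_half_double lti => /(_ erefl).
  rewrite -[i in _ -> adj (nth _ _ i) _]odd_double_half; case: ifP => oi.
    by rewrite -[i in _ -> adj _ (nth _ _ i.-1)]odd_double_half oi /= adj_sym.
  by rewrite -[i in _ -> adj _ (nth _ _ i.+1)]odd_double_half oi.
exists f; first by apply: inj_card_bij => //; rewrite card_ord.
move=> i j; rewrite /= /matching_adj; apply/idP/and3P=> [aij|[nij /eqP eij]].
  have lti : i < e.*2.
    rewrite ltnNge; apply/negP => gei.
    have : f i \in ~: nonisolated L.
      rewrite /f nth_cat ss ltnNge gei /= -mem_enum mem_nth //.
      by rewrite -(ltn_add2l (size s)) -size_cat sizes ss subnKC.
    by rewrite !inE (deg_gt0 aij).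
  have ltp : partner i < #|L| by apply: leq_trans le2; rewrite ltn_partner.
  have : f (Ordinal ltp) = f j by apply: (deg_le1_uniq (deg1 (f i))) => //; apply: adjp.
  move=> /fi <-; rewrite /= partner_half eqxx ltn_half_double lti; split=> //.
  by rewrite -val_eqE eq_sym partner_neq.
rewrite ltn_half_double => lti; rewrite /f (_ : nat_of_ord j = partner i); first exact: adjp.
exact: partnerP.
Qed.

Lemma sum_deg_le1 (V : zmodType) (w : nat -> V) :
  (\sum_(x : L) w (deg x) = w 0%N *+ #|L| + (w 1%N - w 0%N) *+ #|nonisolated L|)%R.
Proof.
rewrite -(sumr_const (mem L)) -(sumr_const (mem (nonisolated L))) [X in (_ + X)%R]big_mkcond.
rewrite -big_split; apply: eq_bigr => x _; rewrite inE.
by have := deg1 x; case: (deg x) => [|[]] //= _; rewrite ?addr0 // addrC subrK.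
Qed.

End Matching.

Section FinishMatching.
Variables (R : realType) (p : R) (F : sgraph).
Hypothesis p_gt1 : (1 < p)%R.

Lemma maximal_join_matching (G : sgraph) (B : {set G}) b n e :
    #|G| = n -> b <= n -> joined B -> #|B| = b -> ep_maximal p F G ->
    (forall x : induced (~: B), deg x <= 1) ->
    #|nonisolated (induced (~: B))| <= e.*2 -> e.*2 <= n - b ->
    Defs.free F (gjoin (complete b) (matching (n - b) e)) ->
  iso G (gjoin (complete b) (matching (n - b) e)).
Proof.
move=> cG leb jB cB maxG deg1 leN len freeH.
have cM : #|matching (n - b) e| = n - b by rewrite card_ord.
have cL : #|induced (~: B)| = n - b by rewrite card_induced cardsCs setCK cB cG.
have degM (y : matching (n - b) e) : deg y <= 1 by rewrite matching_deg ?leq_b1.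
have cMn := card_nonisolated_matching len.
have d0 : (0 < dpow p (b + 1) - dpow p (b + 0))%R.
  by rewrite subr_gt0; apply: dpow_lt; rewrite // ltn_add2l.
have sumL := sum_deg_le1 deg1 (fun d => dpow p (b + d)).
have sumM := sum_deg_le1 degM (fun d => dpow p (b + d)).
have [||fullB eqS] := maximal_join p_gt1 jB cB _ freeH maxG.
- by rewrite cM cG subnKC.
- by rewrite sumL sumM cL cM cMn lerD2l ler_pMn2l.
have eN : #|nonisolated (induced (~: B))| = e.*2.
  move: eqS; rewrite sumL sumM cL cM cMn => /addrI eqM.
  by apply/eqP; rewrite eqn_leq -!(ler_pMn2l d0) eqM lexx.
apply: (iso_join_complete cB jB fullB).
have [e' [le' isoL]] := matching_normal_form deg1.
suff ee : e' = e by rewrite -ee -cL.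
apply: double_inj; rewrite -eN (iso_nonisolated isoL) card_nonisolated_matching //.
Qed.

End FinishMatching.

Section ForbiddenParts.
Variables (F G : sgraph) (B : {set G}).
Hypotheses (jB : joined B) (freeF : Defs.free F G).
Let L := induced (~: B).
Hypothesis leFL : #|F| <= #|L|.

Lemma indep_cover_indep (T : {set F}) : indep_cover T -> indep T.
Proof.
case/andP=> /forallP h _ x y xT yT; apply/negP => axy.
by have /forallP/(_ y)/implyP/(_ axy) := h x; rewrite xT yT.
Qed.

Lemma indep_coverE (T : {set F}) x y : indep_cover T -> adj x y -> x \notin T -> y \in T.
Proof.
case/andP=> _ /forallP h axy xT.
by have /forallP/(_ y)/implyP/(_ axy) := h x; rewrite (negPf xT).
Qed.

Lemma indepS (S T : {set F}) : S \subset T -> indep T -> indep S.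
Proof. by move=> /subsetP sST iT x y /sST xT /sST yT; apply: iT. Qed.

(* Removing T minus x from F leaves only the star at x. *)
Lemma joined_deg_lt (T : {set F}) x d : indep_cover T -> x \in T ->
  deg x <= d -> #|T| <= #|B|.+1 -> forall v : L, deg v < d.
Proof.
move=> covT xT lexd leTB v; rewrite ltnNge; apply/negP => ledv; case/negP: freeF.
apply: (@contains_joined _ _ (T :\ x) B) => //.
- exact: indepS (subsetDl _ _) (indep_cover_indep covT).
- by move: leTB; rewrite (cardsD1 x T) xT.
have lexv : deg x <= deg v := leq_trans lexd ledv.
pose N := [set y | adj x y].
have [g [gi gN]] : exists g : F -> L,
    {in N &, injective g} /\ {in N, forall y, adj v (g y)}.
  have [N0|N0] := eqVneq N set0; first by exists (fun=> v); rewrite N0; split=> y; rewrite inE.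
  have [g [gi gN]] := @inj_between F L N [set y | adj v y] lexv N0.
  by exists g; split=> // y /gN; rewrite inE.
pose D := x |: N.
have xN : x \notin N by rewrite inE adj_irrefl.
have nx y : y \in N -> (y == x) = false by move=> yN; apply: contraNF xN => /eqP <-.
pose h y := if y == x then v else g y.
have [|||h' [hi hD _]] := @extend_injection F L D [set: L] h.
- move=> y z /setU1P[->|yN] /setU1P[->|zN] //; rewrite /h ?eqxx ?nx //.
  + by move=> e; have := gN z zN; rewrite -e adj_irrefl.
  + by move=> e; have := gN y yN; rewrite e adj_irrefl.
  + exact: gi.
- by move=> y _; rewrite inE.
- by rewrite cardsT.
apply/containsP; exists (fun y => h' (val y)); split.
  by move=> y z /hi/val_inj.
have key y z : adj y z -> y \notin T :\ x -> z \notin T :\ x -> y \in T -> adj (h' y) (h' z).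
  rewrite !inE => ayz nyT nzT yT; have eyx : y = x by apply/eqP; rewrite yT andbT negbK in nyT.
  have zN : z \in N by rewrite inE -eyx.
  by rewrite eyx !hD ?setU11 ?setU1r // /h eqxx nx // gN.
move=> [y yS] [z zS]; rewrite /= /induced_adj /= => ayz.
have nyS : y \notin T :\ x by rewrite inE in yS.
have nzS : z \notin T :\ x by rewrite inE in zS.
have [yT|yT] := boolP (y \in T); first exact: key.
by rewrite adj_sym; apply: key; rewrite // ?(indep_coverE covT ayz) // adj_sym.
Qed.

Lemma joined_nonisolated_lt (S : {set F}) M : indep S -> #|S| <= #|B| ->
    (forall x : induced (~: S), deg x <= 1) ->
    #|nonisolated (induced (~: S))| <= M.*2 ->
    (forall v : L, deg v <= 1) -> 0 < M ->
  #|nonisolated L| <= M.-1.*2.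
Proof.
move=> iS leSB dS nS dL M0; rewrite leqNgt; apply/negP => ltM; case/negP: freeF.
apply: contains_joined iS leSB _ => //.
have [e [lee isoL]] := matching_normal_form dL.
have [e' [lee' isoS]] := matching_normal_form dS.
apply: contains_trans (iso_contains isoS) _.
apply: contains_trans (iso_contains (iso_sym isoL)).
move: ltM nS; rewrite (iso_nonisolated isoL) (iso_nonisolated isoS).
rewrite !card_nonisolated_matching // => ltM nS.
apply: contains_matching; last first.
  by rewrite -leq_double; apply: leq_trans nS _; rewrite leq_double -(prednK M0) -ltn_double.
by apply: leq_trans leFL; rewrite card_induced max_card.
Qed.

End ForbiddenParts.

(** * Near-regular graphs *)

Section Circulant.
Variables (n' a : nat) (extra : bool).
Let n := n'.+1.
Let h := n./2.
Local Open Scope ring_scope.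

Definition short_diff (d : 'I_n) : bool := (0 < d <= a)%N.

(* x is joined to x +- 1, ..., x +- a modulo n and, when extra holds, also to
   the opposite point x + h; the matching {x, x + h}, x < h, misses at most the
   last point. *)
Definition circulant_adj : rel 'I_n := fun x y =>
  (short_diff (x - y) || short_diff (y - x)) ||
  extra && ((val y == x + h)%N && (x < h)%N || (val x == y + h)%N && (y < h)%N).

Fact circulant_sym : symmetric circulant_adj.
Proof.
move=> x y; rewrite /circulant_adj [short_diff _ || _]orbC.
by congr (_ || (_ && _)); rewrite orbC.
Qed.

Fact circulant_irrefl : irreflexive circulant_adj.
Proof.
move=> x; rewrite /circulant_adj subrr /short_diff /= orbb.
have [ltx|] := ltnP x h; last by rewrite !andbF.
by rewrite !andbT -[X in X == _]addn0 eqn_add2l eq_sym gtn_eqF ?andbF // (leq_ltn_trans _ ltx).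
Qed.

Definition circulant : sgraph := SGraph circulant_sym circulant_irrefl.

Hypothesis lea : (2 * a + 2 <= n)%N.

Let ltah : (a < h)%N. Proof. by rewrite /h; lia. Qed.
Let lehn : (h + h <= n)%N. Proof. by rewrite /h; lia. Qed.

Lemma card_short_diff : #|[set d | short_diff d]| = a.
Proof.
have lean : (a <= n')%N by move: lea; rewrite /n; lia.
pose f (i : 'I_a) : 'I_n := inord i.+1.
have vf i : f i = i.+1 :> nat.
  by rewrite /= inordK // ltnS; apply: leq_trans (ltn_ord i) lean.
have fi : injective f by move=> i j /(congr1 (@nat_of_ord n)); rewrite !vf => -[] /ord_inj.
rewrite -[RHS]card_ord -cardsT -(card_imset _ fi); apply: eq_card => d.
rewrite !inE; apply/idP/imsetP=> [/andP[d0 da]|[i _ ->]]; last by rewrite /short_diff vf /=.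
have ltd : (d.-1 < a)%N by rewrite prednK.
exists (Ordinal ltd); rewrite ?inE //; by apply: val_inj; rewrite /= -[RHS]/(nat_of_ord (f _)) vf /= prednK.
Qed.

Lemma valN (d : 'I_n) : d != 0 -> val (- d) = (n - d)%N.
Proof.
move=> d0; rewrite /= modn_small // ltn_subLR ?(ltnW (ltn_ord d)) //.
by rewrite -[X in (X < _)%N]add0n ltn_add2r lt0n; exact: d0.
Qed.

Lemma short_diffN (d : 'I_n) : short_diff d -> ~~ short_diff (- d).
Proof.
move=> /andP[d0 da]; rewrite /short_diff valN -?val_eqE -?lt0n //.
apply/negP => /andP[_]; rewrite leq_subLR => le1.
have := leq_trans lea (leq_trans le1 (leq_add da (leqnn a))).
by rewrite mul2n -addnn -[X in (_ <= X)%N]addn0 leq_add2l.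
Qed.

Lemma card_near (x : 'I_n) : #|[set y | short_diff (x - y) || short_diff (y - x)]| = (2 * a)%N.
Proof.
have -> : [set y | short_diff (x - y) || short_diff (y - x)] =
    [set y | short_diff (x - y)] :|: [set y | short_diff (y - x)].
  by apply/setP=> y; rewrite !inE.
rewrite cardsU disjoint_setI0 ?cards0 ?subn0; last first.
  rewrite disjoints_subset; apply/subsetP=> y; rewrite !inE => /short_diffN.
  by rewrite opprB.
have c1 : #|[set y | short_diff (x - y)]| = a.
  rewrite -[RHS]card_short_diff.
  have i1 : injective (fun y => x - y) by move=> y z /addrI/oppr_inj.
  rewrite -(card_imset _ i1); apply: eq_card => d; rewrite inE.
  apply/imsetP/idP => [[y + ->]|sd]; first by rewrite inE.
  by exists (x - d); rewrite ?inE opprB addrC subrK.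
have c2 : #|[set y | short_diff (y - x)]| = a.
  rewrite -[RHS]card_short_diff.
  have i1 : injective (fun y => y - x) by move=> y z /addIr.
  rewrite -(card_imset _ i1); apply: eq_card => d; rewrite inE.
  apply/imsetP/idP => [[y + ->]|sd]; first by rewrite inE.
  by exists (d + x); rewrite ?inE addrK.
by rewrite c1 c2 mul2n addnn.
Qed.

Lemma not_near (x y : 'I_n) : (val y = x + h)%N ->
  (short_diff (x - y) || short_diff (y - x)) = false.
Proof.
move=> ey; pose d : 'I_n := inZp h.
have ltxh : (x + h < n)%N by rewrite -ey; apply: ltn_ord.
have vd : val d = h by rewrite /= modn_small // (leq_ltn_trans _ ltxh) // leq_addl.
have ed : y - x = d.
  suff -> : y = x + d by rewrite addrC addKr.
  by apply: val_inj; rewrite ey -[RHS]/((x + val d) %% n)%N vd modn_small.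
have d0 : d != 0 by rewrite -val_eqE vd -lt0n (leq_ltn_trans _ ltah).
rewrite -[x - y]opprB ed /short_diff valN // vd.
by apply/negbTE; rewrite negb_or !negb_and -!ltnNge; move: ltah lehn; lia.
Qed.

Lemma deg_circulant (x : circulant) : deg x = (2 * a + (extra && (x < h + h)))%N.
Proof.
rewrite -(card_near x) /deg.
pose Y := [set y : 'I_n | extra && ((val y == x + h)%N && (x < h)%N || (val x == y + h)%N && (y < h)%N)].
have -> : [set u | adj x u] = [set y | short_diff (x - y) || short_diff (y - x)] :|: Y.
  by apply/setP=> y; rewrite !inE.
rewrite cardsU disjoint_setI0 ?cards0 ?subn0; last first.
  rewrite disjoint_sym disjoints_subset; apply/subsetP=> y; rewrite !inE.
  case/andP=> _ /orP[]/andP[/eqP e _]; apply/negbT; first exact: not_near.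
  by rewrite orbC; apply: not_near.
congr (_ + _)%N; rewrite /Y; case: extra => /=; last first.
  by apply/eqP; rewrite cards_eq0; apply/eqP/setP=> y; rewrite !inE.
have [ltx|gex] := ltnP x (h + h); last first.
  apply/eqP; rewrite cards_eq0; apply/eqP/setP=> y; rewrite !inE.
  apply/negbTE; rewrite negb_or !negb_and -!leqNgt.
  have := ltn_ord y; move: gex; rewrite -/n.
  by case: eqP => e1; case: eqP => e2; rewrite ?orbT ?orbF //=; lia.
apply/eqP/cards1P.
have [ltxh|gexh] := ltnP x h.
  have lty : (x + h < n)%N by apply: leq_trans lehn; rewrite ltn_add2r.
  exists (Ordinal lty); apply/setP=> y; rewrite !inE -val_eqE /= andbT.
  by case: eqP => //= ne; apply/negbTE/negP => /andP[/eqP e _]; lia.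
have lty : (x - h < n)%N by rewrite ltn_subLR // (leq_trans ltx) // (leq_trans lehn) // leq_addl.
exists (Ordinal lty); apply/setP=> y; rewrite !inE -val_eqE /= andbF /=.
by apply/andP/eqP => [[/eqP -> _]|->]; rewrite ?addnK // subnK // ltn_subLR.
Qed.

End Circulant.

Lemma near_regular_exists l n : 2 * l + 2 <= n ->
  exists L : sgraph, #|L| = n /\ near_regular l L.
Proof.
case: n => [|n'] ltl; first by rewrite addn2 in ltl.
exists (circulant n' l./2 (odd l)); rewrite card_ord; split=> //.
have lea : 2 * l./2 + 2 <= n'.+1 by lia.
rewrite /near_regular card_ord oddM; have [ol|el] /= := boolP (odd l); last first.
  by move=> u; rewrite deg_circulant //= addn0; lia.
case: ifP => on; last by move=> u; rewrite deg_circulant //=; have := ltn_ord u; lia.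
exists (ord_max : circulant n' l./2 (odd l)).
  by rewrite deg_circulant //= ; lia.
move=> u nu; rewrite deg_circulant //=; have := ltn_ord u.
have : nat_of_ord u != n' by rewrite -[X in _ != X]/(nat_of_ord (@ord_max n')).
by rewrite !uphalf_half (negPf on); lia.
Qed.

Section NearRegular.
Variables (R : realType) (w : nat -> R) (l : nat).
Hypothesis w_lt : forall x y, x < y -> (w x < w y)%R.
Local Open Scope ring_scope.

Definition near_regular_sum (n : nat) : R :=
  if odd (l * n) then w (l - 1)%N + w l *+ n.-1 else w l *+ n.

Let w_le x y : (x <= y)%N -> w x <= w y.
Proof. by rewrite leq_eqVlt => /predU1P[->//|/w_lt/ltW]. Qed.

Lemma near_regular_le (L : sgraph) (x : L) : near_regular l L -> (deg x <= l)%N.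
Proof.
rewrite /near_regular; case: ifP => _ => [[v dv dL]|->//].
by have [->|/dL ->//] := eqVneq x v; rewrite dv leq_subr.
Qed.

Lemma sum_near_regular (L : sgraph) : near_regular l L ->
  \sum_(x : L) w (deg x) = near_regular_sum #|L|.
Proof.
rewrite /near_regular /near_regular_sum; case: ifP => _ => [[v dv dL]|dL].
  rewrite (bigD1 v) //= dv; congr (_ + _).
  rewrite (eq_bigr (fun=> w l)) => [|u nuv]; last by rewrite dL.
  by rewrite sumr_const cardC1.
by rewrite (eq_bigr (fun=> w l)) => [|u _]; rewrite ?dL // sumr_const.
Qed.

Lemma sum_bounded_deg (L : sgraph) : (forall x : L, deg x <= l)%N ->
  \sum_(x : L) w (deg x) <= near_regular_sum #|L| /\
  (\sum_(x : L) w (deg x) = near_regular_sum #|L| -> near_regular l L).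
Proof.
move=> dL; rewrite /near_regular /near_regular_sum; case: ifP => [ol|_].
  have [v nv] : exists v : L, (deg v < l)%N.
    apply/existsP; apply: contraLR ol => /existsPn h.
    have -> : (l * #|L|)%N = (\sum_(x : L) deg x)%N; last by rewrite odd_sum_deg.
    rewrite (eq_bigr (fun=> l)) => [|x _]; first by rewrite sum_nat_const mulnC.
    by apply/eqP; rewrite eqn_leq dL leqNgt h.
  have dv : (deg v <= l - 1)%N by rewrite subn1 -ltnS (ltn_predK nv).
  have wv := w_le dv.
  have sumE : \sum_(x : L | x != v) w l = w l *+ #|L|.-1 by rewrite sumr_const cardC1.
  have wrest : \sum_(x : L | x != v) w (deg x) <= w l *+ #|L|.-1.
    by rewrite -sumE; apply: ler_sum => x _; apply: w_le.
  rewrite (bigD1 v) //=; split; first exact: lerD.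
  move=> e; exists v.
    apply/eqP; rewrite eqn_leq dv leqNgt; apply/negP => /w_lt.
    move: e wrest; move: (\sum_(x | _) _) (w l *+ _) => X Y; lra.
  move=> u nuv; apply/eqP; rewrite eqn_leq dL leqNgt; apply/negP => /w_lt ltu.
  have : \sum_(x : L | x != v) w (deg x) < w l *+ #|L|.-1.
    rewrite -sumE (bigD1 u) //= [X in _ < X](bigD1 u) //=; apply: ltr_leD => //.
    by apply: ler_sum => x _; apply: w_le.
  move: e wv; move: (\sum_(x | _) _) (w l *+ _) => X Y; lra.
have sumE : \sum_(x : L) w l = w l *+ #|L| by rewrite sumr_const.
rewrite -sumE; split; first by apply: ler_sum => x _; apply: w_le.
move=> e u; apply/eqP; rewrite eqn_leq dL leqNgt; apply/negP => /w_lt ltu.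
have : \sum_(x : L) w (deg x) < \sum_(x : L) w l.
  rewrite (bigD1 u) //= [X in _ < X](bigD1 u) //=; apply: ltr_leD => //.
  by apply: ler_sum => x _; apply: w_le.
by rewrite e ltxx.
Qed.

End NearRegular.

Section FinishNearRegular.
Variables (R : realType) (p : R) (F : sgraph) (b l : nat).
Hypothesis p_gt1 : (1 < p)%R.
Hypothesis freeJ : forall H : sgraph, (forall x : H, deg x <= l) ->
  Defs.free F (gjoin (complete b) H).

Let w (d : nat) : R := dpow p (b + d).
Let w_lt x y : x < y -> (w x < w y)%R.
Proof. by move=> xy; apply: dpow_lt; rewrite // ltn_add2l. Qed.

Lemma e_p_join_near_regular (H : sgraph) : near_regular l H ->
  (e_p p (gjoin (complete b) H) =
   b%:R * dpow p (b + #|H|).-1 + near_regular_sum w l #|H|)%R.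
Proof. by move=> nrH; rewrite e_p_join_complete -(sum_near_regular w nrH). Qed.

Lemma maximal_join_near_regular (G : sgraph) (B : {set G}) n :
    #|G| = n -> b + (2 * l + 2) <= n -> joined B -> #|B| = b -> ep_maximal p F G ->
    (forall x : induced (~: B), deg x <= l) ->
  in_calL n b l G.
Proof.
move=> cG len jB cB maxG dL.
have leb : b <= n by apply: leq_trans len; apply: leq_addr.
have [H [cH nrH]] := @near_regular_exists l (n - b) ltac:(by rewrite leq_subRL).
have freeH := freeJ (fun x => near_regular_le x nrH).
have cL : #|induced (~: B)| = n - b by rewrite card_induced cardsCs setCK cB cG.
have [leS eqS] := sum_bounded_deg w_lt dL.
have [||fullB eqS'] := maximal_join p_gt1 jB cB _ freeH maxG.
- by rewrite cH cG subnKC.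
- by rewrite -[leRHS]/(\sum_(y : H) w (deg y))%R (sum_near_regular w nrH) cH -cL.
exists (induced (~: B)); split=> //.
  by apply: eqS; rewrite cL -cH -(sum_near_regular w nrH); exact: eqS'.
apply: (iso_join_complete cB jB fullB).
by exists id => //; exists id.
Qed.

Lemma near_regular_extremal n (G : sgraph) :
    b <= n ->
    (forall G' : sgraph, extremal p n F G' -> in_calL n b l G') ->
    in_calL n b l G -> extremal p n F G.
Proof.
move=> leb ext [L [cL nrL isoG]].
have cG : #|G| = n by rewrite (iso_card isoG) card_join_complete cL subnKC.
have freeG := free_iso (iso_sym isoG) (freeJ (fun x => near_regular_le x nrL)).
split=> //; have [G' extG'] := ex_p_attained p cG freeG.
have [L' [cL' nrL' isoG']] := ext _ extG'; case: extG' => _ _ <-.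
rewrite (e_p_iso p isoG) (e_p_iso p isoG') !e_p_join_near_regular // cL cL'.
by [].
Qed.

End FinishNearRegular.

(** * Spiders *)

Section SpiderPositions.
Variable ls : seq nat.
Notation V := (spider ls).
Notation len i := (nth 0 ls (@nat_of_ord (size ls) i)).

Definition leg_vertex (i : 'I_(size ls)) (j : 'I_(len i)) : V :=
  Some (Tagged (fun i : 'I_(size ls) => 'I_(nth 0 ls i)) j).

(* Past the end of leg i this is None, that is, the centre. *)
Definition spos (i : 'I_(size ls)) (d : nat) : V :=
  if d is d'.+1 then obind (@leg_vertex i) (insub d') else None.

Arguments spos : simpl never.

Definition sdist (x : V) : nat := if x is Some u then (tagged u).+1 else 0.

Lemma sposS (i : 'I_(size ls)) (j : 'I_(len i)) : spos i j.+1 = leg_vertex j.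
Proof. by rewrite /spos /= insubT //= => lt; congr leg_vertex; apply: val_inj. Qed.

Lemma sdist_spos i d : d <= len i -> sdist (spos i d) = d.
Proof. by case: d => // d ltd; rewrite (sposS (Ordinal ltd)). Qed.

Lemma spos_inj i i' d d' : 0 < d <= len i -> d' <= len i' ->
  spos i d = spos i' d' -> i = i' /\ d = d'.
Proof.
move=> /andP[d0 led] led' e.
have ed : d = d' by rewrite -(sdist_spos led) e sdist_spos.
split=> //; subst d'; case: d d0 led led' e => // d _ led led'.
by rewrite (sposS (Ordinal led)) (sposS (Ordinal led')) => -[->].
Qed.

Lemma adj_sdist (x y : V) : adj x y -> sdist y = (sdist x).+1 \/ sdist x = (sdist y).+1.
Proof.
rewrite /= /spider_adj; case: x y => [[i j]|] [[i' j']|] //=.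
- case/orP=> /andP[_ /eqP e]; [left|right]; by rewrite /= -e.
- by move/eqP=> ->; right.
- by rewrite orbF => /eqP ->; left.
Qed.

Lemma adj_spos i d : d < len i -> adj (spos i d) (spos i d.+1).
Proof.
move=> ltd; rewrite (sposS (Ordinal ltd)) /= /spider_adj.
case: d ltd => [|d] ltd //.
by rewrite (sposS (Ordinal (ltnW ltd))) /= !eqxx.
Qed.

Lemma spider_adjP (x y : V) : adj x y -> exists i d, d < len i /\
  ((x = spos i d /\ y = spos i d.+1) \/ (y = spos i d /\ x = spos i d.+1)).
Proof.
wlog suff W : x y / spider_succ x y -> exists i d, d < len i /\ (x = spos i d /\ y = spos i d.+1).
  rewrite /= /spider_adj => /orP[]/W[i [d [ltd e]]]; exists i, d; split=> //.
    by left.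
  by right.
case: y => [[i j]|]; last by case: x.
case: x => [[i' j']|] /=.
  case/andP=> /eqP e; case: i / e j => j /eqP /= e.
  exists i', j'.+1; split; first by rewrite e ltn_ord.
  by split; [exact/esym/sposS|rewrite e; exact/esym/sposS].
move=> /eqP /= e; exists i, 0; split; first exact: leq_ltn_trans (ltn_ord j).
by split=> //; have := sposS j; rewrite e => ->.
Qed.

End SpiderPositions.

Arguments spos : simpl never.

Lemma count_pairs (Q : nat -> bool) a q :
  (forall k, k < q -> Q (a + k.*2) || Q (a + k.*2).+1) ->
  q <= \sum_(a <= d < a + q.*2) Q d.
Proof.
elim: q => [|q IHq] hQ; first by rewrite big_geq // addn0.
rewrite doubleS !addnS !big_nat_recr /= ?leq_addr //; last first.
  by rewrite -addnS leq_addr.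
rewrite -addnA -addn1; apply: leq_add; first by apply: IHq => k /ltnW; apply: hQ.
by have := hQ q (leqnn _); case: (Q _) => //=; case: (Q _).
Qed.

Lemma count_from (Q : nat -> bool) a l : a <= l.+1 ->
    (forall d, a <= d < l -> odd d = odd a -> Q d || Q d.+1) ->
  (l.+1 - a)./2 <= \sum_(a <= d < l.+1) Q d.
Proof.
move=> leal hQ; set q := (l.+1 - a)./2.
have leq : a + q.*2 <= l.+1.
  by rewrite -leq_subRL // /q -[leqRHS]odd_double_half leq_addl.
apply: leq_trans (@count_pairs Q a q _) _.
  move=> k ltk; apply: hQ; last by rewrite oddD odd_double addbF.
  by rewrite leq_addr /=; move: leq ltk; clear; lia.
by rewrite (big_cat_nat _ leq) ?leq_addr //= leq_addr.
Qed.

Lemma sum_odd l : \sum_(1 <= d < l.+1) odd d = uphalf l.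
Proof.
elim: l => [|l IHl]; first by rewrite big_geq.
by rewrite big_nat_recr //= IHl; case ol: (odd l); rewrite ?uphalf_half; lia.
Qed.

Lemma sum_even l : \sum_(1 <= d < l.+1) ~~ odd d = l./2.
Proof.
elim: l => [|l IHl]; first by rewrite big_geq.
by rewrite big_nat_recr //= IHl; case ol: (odd l); rewrite ?uphalf_half; lia.
Qed.

Section SpiderCounts.
Variable ls : seq nat.
Notation V := (spider ls).
Notation len i := (nth 0 ls (@nat_of_ord (size ls) i)).

Lemma card_spider (S : {set V}) : #|S| = ((None : V) \in S) +
  \sum_(i < size ls) \sum_(1 <= d < (len i).+1) (spos i d \in S).
Proof.
pose S' := [set u : {i : 'I_(size ls) & 'I_(len i)} | (Some u : V) \in S].
have -> : #|S| = ((None : V) \in S) + #|S'|.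
  rewrite (cardsD1 (None : V)); congr (_ + _).
  have si : injective (Some : {i : 'I_(size ls) & 'I_(len i)} -> V) by move=> u v [].
  rewrite -(card_imset _ si); apply: eq_card => -[u|]; rewrite !inE /=.
    by apply/idP/imsetP => [uS|[v + [->]]]; [exists u; rewrite ?inE|rewrite inE].
  by apply/esym/negbTE/imsetP => -[].
congr (_ + _); transitivity (\sum_(u : {i : 'I_(size ls) & 'I_(len i)}) (leg_vertex (tagged u) \in S)).
  by rewrite -sum1dep_card big_mkcond; apply: eq_bigr => -[i j] _; rewrite /=; case: (_ \in S).
rewrite -(sig_big_dep xpredT (fun _ => xpredT)
  (fun (i : 'I_(size ls)) (j : 'I_(len i)) => nat_of_bool (leg_vertex j \in S))) /=.
apply: eq_bigr => i _; rewrite big_add1 /= big_mkord.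
by apply: eq_bigr => j _; rewrite sposS.
Qed.

Definition spider_set (c : bool) (P : 'I_(size ls) -> nat -> bool) : {set V} :=
  [set x : V | if x is Some u then P (tag u) (tagged u).+1 else c].

Lemma in_spider_set0 c P i : (spos i 0 \in spider_set c P) = c.
Proof. by rewrite inE. Qed.

Lemma in_spider_set c P i d : 0 < d <= len i ->
  (spos i d \in spider_set c P) = P i d.
Proof. by case: d => // d /andP[_ ltd]; rewrite inE (sposS (Ordinal ltd)). Qed.

Lemma card_spider_set c P : #|spider_set c P| =
  c + \sum_(i < size ls) \sum_(1 <= d < (len i).+1) P i d.
Proof.
rewrite card_spider inE; congr (_ + _); apply: eq_bigr => i _.
by apply: eq_big_nat => d ltd; rewrite in_spider_set.
Qed.

Definition parity_class (o : bool) : {set V} := [set x | odd (sdist x) == o].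

Lemma parity_class_cover o : indep_cover (parity_class o).
Proof.
apply/andP; split; apply/forallP=> x; apply/forallP=> y; apply/implyP=> /adj_sdist;
  by rewrite !inE => -[]->; rewrite /=; case: odd; case: o.
Qed.

Lemma in_parity_class o i d : d <= len i -> (spos i d \in parity_class o) = (odd d == o).
Proof. by move=> led; rewrite inE sdist_spos. Qed.

Lemma card_parity_class_even :
  #|parity_class false| = (\sum_(i < size ls) (len i)./2).+1.
Proof.
rewrite card_spider inE /= add1n; congr _.+1; apply: eq_bigr => i _.
rewrite -sum_even; apply: eq_big_nat => d /andP[_ led].
by rewrite in_parity_class // eqbF_neg.
Qed.

Lemma card_parity_class_odd :
  #|parity_class true| = \sum_(i < size ls) uphalf (len i).
Proof.
rewrite card_spider inE /= add0n; apply: eq_bigr => i _.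
rewrite -sum_odd; apply: eq_big_nat => d /andP[_ led].
by rewrite in_parity_class // eqb_id.
Qed.

Lemma spider_forest_depth : forest_depth (@sdist ls).
Proof.
move=> x y z /spider_adjP[i [d [ltd exy]]] /spider_adjP[i' [d' [ltd' exz]]].
case: exy => [[ex ey]|[ey ex]]; subst.
  by rewrite !sdist_spos ?(ltnW ltd) // ltnn.
case: exz => [[ex ez]|[ez ex]]; subst.
  by move=> _; rewrite ex !sdist_spos ?(ltnW ltd') // ltnn.
by have [-> [->]] := @spos_inj _ i i' d.+1 d'.+1 ltd ltd' ex.
Qed.

Lemma spider_nbr i d (y : V) : 0 < d <= len i -> adj (spos i d) y ->
  y = spos i d.-1 \/ (d < len i /\ y = spos i d.+1).
Proof.
move=> hd /spider_adjP[i' [d' [ltd' [[ex ->]|[-> ex]]]]].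
  by have [ei ed] := spos_inj hd (ltnW ltd') ex; subst; right.
by have [ei ed] := spos_inj hd ltd' ex; subst; left.
Qed.

Lemma spider_nbr0 (y : V) : adj (None : V) y -> exists i, 0 < len i /\ y = spos i 1.
Proof.
move=> /spider_adjP[i [d [ltd [[ex ->]|[-> ex]]]]].
  case: d ltd ex => [|d] ltd ex; first by exists i.
  by have := @spos_inj _ i i d.+1 0 (ltnW ltd) isT (esym ex) => -[].
by have := @spos_inj _ i i d.+1 0 ltd isT (esym ex) => -[].
Qed.

Lemma deg_spos_le2 i d : 0 < d <= len i -> deg (spos i d) <= 2.
Proof.
move=> hd; apply: (@leq_trans #|[set spos i d.-1; spos i d.+1]|); last first.
  by rewrite cards2; case: eqP.
apply/subset_leq_card/subsetP => y; rewrite !inE => /(spider_nbr hd)[->|[_ ->]];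
  by rewrite eqxx ?orbT.
Qed.

Lemma deg_spos_end i : 0 < len i -> deg (spos i (len i)) <= 1.
Proof.
move=> hl; rewrite -(cards1 (spos i (len i).-1)).
apply/subset_leq_card/subsetP => y; rewrite !inE => /spider_nbr[|->|[]].
- by rewrite hl leqnn.
- by [].
- by rewrite ltnn.
Qed.

Lemma deg_center_le : deg (None : V) <= size ls.
Proof.
apply: (@leq_trans #|[set spos i 1 | i : 'I_(size ls)]|); last first.
  by apply: leq_trans (leq_imset_card _ _) _; rewrite card_ord.
apply/subset_leq_card/subsetP => y; rewrite inE => /spider_nbr0[i [_ ->]].
exact: imset_f.
Qed.

Lemma deg_center_ge : all (fun l => 0 < l) ls -> size ls <= deg (None : V).
Proof.
move=> /allP pos; have pos_i i : 0 < len i by apply/pos/mem_nth.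
have fi : injective (fun i : 'I_(size ls) => spos i 1).
  by move=> i i' e; have [] := @spos_inj _ i i' 1 1 (pos_i i) (pos_i i') e.
rewrite -[leqLHS]card_ord -cardsT -(card_imset _ fi).
apply/subset_leq_card/subsetP => _ /imsetP[i _ ->]; rewrite inE.
exact: (@adj_spos _ i 0).
Qed.

Lemma card_spider_vertices : #|V| = (\sum_(i < size ls) len i).+1.
Proof.
rewrite -cardsT card_spider inE add1n; congr _.+1; apply: eq_bigr => i _.
rewrite (eq_bigr (fun=> 1)) => [|d _]; last by rewrite inE.
by rewrite sum_nat_const_nat muln1 subn1.
Qed.

Definition spider_tau : nat := \sum_(i < size ls) (len i)./2 + ~~ even_legged ls.

Lemma card_by_legs (S : {set V}) i1 e :
    (forall i, i != i1 -> (len i)./2 <= \sum_(1 <= d < (len i).+1) (spos i d \in S)) ->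
    (len i1)./2 + e <= ((None : V) \in S) + \sum_(1 <= d < (len i1).+1) (spos i1 d \in S) ->
  \sum_(i < size ls) (len i)./2 + e <= #|S|.
Proof.
move=> h h1; rewrite card_spider (bigD1 i1) //= [X in _ <= _ + X](bigD1 i1) //= addnAC addnA.
by apply: leq_add => //; apply: leq_sum.
Qed.

End SpiderCounts.

Section MatchingOutside.
Variables (G : sgraph) (S : {set G}).

Definition matching_outside : Prop := forall x y z,
  x \notin S -> y \notin S -> z \notin S -> adj x y -> adj x z -> y = z.

Definition leaves_matching (M : nat) : Prop :=
  [/\ indep S, matching_outside &
      exists2 D : {set G}, #|D| <= M.*2 &
        forall x y, x \notin S -> y \notin S -> adj x y -> x \in D].

Lemma induced_deg_le1 : matching_outside <-> forall x : induced (~: S), deg x <= 1.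
Proof.
split=> [mS x|dS x y z xS yS zS axy axz].
  have xS : val x \notin S by have := valP x; rewrite inE.
  rewrite deg_induced; apply/card_le1_eqP => y z; rewrite !inE.
  by case/andP=> yS axy /andP[zS axz]; apply: mS xS zS yS axz axy.
have xS' : x \in ~: S by rewrite inE.
have := dS (Sub x xS' : {x | x \in ~: S}); rewrite deg_induced => /card_le1_eqP; apply.
  by rewrite !inE zS.
by rewrite !inE yS.
Qed.

Lemma leaves_matching_nonisolated M : leaves_matching M ->
  #|nonisolated (induced (~: S))| <= M.*2.
Proof.
case=> _ _ [D cD hD]; apply: leq_trans cD.
rewrite -(card_imset _ val_inj); apply: subset_leq_card.
apply/subsetP=> _ /imsetP[x + ->]; rewrite inE => /card_gt0P[y]; rewrite inE => axy.
have := valP x; have := valP y; rewrite !inE => yS xS.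
exact: hD xS yS axy.
Qed.

Lemma nonisolated_outside x y : x \notin S -> y \notin S -> adj x y ->
  exists2 u : induced (~: S), val u = x & u \in nonisolated (induced (~: S)).
Proof.
move=> xS yS axy; have xS' : x \in ~: S by rewrite inE.
have yS' : y \in ~: S by rewrite inE.
exists (Sub x xS' : {x | x \in ~: S}) => //; rewrite inE.
exact: (@deg_gt0 (induced (~: S)) _ (Sub y yS' : {x | x \in ~: S})).
Qed.

Lemma card_nonisolated_outside (D : {set G}) :
    (forall x, x \in D -> exists2 y, x \notin S /\ y \notin S & adj x y) ->
  #|D| <= #|nonisolated (induced (~: S))|.
Proof.
move=> hD; rewrite -(card_imset _ val_inj); apply: subset_leq_card.
apply/subsetP=> x /hD[y [xS yS] axy].
by have [u <- uN] := nonisolated_outside xS yS axy; apply: imset_f.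
Qed.

End MatchingOutside.

Lemma cover_minus_two_leaves (G : sgraph) (T : {set G}) (x y : G) :
    indep_cover T -> x \in T -> y \in T -> x != y -> deg x <= 1 -> deg y <= 1 ->
    (forall z, adj x z -> ~~ adj y z) ->
  leaves_matching (T :\ x :\ y) 2 /\ #|T :\ x :\ y|.+2 = #|T|.
Proof.
move=> covT xT yT nxy dx dy noz.
have cT : #|T :\ x :\ y|.+2 = #|T|.
  by rewrite (cardsD1 x T) xT (cardsD1 y (T :\ x)) !inE eq_sym nxy yT.
split=> //; split.
- apply: indepS (indep_cover_indep covT); apply: subset_trans (subsetDl _ _) (subsetDl _ _).
- have xyP u : u \in T -> u \notin T :\ x :\ y -> u = x \/ u = y.
    rewrite !inE => ->; rewrite andbT negb_and !negbK.
    by case/orP=> /eqP; [right|left].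
  move=> u v w uS vS wS auv auw; have [uT|uT] := boolP (u \in T).
    by case: (xyP u uT uS) auv auw => -> auv auw;
      [apply: (deg_le1_uniq dx auv auw)|apply: (deg_le1_uniq dy auv auw)].
  have := xyP v (indep_coverE covT auv uT) vS.
  have := xyP w (indep_coverE covT auw uT) wS.
  rewrite adj_sym in auv; rewrite adj_sym in auw.
  move=> [ew|ew] [ev|ev]; subst => //.
    by have := noz u auw; rewrite auv.
  by have := noz u auv; rewrite auw.
exists ([set x; y] :|: ([set z | adj x z] :|: [set z | adj y z])).
  rewrite (@leq_trans (#|[set x; y]| + (deg x + deg y))) //.
    apply: leq_trans (leq_card_setU _ _) _; rewrite leq_add2l.
    exact: leq_card_setU.
  by rewrite cards2 nxy; exact: (leq_add (leqnn 2) (leq_add dx dy)).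
move=> u v uS vS auv; rewrite !inE; have [uT|uT] := boolP (u \in T).
  by move: uS; rewrite !inE uT andbT negb_and !negbK orbC => ->.
have vT := indep_coverE covT auv uT.
rewrite adj_sym in auv; move: vS; rewrite !inE vT andbT negb_and !negbK.
by case/orP=> /eqP ev; rewrite -ev auv !orbT.
Qed.

Lemma sum_nat_1_3 (f : nat -> nat) : \sum_(1 <= d < 4) f d = f 1 + (f 2 + f 3).
Proof. by rewrite -[index_iota 1 4]/[:: 1; 2; 3] !big_cons big_nil addn0. Qed.

Section SpiderBounds.
Variable ls : seq nat.
Notation V := (spider ls).
Notation len i := (nth 0 ls (@nat_of_ord (size ls) i)).
Variable S : {set V}.

Let share (i : 'I_(size ls)) := \sum_(1 <= d < (len i).+1) (spos i d \in S).

Lemma leg_share i : (forall d, 1 <= d < len i -> odd d ->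
    (spos i d \in S) || (spos i d.+1 \in S)) -> (len i)./2 <= share i.
Proof.
move=> h; have := @count_from (fun d => spos i d \in S) 1 (len i) isT.
by rewrite subn1 => /(_ _) -> // d hd od; apply: h; rewrite ?od.
Qed.

Lemma leg_share_shifted i : odd (len i) -> (forall d, 2 <= d < len i -> ~~ odd d ->
    (spos i d \in S) || (spos i d.+1 \in S)) -> (len i)./2 <= share i.
Proof.
move=> ol h; have l0 : 0 < len i by case: (len i) ol.
have := @count_from (fun d => spos i d \in S) 2 (len i) l0 _.
have -> : ((len i).+1 - 2)./2 = (len i)./2.
  by rewrite -(odd_double_half (len i)) ol /= subSS; lia.
move=> c; rewrite /share big_ltn ?ltnS //; apply: leq_trans (leq_addl _ _).
by apply: c => d hd od; apply: h; rewrite ?od.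
Qed.

Lemma leg_share_center i : (forall d, d < len i -> ~~ odd d ->
    (spos i d \in S) || (spos i d.+1 \in S)) ->
  uphalf (len i) <= ((None : V) \in S) + share i.
Proof.
move=> h; have := @count_from (fun d => spos i d \in S) 0 (len i) isT.
rewrite subn0 /= big_ltn // => c; apply: c => d hd od; apply: h => //.
by rewrite od.
Qed.

Lemma odd_leg_exists : ~~ even_legged ls -> exists i : 'I_(size ls), odd (len i).
Proof.
by case/allPn=> l /(nthP 0)[i lti <-]; rewrite negbK => ol; exists (Ordinal lti).
Qed.

Lemma even_legP i : even_legged ls -> ~~ odd (len i).
Proof. by move=> /allP; apply; apply: mem_nth. Qed.

Lemma odd_legP i : odd_legged ls -> odd (len i).
Proof. by move=> /allP; apply; apply: mem_nth. Qed.

Lemma tau_le_almost_cover i0 d0 :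
    (forall i d, d < len i -> (i, d) != (i0, d0) ->
      (spos i d \in S) || (spos i d.+1 \in S)) ->
    even_legged ls \/ odd_legged ls /\ 1 < size ls ->
  spider_tau ls <= #|S|.
Proof.
move=> cov pure.
have std i : i != i0 -> (len i)./2 <= share i.
  move=> ni; apply: leg_share => d /andP[_ ltd] _; apply: cov => //.
  by rewrite xpair_eqE (negPf ni).
rewrite /spider_tau; case: pure => [ev|[od sz2]].
  rewrite ev; apply: (@card_by_legs _ S i0 0 std); rewrite addn0.
  have [od0|ev0] := boolP (odd d0).
    have := @leg_share_center i0; rewrite uphalf_half (negPf (even_legP _ ev)).
    apply=> d ltd ed; apply: cov => //; rewrite xpair_eqE eqxx.
    by apply: contraNneq ed => ->.
  apply: leq_trans (leq_addl _ _); apply: leg_share => d /andP[_ ltd] ed; apply: cov => //.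
  by rewrite xpair_eqE eqxx; apply: contraNneq ev0 => <-.
have [i1 ni1] : exists i1, i1 \in [set~ i0].
  by apply/card_gt0P; rewrite cardsC1 card_ord -ltnS prednK // ltnW.
rewrite !inE in ni1.
apply: leq_trans (_ : \sum_(i < size ls) (len i)./2 + 1 <= _).
  by rewrite leq_add2l; case: even_legged.
apply: (@card_by_legs _ S i1) => [i _|]; last first.
  have := @leg_share_center i1; rewrite uphalf_half odd_legP // addn1; apply=> d ltd _.
  by apply: cov; rewrite // xpair_eqE (negPf ni1).
have [->|/std //] := eqVneq i i0.
have [od0|ev0] := boolP (odd d0).
  apply: leg_share_shifted; first exact: odd_legP.
  move=> d /andP[_ ltd] ed; apply: cov => //.
  by rewrite xpair_eqE eqxx; apply: contraNneq ed => ->.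
apply: leg_share => d /andP[_ ltd] ed; apply: cov => //.
by rewrite xpair_eqE eqxx; apply: contraNneq ev0 => <-.
Qed.

Lemma tau_le_cover : 0 < size ls ->
    (forall i d, d < len i -> (spos i d \in S) || (spos i d.+1 \in S)) ->
  spider_tau ls <= #|S|.
Proof.
move=> sz cov.
have std i : (len i)./2 <= share i.
  by apply: leg_share => d /andP[_ ltd] _; apply: cov.
rewrite /spider_tau; have [ev|/odd_leg_exists[i1 od]] := boolP (even_legged ls).
  apply: (@card_by_legs _ S (Ordinal sz)) => [//|].
  by rewrite addn0; apply: leq_trans (leq_addl _ _).
apply: (@card_by_legs _ S i1) => [//|].
have := @leg_share_center i1; rewrite uphalf_half od addn1; apply=> d ltd _.
exact: cov.
Qed.

Lemma count_legs l : count_mem l ls = #|[set i : 'I_(size ls) | len i == l]|.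
Proof.
rewrite -sum1_count (big_nth 0) big_mkord sum1dep_card.
by apply: eq_card => i; rewrite !inE.
Qed.

Section Legs13.
Hypothesis legs13 : forall l, l \in ls -> l = 1 \/ l = 3.
Hypothesis sz : 0 < size ls.
Hypothesis mS : matching_outside S.

Lemma len13 i : len i = 1 \/ len i = 3.
Proof. by apply: legs13; apply: mem_nth. Qed.

Let share13 i : (len i)./2 <= share i.
Proof.
rewrite /share; case: (len13 i) => el; rewrite el //=.
have a d : d < 3 -> adj (spos i d) (spos i d.+1) by move=> ltd; apply: adj_spos; rewrite el.
rewrite sum_nat_1_3.
have [|n1] := boolP (spos i 1 \in S) => //; have [|n2] := boolP (spos i 2 \in S) => //.
have [|n3] := boolP (spos i 3 \in S) => //.
have a21 : adj (spos i 2) (spos i 1) by rewrite adj_sym a.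
have e13 := mS n2 n1 n3 a21 (a 2 isT).
have si := @spos_inj _ i i 1 3; rewrite el in si.
by have [] := si isT isT e13.
Qed.

Lemma tau13 : spider_tau ls = \sum_(i < size ls) (len i)./2 + 1.
Proof.
rewrite /spider_tau; congr (_ + _); case ev: (even_legged ls) => //.
by have := even_legP (Ordinal sz) ev; case: (len13 (Ordinal sz)) => ->.
Qed.

Lemma tau_le_matching13 : 1 < count_mem 1 ls -> spider_tau ls <= #|S|.
Proof.
rewrite count_legs => /card_gt1P[i1 [i2 []]]; rewrite !inE => /eqP l1 /eqP l2 n12.
rewrite tau13.
have [s1|] := leqP 1 (((None : V) \in S) + share i1).
  by apply: (@card_by_legs _ S i1) => //; rewrite [X in X./2]l1.
have [s2 _|] := leqP 1 (share i2).
  apply: (@card_by_legs _ S i2) => //; rewrite [X in X./2]l2.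
  exact: leq_trans (leq_addl _ _).
rewrite /share l1 l2 !big_nat1.
case n2 : (_ \in S) => // _; case n0 : (_ \in S) => //; case n1 : (_ \in S) => // _.
have a1 : adj (None : V) (spos i1 1) by apply: (@adj_spos _ i1 0); rewrite l1.
have a2 : adj (None : V) (spos i2 1) by apply: (@adj_spos _ i2 0); rewrite l2.
have e12 := mS (negbT n0) (negbT n1) (negbT n2) a1 a2.
have [e _] := @spos_inj _ i1 i2 1 1 ltac:(by rewrite l1) ltac:(by rewrite l2) e12.
by rewrite e eqxx in n12.
Qed.

Lemma size_le_nonisolated13 : #|S| < spider_tau ls ->
  (size ls).*2 <= #|nonisolated (induced (~: S))|.
Proof.
rewrite tau13 => ltS.
have n0 : (None : V) \notin S.
  apply/negP => cS; move: ltS; rewrite ltnNge => /negP; apply.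
  by apply: (@card_by_legs _ S (Ordinal sz)) => //; rewrite cS addnC leq_add2l.
have eshare i : share i = (len i)./2.
  apply/eqP; rewrite eqn_leq share13 andbT leqNgt; apply/negP => lts.
  move: ltS; rewrite ltnNge => /negP; apply.
  by apply: (@card_by_legs _ S i) => //; rewrite addn1; apply: leq_trans (leq_addl _ _).
(* The uncovered edge of leg i joins the positions e i and (e i).+1. *)
pose e i := if (spos i 1 \in S) then 2 else 0.
have he i : [/\ e i < len i, spos i (e i) \notin S & spos i (e i).+1 \notin S].
  rewrite /e; have := eshare i; rewrite /share; case: (len13 i) => el; rewrite el.
    by rewrite big_nat1; case h1: (spos i 1 \in S) => //= _; rewrite h1.
  rewrite sum_nat_1_3.
  by case n1: (spos i 1 \in S); case n2: (spos i 2 \in S); case n3: (spos i 3 \in S) => //;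
    rewrite ?n1 ?n2 ?n3 ?n0.
have ae i : adj (spos i (e i)) (spos i (e i).+1) by apply: adj_spos; case: (he i).
pose D := [set spos i (e i) | i : 'I_(size ls)] :|: [set spos i (e i).+1 | i : 'I_(size ls)].
apply: (@leq_trans #|D|); last first.
  apply: card_nonisolated_outside => x; rewrite inE => /orP[]/imsetP[i _ ->].
    by have [_ h1 h2] := he i; exists (spos i (e i).+1).
  by have [_ h1 h2] := he i; exists (spos i (e i)) => //; rewrite adj_sym.
have inj2 : injective (fun i => spos i (e i).+1).
  move=> i i' eq_ii; have [lti _ _] := he i; have [lti' _ _] := he i'.
  by have [] := @spos_inj _ i i' (e i).+1 (e i').+1 lti lti' eq_ii.
have inj1 : injective (fun i => spos i (e i)).
  move=> i i' eq_ii; have [_ _ h1] := he i; have [_ h0 h1'] := he i'.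
  apply: inj2; apply: (mS h0 h1 h1' _ (ae i')).
  by rewrite -eq_ii.
have disj : [disjoint [set spos i (e i) | i : 'I_(size ls)] & [set spos i (e i).+1 | i : 'I_(size ls)]].
  rewrite disjoints_subset; apply/subsetP=> _ /imsetP[i _ ->]; rewrite inE.
  apply/imsetP => -[i' _ eq_ii].
  have [lti _ _] := he i; have [lti' _ _] := he i'.
  have := congr1 (@sdist ls) eq_ii; rewrite !sdist_spos ?(ltnW lti) // /e.
  by do 2!case: ifP.
rewrite cardsU disjoint_setI0 // cards0 subn0 !card_imset //.
by rewrite card_ord addnn.
Qed.

End Legs13.

End SpiderBounds.

Section SpiderSets.
Variable ls : seq nat.
Notation V := (spider ls).
Notation len i := (nth 0 ls (@nat_of_ord (size ls) i)).

Lemma matching_outside_edges (S : {set V}) (E : 'I_(size ls) -> nat -> Prop) :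
    (forall i d, d < len i -> spos i d \notin S -> spos i d.+1 \notin S -> E i d) ->
    (forall i i' d d', E i d -> E i' d' -> d <> d'.+1) ->
    (forall i i' d, d < len i -> d < len i' -> E i d -> E i' d ->
      spos i d = spos i' d -> i = i') ->
  matching_outside S.
Proof.
move=> unc disj uniq x y z xS yS zS.
move=> /spider_adjP[i [d [ltd exy]]] /spider_adjP[i' [d' [ltd' exz]]].
have sd j c : c <= len j -> sdist (spos j c) = c by apply: sdist_spos.
case: exy => [[ex ey]|[ey ex]]; case: exz => [[ez ex']|[ex' ez]]; subst.
- have ed : d = d' by rewrite -(sd i d (ltnW ltd)) ez sd // ltnW.
  subst d'; rewrite (uniq i i' d) //; first exact: unc.
  by apply: unc; rewrite // -ez.
- have ed : d = d'.+1 by rewrite -(sd i d (ltnW ltd)) ez sd.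
  case: (disj i i' d d') => //; first exact: unc.
  by apply: unc; rewrite // -ez.
- have ed : d' = d.+1 by rewrite -(sd i' d' (ltnW ltd')) -ez sd.
  case: (disj i' i d' d) => //; last exact: unc.
  by apply: unc; rewrite // -ez.
- have ed : d.+1 = d'.+1 by rewrite -(sd i d.+1 ltd) ez sd.
  by have [-> [->]] := @spos_inj _ i i' d.+1 d'.+1 ltd ltd' ez.
Qed.

Lemma card_set_seq (T : finType) (s : seq T) : #|[set x in s]| <= size s.
Proof. by rewrite cardsE; apply: card_size. Qed.

Lemma even_legged_leaves_matching : spider_notation ls -> even_legged ls ->
  exists S : {set V}, leaves_matching S 2 /\ #|S|.+1 = spider_tau ls.
Proof.
move=> /and4P[sz /allP pos n2 sz2] ev.
have ev_i i : ~~ odd (len i) by apply: even_legP.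
have len2 i : 2 <= len i.
  have : 0 < len i by apply/pos/mem_nth.
  by move: (ev_i i); case: (len i) => [|[]].
pose T := parity_class ls false.
have cT : #|T| = (spider_tau ls).+1 by rewrite card_parity_class_even /spider_tau ev addn0.
have covT : indep_cover T := parity_class_cover ls false.
have endT i : spos i (len i) \in T by rewrite in_parity_class // eqbF_neg.
have dend i : deg (spos i (len i)) <= 1 by apply: deg_spos_end; apply: ltnW.
have nend i z : adj (spos i (len i)) z -> z = spos i (len i).-1.
  by case/spider_nbr=> [|//|[]]; rewrite ?leqnn ?ltnn // andbT ltnW.
have finish x y : x \in T -> y \in T -> x != y -> deg x <= 1 -> deg y <= 1 ->
    (forall z, adj x z -> ~~ adj y z) ->
    exists S : {set V}, leaves_matching S 2 /\ #|S|.+1 = spider_tau ls.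
  move=> xT yT nxy dx dy noz; exists (T :\ x :\ y).
  have [lm c] := cover_minus_two_leaves covT xT yT nxy dx dy noz.
  by split=> //; apply/eqP; rewrite -eqSS c cT.
have [k2|] := ltnP 1 (size ls).
  pose i0 := Ordinal sz; pose i1 := Ordinal k2.
  have nspos d d' : 0 < d <= len i0 -> d' <= len i1 -> spos i0 d <> spos i1 d'.
    by move=> hd hd' /(spos_inj hd hd')[] /(congr1 val).
  apply: (finish (spos i0 (len i0)) (spos i1 (len i1))) => //.
    by apply/eqP/nspos; rewrite ?leqnn // andbT ltnW.
  move=> z /nend ->; apply/negP => /nend.
  have h0 : 0 < (len i0).-1 by have := len2 i0; case: (len i0) => [|[]].
  by apply: nspos; rewrite ?leq_pred // h0.
move=> k1; have k1' : size ls = 1 by apply/eqP; rewrite eqn_leq k1 sz.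
pose i0 := Ordinal sz.
have len4 : 4 <= len i0.
  have : len i0 != 2.
    apply: contra n2; rewrite /i0 /=; case: (ls) k1' => [|l [|]] //= _ /eqP ->.
    by [].
  by move: (len2 i0) (ev_i i0); case: (len i0) => [|[|[|[|]]]].
apply: (finish (spos i0 0) (spos i0 (len i0))) => //.
- by rewrite in_parity_class.
- apply/eqP => /esym e0.
  have hl : 0 < len i0 <= len i0 by rewrite leqnn ltnW.
  by have [_ el] := spos_inj hl (leq0n (len i0)) e0; move: len4; rewrite el.
- by apply: leq_trans (deg_center_le ls) _.
move=> z /spider_nbr0[i [_ ->]]; apply/negP => /nend e1.
have [_ el] := @spos_inj _ i i0 1 (len i0).-1 (ltnW (len2 i)) (leq_pred _) e1.
by move: el len4; case: (len i0) => [|[|[]]].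
Qed.

Lemma odd_legged_leaves_matching i0 : odd_legged ls -> 5 <= len i0 ->
  exists S : {set V}, leaves_matching S 2 /\ #|S|.+1 = spider_tau ls.
Proof.
move=> od l5; pose l := len i0.
have ol : odd l by apply: odd_legP.
pose P (i : 'I_(size ls)) d := if i == i0 then odd d && (1 < d < l) else ~~ odd d.
pose S := spider_set true P.
have inS i d : 0 < d <= len i -> (spos i d \in S) = P i d by apply: in_spider_set.
have inS0 i : spos i 0 \in S by rewrite in_spider_set0.
exists S; split; last first.
  have oddls : even_legged ls = false.
    by apply/negP => /(even_legP i0); rewrite (odd_legP i0 od).
  rewrite card_spider_set /spider_tau oddls addn1 add1n; congr _.+1.
  rewrite (bigD1 i0) //= [RHS](bigD1 i0) //= -addSn; congr (_ + _).
    have -> : \sum_(1 <= d < l.+1) P i0 d = \sum_(2 <= d < l) odd d.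
      rewrite big_ltn; last by rewrite ltnS ltnW // (leq_trans _ l5).
      rewrite big_nat_recr /=; last by rewrite (leq_trans _ l5).
      rewrite /P eqxx /= ltnn !andbF addn0 add0n.
      by apply: eq_big_nat => d ->; rewrite andbT.
    have := sum_odd l; rewrite big_ltn; last by rewrite ltnS (leq_trans _ l5).
    rewrite big_nat_recr /=; last by rewrite (leq_trans _ l5).
    rewrite ol uphalf_half ol; lia.
  apply: eq_bigr => i ni; rewrite -sum_even; apply: eq_bigr => d _.
  by rewrite /P (negPf ni).
have unc i d : d < len i -> spos i d \notin S -> spos i d.+1 \notin S ->
    i = i0 /\ (d = 1 \/ d.+1 = l).
  case: d => [|d] ltd; first by rewrite inS0.
  rewrite !inS ?(ltnW ltd) // /P; case: eqP => [ei|_]; last by rewrite /= negbK => ->.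
  rewrite ei -/l in ltd; move=> h1 h2; split=> //; move: h1 h2 ltd; rewrite /=.
  case od1 : (odd d) => /=.
    by move=> _; rewrite -leqNgt => gel ltd; right; apply/eqP; rewrite eqn_leq ltd.
  by case: d {od1} => [|d] h1 _ ltd; [left|rewrite ltd in h1].
split.
- move=> x y xS yS; apply/negP => /spider_adjP[i [d [ltd exy]]].
  have [h1 h2] : spos i d \in S /\ spos i d.+1 \in S by case: exy => -[<- <-].
  move: h2; rewrite inS // /P; case: d ltd h1 {exy} => [|d] ltd h1 /=.
    by case: ifP.
  rewrite inS ?(ltnW ltd) // /P /= in h1.
  by move: h1; case: eqP => _; case: (odd d).
- apply: (matching_outside_edges unc) => [i i' d d' [_ hd] [_ hd']|i i' d _ _ [-> _] [-> _] //].
  by move: hd hd' l5; rewrite -/l; lia.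
exists [set x in [:: spos i0 1; spos i0 2; spos i0 l.-1; spos i0 l]].
  exact: card_set_seq.
have inD d : d = 1 \/ d.+1 = l ->
    spos i0 d \in [:: spos i0 1; spos i0 2; spos i0 l.-1; spos i0 l] /\
    spos i0 d.+1 \in [:: spos i0 1; spos i0 2; spos i0 l.-1; spos i0 l].
  by case=> [->|<-]; rewrite !inE !eqxx ?orbT.
move=> x y xS yS /spider_adjP[i [d [ltd [[ex ey]|[ey ex]]]]]; subst; rewrite inE.
  by have [-> /inD[]] := unc i d ltd xS yS.
by have [-> /inD[]] := unc i d ltd yS xS.
Qed.

Lemma legs13_leaves_matching :
    0 < size ls -> (forall l, l \in ls -> l = 1 \/ l = 3) -> count_mem 1 ls <= 1 ->
  exists S : {set V}, leaves_matching S (size ls) /\ #|S|.+1 = spider_tau ls.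
Proof.
move=> sz legs13 c1.
pose S := spider_set false (fun (i : 'I_(size ls)) d => (d == 1) && (len i == 3)).
have inS i d : 0 < d <= len i -> (spos i d \in S) = (d == 1) && (len i == 3).
  exact: in_spider_set.
have l13 i := @len13 ls legs13 i.
exists S; split; last first.
  rewrite card_spider_set (tau13 legs13 sz) add0n addn1; congr _.+1.
  apply: eq_bigr => i _; case: (l13 i) => ->; first by rewrite big_nat1.
  by rewrite sum_nat_1_3.
have unc i d : d < len i -> spos i d \notin S -> spos i d.+1 \notin S ->
    d = (if len i == 3 then 2 else 0).
  move=> ltd; rewrite (inS i d.+1) //; case: d ltd => [|d] ltd; last rewrite inS ?(ltnW ltd) //;
    by move: ltd; case: (l13 i) => -> //; move: d => [|[|[|]]].
split.
- move=> x y xS yS; apply/negP => /spider_adjP[i [d [ltd exy]]].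
  have [h1 h2] : spos i d \in S /\ spos i d.+1 \in S by case: exy => -[<- <-].
  move: h2; rewrite inS // eqSS; case: d ltd h1 {exy} => [|d] ltd h1 //=.
  by rewrite in_spider_set0 in h1.
- apply: (matching_outside_edges unc) => [i i' d d' -> ->|i i' d ltd ltd' ed ed' eii].
    by case: ifP; case: ifP.
  move: ltd ltd' eii; case: d ed ed' => [|d] ed ed' ltd ltd' eii; last first.
    by have [] := @spos_inj _ i i' d.+1 d.+1 (ltnW ltd) (ltnW ltd') eii.
  have l1 j : 0 = (if len j == 3 then 2 else 0) -> j \in [set i : 'I_(size ls) | len i == 1].
    by rewrite inE; case: (l13 j) => ->.
  by move: c1; rewrite count_legs => /card_le1_eqP; apply; apply: l1.
pose e (i : 'I_(size ls)) := if len i == 3 then 2 else 0.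
exists ([set spos i (e i) | i : 'I_(size ls)] :|: [set spos i (e i).+1 | i : 'I_(size ls)]).
  apply: leq_trans (leq_card_setU _ _) _; rewrite -addnn; apply: leq_add;
    by apply: leq_trans (leq_imset_card _ _) _; rewrite card_ord.
move=> x y xS yS /spider_adjP[i [d [ltd [[ex ey]|[ey ex]]]]]; subst; rewrite inE.
  by rewrite (unc i d ltd xS yS) imset_f.
by rewrite [X in _ || X](_ : _ = true) ?orbT // (unc i d ltd yS xS) (imset_f (fun i => spos i (e i).+1)).
Qed.

End SpiderSets.

(** * Disjoint unions *)

Section NatMin.
Variables (I : finType) (P : pred I) (f : I -> nat).

Lemma nat_min_le i : P i -> nat_min P f <= f i.
Proof.
rewrite /nat_min -big_filter => Pi.
have : i \in [seq i <- index_enum I | P i] by rewrite mem_filter Pi mem_index_enum.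
elim: [seq i <- index_enum I | P i] => //= j s IHs; rewrite inE big_cons.
by case/predU1P=> [<-|/IHs le]; rewrite geq_min ?leqnn ?le ?orbT.
Qed.

Lemma nat_min_attained i : P i -> exists2 j, P j & f j = nat_min P f.
Proof.
move=> Pi; have [j Pj minj] := arg_minnP f Pi; exists j => //.
apply/eqP; rewrite eqn_leq nat_min_le // andbT /nat_min.
elim/big_ind: _ => [|x y jx jy|k Pk]; last exact: minj.
  exact: leq_bigmax_cond.
by rewrite leq_min jx.
Qed.

End NatMin.

Lemma tau_le (G : sgraph) (A : {set G}) : indep_cover A -> tau G <= #|A|.
Proof. exact: (@nat_min_le _ (@indep_cover G) (fun A => #|A|)). Qed.

Lemma tau_attained (G : sgraph) (A : {set G}) : indep_cover A ->
  exists2 T : {set G}, indep_cover T & #|T| = tau G.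
Proof. exact: (@nat_min_attained _ (@indep_cover G) (fun A => #|A|)). Qed.

Section Union.
Variables (I : finType) (G : I -> sgraph).
Let U := gunion G.

Definition gin (i : I) (x : G i) : U := Tagged (fun i => G i) x.

Lemma gin_inj i : injective (@gin i).
Proof. by move=> x y /eqP; rewrite -tag_eqE /tag_eq /= eqxx /= tagged_asE => /eqP. Qed.

Lemma adj_gin i (x y : G i) : adj (gin x) (gin y) = adj x y.
Proof. by rewrite /= /gunion_adj /= eqxx tagged_asE. Qed.

Lemma adj_ginP i (x : G i) (u : U) : adj (gin x) u -> exists2 y, u = gin y & adj x y.
Proof.
case: u => j y; rewrite /= /gunion_adj /= => /andP[/eqP e].
by case: j / e y => y; rewrite tagged_asE; exists y.
Qed.

Lemma ginP (u : U) : exists i (x : G i), u = gin x.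
Proof. by case: u => i x; exists i, x. Qed.

Definition gset (T : forall i, {set G i}) : {set U} := [set u | tagged u \in T (tag u)].
Definition slice (S : {set U}) i : {set G i} := [set x | gin x \in S].

Lemma in_gset T i (x : G i) : (gin x \in gset T) = (x \in T i).
Proof. by rewrite inE. Qed.

Lemma gset_slice S : gset (slice S) = S.
Proof. by apply/setP => u; have [i [x ->]] := ginP u; rewrite in_gset inE. Qed.

Lemma card_gset (T : forall i, {set G i}) : #|gset T| = \sum_i #|T i|.
Proof.
transitivity (\sum_(u : U) (tagged u \in T (tag u))).
  by rewrite -sum1dep_card big_mkcond; apply: eq_bigr => u _; case: (_ \in _).
rewrite -(sig_big_dep xpredT (fun=> xpredT) (fun i (x : G i) => nat_of_bool (x \in T i))) /=.
by apply: eq_bigr => i _; rewrite -sum1_card [RHS]big_mkcond; apply: eq_bigr => x _; case: (_ \in _).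
Qed.

Lemma card_slices (S : {set U}) : #|S| = \sum_i #|slice S i|.
Proof. by rewrite -card_gset gset_slice. Qed.

Lemma gset_cover T : (forall i, indep_cover (T i)) -> indep_cover (gset T).
Proof.
move=> cT; apply/andP; split; apply/forallP=> u; apply/forallP=> v; apply/implyP;
  have [i [x ->]] := ginP u => /adj_ginP[y -> axy]; rewrite !in_gset.
  have /andP[/forallP/(_ x)/forallP/(_ y)/implyP h _] := cT i; exact: h.
have /andP[_ /forallP/(_ x)/forallP/(_ y)/implyP h] := cT i; exact: h.
Qed.

Lemma slice_cover S i : indep_cover S -> indep_cover (slice S i).
Proof.
case/andP=> /forallP h1 /forallP h2.
apply/andP; split; apply/forallP=> x; apply/forallP=> y; apply/implyP=> axy; rewrite !inE.
  by have /forallP/(_ (gin y))/implyP := h1 (gin x); apply; rewrite adj_gin.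
by have /forallP/(_ (gin y))/implyP := h2 (gin x); apply; rewrite adj_gin.
Qed.

Lemma tau_gunion : (forall i, exists T : {set G i}, indep_cover T) ->
  tau U = \sum_i tau (G i).
Proof.
move=> ex; have hT i : exists T : {set G i}, indep_cover T && (#|T| == tau (G i)).
  by have [A cA] := ex i; have [T cT cardT] := tau_attained cA; exists T; rewrite cT cardT eqxx.
pose T i := xchoose (hT i).
have cT i : indep_cover (T i) by have /andP[] := xchooseP (hT i).
have cardT i : #|T i| = tau (G i) by have /andP[_ /eqP] := xchooseP (hT i).
have covT := gset_cover cT.
apply/eqP; rewrite eqn_leq; apply/andP; split.
  by apply: leq_trans (tau_le covT) _; rewrite card_gset; apply: leq_sum => i _; rewrite cardT.
have [S cS <-] := tau_attained covT.
by rewrite card_slices; apply: leq_sum => i _; apply/tau_le/slice_cover.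
Qed.

Lemma deg_gin i (x : G i) : deg (gin x) <= deg x.
Proof.
rewrite /deg -[leqRHS](card_imset _ (@gin_inj i)); apply/subset_leq_card/subsetP => u.
by rewrite inE => /adj_ginP[y -> axy]; apply: imset_f; rewrite inE.
Qed.

Lemma gunion_forest_depth (dp : forall i, G i -> nat) :
  (forall i, forest_depth (dp i)) -> forest_depth (fun u : U => dp (tag u) (tagged u)).
Proof.
move=> dpP u v w; have [i [x ->]] := ginP u.
by move=> /adj_ginP[y -> axy] /adj_ginP[z -> axz] /= h1 h2; rewrite (dpP i x y z).
Qed.

Lemma gset_leaves_matching T i0 M : leaves_matching (T i0) M ->
  (forall i, i != i0 -> indep_cover (T i)) -> leaves_matching (gset T) M.
Proof.
move=> [iT mT [D cD hD]] cT.
have out i (x y : G i) : x \notin T i -> y \notin T i -> adj x y -> i = i0.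
  move=> xT yT axy; apply/eqP; apply: contraNT yT => ni.
  exact: indep_coverE (cT i ni) axy xT.
split.
- move=> u v; have [i [x ->]] := ginP u; rewrite in_gset => xT vT.
  apply/negP => /adj_ginP[y ev axy]; subst; rewrite in_gset in vT.
  have [ei|/cT/indep_cover_indep ind] := eqVneq i i0; last by have := ind x y xT vT; rewrite axy.
  by subst; have := iT x y xT vT; rewrite axy.
- move=> u v w; have [i [x ->]] := ginP u; rewrite !in_gset => xT vT wT.
  move=> /adj_ginP[y ev axy] /adj_ginP[z ew axz]; subst; rewrite !in_gset in vT wT.
  have ei := out i x y xT vT axy; subst.
  by rewrite (mT x y z).
exists (@gin i0 @: D); first by rewrite card_imset //; apply: gin_inj.
move=> u v; have [i [x ->]] := ginP u; rewrite !in_gset => xT vT.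
move=> /adj_ginP[y ev axy]; subst; rewrite !in_gset in vT.
have ei := out i x y xT vT axy; subst.
exact/imset_f/(hD x y).
Qed.

Lemma contains_induced_slice S i : contains (induced (~: slice S i)) (induced (~: S)).
Proof.
have h (x : induced (~: slice S i)) : gin (val x) \in ~: S.
  by have := valP x; rewrite !inE.
apply/containsP; exists (fun x => Sub (gin (val x)) (h x) : {x | x \in ~: S}).
split=> [x y [] /gin_inj/val_inj //|x y].
by move=> axy; rewrite -[adj _ _]/(adj (gin (val x)) (gin (val y))) adj_gin.
Qed.

Lemma contains_join_component b (H : sgraph) (c : I -> nat) :
    contains U (gjoin (complete b) H) -> b < \sum_i c i ->
  exists i (S : {set G i}), #|S| < c i /\ contains (induced (~: S)) H.
Proof.
case/contains_join_complete=> S leS cSH ltb.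
have [i lti] : exists i, #|slice S i| < c i.
  apply/existsP; apply: contraLR ltb => /existsPn h; rewrite -leqNgt.
  by apply: leq_trans leS; rewrite card_slices; apply: leq_sum => i _; rewrite leqNgt.
exists i, (slice S i); split=> //.
exact: contains_trans (contains_induced_slice S i) cSH.
Qed.

End Union.

Section SpiderTau.
Variable ls : seq nat.
Notation V := (spider ls).
Notation len i := (nth 0 ls (@nat_of_ord (size ls) i)).

Definition spider_cover : {set V} := parity_class ls (even_legged ls).

Lemma spider_cover_indep : indep_cover spider_cover.
Proof. exact: parity_class_cover. Qed.

Lemma card_spider_cover : #|spider_cover| = spider_tau ls.
Proof.
rewrite /spider_cover /spider_tau; case ev: (even_legged ls); last first.
  by rewrite card_parity_class_even addn1.
rewrite card_parity_class_odd addn0; apply: eq_bigr => i _.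
by rewrite uphalf_half (negPf (even_legP i ev)).
Qed.

Lemma tau_spider : 0 < size ls -> tau V = spider_tau ls.
Proof.
move=> sz; apply/eqP; rewrite eqn_leq -[X in _ <= X]card_spider_cover.
rewrite tau_le ?spider_cover_indep //=.
have [T covT <-] := tau_attained spider_cover_indep.
apply: tau_le_cover sz _ => i d ltd; apply/orP.
have [|nS] := boolP (spos i d \in T); [by left|right].
exact: indep_coverE covT (adj_spos ltd) nS.
Qed.

Lemma sum_half_legs : \sum_(i < size ls) (len i)./2 = \sum_(l <- ls) l %/ 2.
Proof. by rewrite [RHS](big_nth 0) big_mkord; apply: eq_bigr => i _; rewrite divn2. Qed.

Lemma spider_tau_gt0 : spider_notation ls -> 0 < spider_tau ls.
Proof.
move=> /and4P[sz /allP pos _ _]; rewrite /spider_tau.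
case ev: (even_legged ls); last by rewrite addn1.
rewrite (bigD1 (Ordinal sz)) //= -addnA ltn_addr //.
have := even_legP (Ordinal sz) ev; have : 0 < nth 0 ls 0 by apply/pos/mem_nth.
by rewrite /=; case: (nth 0 ls 0) => [|[]].
Qed.

Lemma spider_tau_le1 : spider_notation ls -> spider_tau ls <= 1 -> all (pred1 1) ls.
Proof.
move=> /and4P[sz /allP pos n2 sz2]; rewrite /spider_tau.
have pos_i i : 0 < len i by apply/pos/mem_nth.
have [ev|od] := boolP (even_legged ls); last first.
  rewrite addn1 ltnS leqn0 sum_nat_eq0 => /forallP h.
  apply/(all_nthP 0) => i lti; have := h (Ordinal lti); have := pos_i (Ordinal lti).
  by rewrite /=; case: (nth 0 ls i) => [|[]].
have half i : 0 < (len i)./2.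
  by have := pos_i i; have := even_legP i ev; case: (len i) => [|[]].
rewrite addn0 => le1; have k1 : size ls <= 1.
  apply: leq_trans le1; rewrite -[leqLHS]card_ord -sum1_card.
  by apply: leq_sum => i _; apply: half.
have k1' : size ls = 1 by apply/eqP; rewrite eqn_leq k1.
rewrite (bigD1 (Ordinal sz)) //= in le1.
have h1 : (nth 0 ls 0)./2 <= 1 := leq_trans (leq_addr _ _) le1.
have h2 : ~~ odd (nth 0 ls 0) := even_legP (Ordinal sz) ev.
have h3 : 0 < nth 0 ls 0 := pos_i (Ordinal sz).
move: k1' n2 h1 h2 h3; clear; case: ls => [|l [|]] //= _.
by case: l => [|[|[|[|l]]]].
Qed.

Lemma iso_spider_star : all (pred1 1) ls -> iso V (star (size ls)).
Proof.
move=> /(all_nthP 0) ones; have l1 i : len i = 1 by apply/eqP/ones.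
pose g (u : star (size ls)) : V := match u with inl _ => None | inr i => spos i 1 end.
have sd (i : 'I_(size ls)) : sdist (spos i 1) = 1 by apply: sdist_spos; rewrite l1.
have gi : injective g.
  move=> [i|i] [j|j] //= e.
  - by rewrite (ord1 i) (ord1 j).
  - by have := sd j; rewrite -e.
  - by have := sd i; rewrite e.
  - by have [->] := @spos_inj _ i j 1 1 ltac:(by rewrite l1) ltac:(by rewrite l1) e.
apply: iso_sym; exists g.
  apply: inj_card_bij => //; rewrite card_join_complete card_spider_vertices.
  rewrite card_ord (eq_bigr (fun=> 1)) => [|i _]; last exact: l1.
  by rewrite sum1_card card_ord.
have a i : adj (None : V) (spos i 1) by apply: (@adj_spos _ i 0); rewrite l1.
move=> [i|i] [j|j].
- by rewrite (ord1 i) (ord1 j) !adj_irrefl.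
- by rewrite a.
- by rewrite adj_sym a.
- by apply/negP => /adj_sdist; rewrite /= !sd => -[].
Qed.

Lemma is_star_spider : spider_notation ls -> (is_star V <-> all (pred1 1) ls).
Proof.
move=> nt; have /and4P[sz _ _ _] := nt; split=> [[q q1 [f fb fm]]|ones]; last first.
  by exists (size ls); [|apply: iso_spider_star].
apply: spider_tau_le1 => //.
pose S := [set x : V | if f x is inl _ then true else false].
have cS : #|S| <= 1.
  apply/card_le1_eqP => x y; rewrite !inE => hx hy; apply: (bij_inj fb).
  by move: hx hy; case: (f x) => // i; case: (f y) => // j _ _; rewrite (ord1 i) (ord1 j).
apply: leq_trans cS; apply: tau_le_cover => // i d ltd.
have := adj_spos ltd; rewrite -fm !inE.
by case: (f (spos i d)) => // u; case: (f (spos i d.+1)).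
Qed.

Lemma path_deg_le2 n (x : path_graph n) : deg x <= 2.
Proof.
apply: (@leq_trans #|[set y in pmap insub [:: x.-1; x.+1]] : {set 'I_n}|).
  apply/subset_leq_card/subsetP => y; rewrite !inE mem_pmap_sub !inE.
  by rewrite /= /path_adj => /orP[]/eqP <-; rewrite eqxx ?orbT.
by rewrite cardsE; apply: leq_trans (card_size _) _; rewrite size_pmap_sub; apply: count_size.
Qed.

Lemma is_odd_path_spider : spider_notation ls ->
  (is_odd_path V <-> size ls = 1 /\ odd (nth 0 ls 0)).
Proof.
move=> nt; have /and4P[sz pos n2 sz2] := nt; split=> [[l ol isoP]|[k1 ol]].
  have cl := iso_card isoP; rewrite card_ord card_spider_vertices in cl.
  have [f fb fm] := isoP.
  have := deg_center_ge pos; rewrite -(deg_iso _ fb fm) => /leq_trans/(_ (path_deg_le2 _)).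
  rewrite leq_eqVlt => /predU1P[k2|]; last first.
    rewrite ltnS => k1; have k1' : size ls = 1 by apply/eqP; rewrite eqn_leq k1.
    split=> //; move: cl ol; rewrite (bigD1 (Ordinal sz)) //= big1 ?addn0 => [[->]//|i].
    rewrite -val_eqE /=; have := ltn_ord i; rewrite [X in _ < X]k1'.
    by case: (nat_of_ord i).
  move: sz2; rewrite k2 /= => /eqP els; move: cl ol.
  have -> : \sum_(i < size ls) len i = sumn ls.
    by rewrite sumnE [RHS](big_nth 0) big_mkord.
  by rewrite els /= => -[<-].
pose i0 := Ordinal sz.
have isoP : iso (path_graph (len i0).+1) V; last first.
  by exists (len i0); [|apply: iso_sym].
pose g (d : path_graph (len i0).+1) : V := spos i0 d.
have sd (d : 'I_(len i0).+1) : sdist (spos i0 d) = d by rewrite sdist_spos // -ltnS.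
have gi : injective g by move=> d d' /(congr1 (@sdist ls)); rewrite !sd => /ord_inj.
exists g.
  apply: inj_card_bij => //; rewrite card_spider_vertices card_ord (bigD1 i0) //= big1 ?addn0 // => i.
  rewrite -val_eqE /=; have := ltn_ord i; rewrite [X in _ < X]k1.
  by case: (nat_of_ord i).
have a (d d' : 'I_(len i0).+1) : d.+1 = d' -> adj (g d) (g d').
  move=> e; rewrite /g -e; apply: adj_spos.
  by have := ltn_ord d'; rewrite -e ltnS.
move=> d d'; apply/idP/orP => [/adj_sdist|[]/eqP e].
- by rewrite /g !sd => -[] ->; [left|right].
- exact: a.
- by rewrite adj_sym; apply: a.
Qed.

End SpiderTau.

(** * Spider forests *)

Section SpiderForest.
Variables (t : nat) (ell : 'I_t -> seq nat).
Hypotheses (t_gt0 : 0 < t) (ntF : forall j, spider_notation (ell j)).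
Notation Fj := (fun j : 'I_t => spider (ell j)).
Let F := gunion Fj.

Lemma legs_gt0 j : 0 < size (ell j). Proof. by have /and4P[] := ntF j. Qed.

Lemma leg_gt0 j (i : 'I_(size (ell j))) : 0 < nth 0 (ell j) i.
Proof. by have /and4P[_ /allP pos _ _] := ntF j; apply/pos/mem_nth. Qed.

Definition forest_cover : {set F} := gset (fun j => spider_cover (ell j)).

Lemma forest_coverP : indep_cover forest_cover.
Proof. by apply: gset_cover => j; apply: spider_cover_indep. Qed.

Lemma tau_forest : tau F = \sum_j spider_tau (ell j).
Proof.
rewrite tau_gunion => [|j]; last by exists (spider_cover (ell j)); apply: spider_cover_indep.
by apply: eq_bigr => j _; rewrite tau_spider ?legs_gt0.
Qed.

Lemma card_forest_cover : #|forest_cover| = tau F.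
Proof. by rewrite card_gset tau_forest; apply: eq_bigr => j _; apply: card_spider_cover. Qed.

Lemma forest_forest_depth : exists dp : F -> nat, forest_depth dp.
Proof.
exists (fun u : F => sdist (tagged u)).
exact: (gunion_forest_depth (fun j => @spider_forest_depth (ell j))).
Qed.

Lemma forest_leaves_matching j0 (S0 : {set spider (ell j0)}) M :
    leaves_matching S0 M -> #|S0|.+1 = spider_tau (ell j0) ->
  exists S : {set F}, leaves_matching S M /\ #|S|.+1 = tau F.
Proof.
move=> lm c; pose T := dfwith (fun j => spider_cover (ell j)) S0.
exists (gset T); split.
  apply: (@gset_leaves_matching _ _ _ j0); first by rewrite /T dfwith_in.
  by move=> j nj; rewrite /T dfwith_out 1?eq_sym // spider_cover_indep.
rewrite card_gset tau_forest (bigD1 j0) //= [RHS](bigD1 j0) //= -c /T dfwith_in addSn.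
congr (_ + _).+1; apply: eq_bigr => j nj.
by rewrite dfwith_out 1?eq_sym // card_spider_cover.
Qed.

Lemma forest_sub_matching b m e : e.*2 <= m -> b < tau F ->
    contains F (gjoin (complete b) (matching m e)) ->
  exists j (S : {set spider (ell j)}), [/\ #|S| < spider_tau (ell j),
    matching_outside S & #|nonisolated (induced (~: S))| <= e.*2].
Proof.
rewrite tau_forest => lem ltb cF.
have [j [S [ltS cS]]] := contains_join_component cF ltb; exists j, S; split=> //.
  apply/induced_deg_le1; apply: contains_max_deg cS _ => y.
  by rewrite matching_deg // leq_b1.
by rewrite -(card_nonisolated_matching lem) contains_nonisolated.
Qed.

Lemma forest_free_edgeless b m : b < tau F -> Defs.free F (gjoin (complete b) (matching m 0)).
Proof.
move=> ltb; apply/negP => /(@forest_sub_matching b m 0 (leq0n m) ltb)[j [S [ltS _ n0]]].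
move: ltS; rewrite ltnNge => /negP; apply; apply: tau_le_cover (legs_gt0 j) _ => i d ltd.
apply/orP; have [|n1] := boolP (spos i d \in S); first by left.
have [|n2] := boolP (spos i d.+1 \in S); first by right.
have [u _ uN] := nonisolated_outside n1 n2 (adj_spos ltd).
by move: n0; rewrite leqn0 cards_eq0 => /eqP n0; rewrite n0 inE in uN.
Qed.

Lemma forest_free_one_edge b m : 2 <= m -> b < tau F ->
    (forall j, even_legged (ell j) \/ odd_legged (ell j) /\ 1 < size (ell j)) ->
  Defs.free F (gjoin (complete b) (matching m 1)).
Proof.
move=> m2 ltb pure; apply/negP => /(@forest_sub_matching b m 1 m2 ltb)[j [S [ltS mS n2]]].
have edge_eq (i : 'I_(size (ell j))) d (i' : 'I_(size (ell j))) d' : d < nth 0 (ell j) i -> d' < nth 0 (ell j) i' ->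
    spos i d \notin S -> spos i d.+1 \notin S ->
    spos i' d' \notin S -> spos i' d'.+1 \notin S -> (i, d) = (i', d').
  move=> ltd ltd' n1 n1' n3 n3'.
  pose D := [set spos i d; spos i d.+1; spos i' d'; spos i' d'.+1].
  have leD : #|D| <= 2.
    apply: leq_trans n2; apply: card_nonisolated_outside => x; rewrite !inE.
    case/orP=> [/orP[/orP[]|]|] /eqP ->.
    - by exists (spos i d.+1) => //; apply: adj_spos.
    - by exists (spos i d) => //; rewrite adj_sym; apply: adj_spos.
    - by exists (spos i' d'.+1) => //; apply: adj_spos.
    - by exists (spos i' d') => //; rewrite adj_sym; apply: adj_spos.
  have sa := sdist_spos (ltnW ltd); have sb : sdist (spos i d.+1) = d.+1 := sdist_spos ltd.
  have sc := sdist_spos (ltnW ltd'); have sd : sdist (spos i' d'.+1) = d'.+1 := sdist_spos ltd'.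
  have nab : spos i d != spos i d.+1.
    by apply: contraTneq (ltnSn d) => e; rewrite -{1}sa e sb ltnn.
  have eD : [set spos i d; spos i d.+1] = D.
    apply/eqP; rewrite eqEcard cards2 nab leD andbT.
    by apply/subsetP=> x; rewrite !inE => /orP[] ->; rewrite ?orbT.
  have : spos i' d' \in D by rewrite !inE eqxx ?orbT.
  have : spos i' d'.+1 \in D by rewrite !inE eqxx ?orbT.
  rewrite -eD !inE => /orP[]/eqP e1 /orP[]/eqP e2; subst.
  - by move: sd; rewrite e1 -e2 sc => /n_Sn.
  - by move: sd; rewrite e1 sa => e3; move: sc; rewrite e2 sb e3; lia.
  - by have [-> [->]] := @spos_inj _ i i' d.+1 d'.+1 ltd ltd' (esym e1).
  - by move: sd; rewrite e1 -e2 sc => /n_Sn.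
have [/forallP all_cov|/forallPn[i0 /forallPn[d0 unc]]] := boolP [forall i : 'I_(size (ell j)),
    forall d : 'I_(nth 0 (ell j) i), (spos i d \in S) || (spos i d.+1 \in S)].
  move: ltS; rewrite ltnNge => /negP; apply; apply: tau_le_cover (legs_gt0 j) _ => i d ltd.
  by have /forallP/(_ (Ordinal ltd)) := all_cov i.
move: unc; rewrite negb_or => /andP[n1 n1'].
move: ltS; rewrite ltnNge => /negP; apply.
apply: (@tau_le_almost_cover _ S i0 d0 _ (pure j)) => i d ltd ne.
apply: contraR ne; rewrite negb_or => /andP[n3 n3'].
by rewrite (edge_eq i d i0 d0).
Qed.

Lemma forest_free_matching13 b m e : e.*2 <= m -> b < tau F ->
    (forall j l, l \in ell j -> l = 1 \/ l = 3) ->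
    (forall j, count_mem 1 (ell j) <= 1 -> e < size (ell j)) ->
  Defs.free F (gjoin (complete b) (matching m e)).
Proof.
move=> lem ltb legs13 he; apply/negP => /(forest_sub_matching lem ltb)[j [S [ltS mS nS]]].
have [/he lte|gt1] := leqP (count_mem 1 (ell j)) 1.
  have := size_le_nonisolated13 (@legs13 j) (legs_gt0 j) mS ltS.
  by move=> /leq_trans/(_ nS); rewrite leq_double leqNgt lte.
by have := tau_le_matching13 (@legs13 j) (legs_gt0 j) mS gt1; rewrite leqNgt ltS.
Qed.

Lemma spider_tau_star j : all (pred1 1) (ell j) -> spider_tau (ell j) = 1.
Proof.
move=> /(all_nthP 0) ones; rewrite /spider_tau.
have -> : even_legged (ell j) = false.
  apply/negP => /(even_legP (Ordinal (legs_gt0 j))).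
  by have /eqP -> := ones _ (legs_gt0 j).
by rewrite big1 // => i _; have /eqP -> := ones _ (ltn_ord i).
Qed.

Lemma forest_free_stars b l (H : sgraph) : b < tau F ->
    (forall j, all (pred1 1) (ell j)) -> (forall j, l < size (ell j)) ->
    (forall x : H, deg x <= l) ->
  Defs.free F (gjoin (complete b) H).
Proof.
rewrite tau_forest => ltb ones ltl dH; apply/negP => cF.
have [j [S [ltS cS]]] := contains_join_component cF ltb.
move: ltS; rewrite spider_tau_star // ltnS leqn0 cards_eq0 => /eqP S0; subst S.
have cin : (None : spider (ell j)) \in ~: set0 by rewrite !inE.
have := contains_max_deg cS dH (Sub None cin : {x | x \in ~: set0}).
rewrite deg_induced /= (_ : deg_in _ _ = deg (None : spider (ell j))); last first.
  by rewrite setC0 deg_inT.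
rewrite leqNgt => /negP; apply.
apply: leq_trans (ltl j) _; apply: deg_center_ge.
by have /and4P[] := ntF j.
Qed.

Lemma star_forestP :
  \sum_(j < t) count_mem 1 (ell j) = \sum_(j < t) size (ell j) <->
  forall j, all (pred1 1) (ell j).
Proof.
split=> [e j|ones]; last first.
  by apply: eq_bigr => j _; apply/eqP; rewrite -all_count.
rewrite all_count eqn_leq count_size /= leqNgt; apply/negP => lt.
move: e; rewrite (bigD1 j) //= [RHS](bigD1 j) //= => /eqP; rewrite ltn_eqF //.
by rewrite -addSn leq_add // leq_sum // => i _; apply: count_size.
Qed.

Lemma tau_forest_gt1 : ~ is_star F -> 1 < tau F.
Proof.
move=> nstar; rewrite ltnNge; apply/negP; rewrite tau_forest => le1.
have t1 : t = 1.
  apply/eqP; rewrite eqn_leq t_gt0 andbT; apply: leq_trans le1.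
  rewrite -[leqLHS]card_ord -sum1_card; apply: leq_sum => j _.
  exact: spider_tau_gt0 (ntF j).
pose j0 := Ordinal t_gt0.
have single j : j = j0.
  by apply: val_inj => /=; have := ltn_ord j; rewrite [X in _ < X]t1; case: (nat_of_ord j).
have ones : all (pred1 1) (ell j0).
  apply: spider_tau_le1 (ntF j0) _; apply: leq_trans le1.
  by rewrite (bigD1 j0) //= leq_addr.
apply: nstar; exists (size (ell j0)); first exact: legs_gt0.
apply: iso_trans (iso_spider_star ones); apply: iso_sym.
exists (@gin _ Fj j0); last by move=> x y; apply: adj_gin.
apply: inj_card_bij; first exact: gin_inj.
rewrite -cardsT card_slices (bigD1 j0) //= big1 ?addn0 ?max_card // => j.
by rewrite (single j) eqxx.
Qed.

End SpiderForest.

Section ForestExtremal.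
Variables (t : nat) (ell : 'I_t -> seq nat).
Hypotheses (ntF : forall j, spider_notation (ell j)).
Let F := gunion (fun j : 'I_t => spider (ell j)).

Lemma forest_extremal_joined (R : realType) (p : R) : (1 < p)%R -> 1 < tau F ->
  exists n0, forall n (G : sgraph), n0 <= n -> extremal p n F G ->
    exists B : {set G}, [/\ #|B| = tau F - 1, joined B & #|F| <= #|induced (~: B)|].
Proof.
move=> p1 tau1; set b := tau F - 1.
have eb : tau F = b.+1 by rewrite /b subn1 prednK // ltnW.
have b0 : 0 < b by rewrite subn_gt0.
have [dp dpF] := forest_forest_depth ell.
have cT : #|forest_cover ell| = b.+1 by rewrite (card_forest_cover ntF).
have [N hN] := maximal_joined_exists p1 dpF (forest_coverP ell) cT b0.
exists (N + (b + #|F|)) => n G len ext; have [cG freeG _] := ext.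
have maxG := extremal_maximal ext.
have leb : b <= n by apply: leq_trans len; rewrite addnCA leq_addr.
have freeK := @forest_free_edgeless _ _ ntF b (n - b) ltac:(by rewrite eb).
have low : (b%:R * dpow p #|G|.-1 <= e_p p G)%R.
  have /maxG : #|gjoin (complete b) (matching (n - b) 0)| = #|G|.
    by rewrite card_join_complete card_ord subnKC.
  move=> /(_ freeK); apply: le_trans.
  rewrite e_p_join_complete card_ord subnKC // cG lerDl.
  by apply: sumr_ge0 => y _; apply: dpow_ge0.
have [|B cB jB] := hN G _ freeG low maxG.
  by rewrite cG; apply: leq_trans len; apply: leq_addr.
exists B; split=> //; rewrite card_induced cardsCs setCK cB cG leq_subRL //.
by apply: leq_trans len; apply: leq_addl.
Qed.

Variables (G : sgraph) (B : {set G}).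
Hypotheses (freeG : Defs.free F G) (cB : #|B| = tau F - 1) (jB : joined B).
Hypothesis leFL : #|F| <= #|induced (~: B)|.

Lemma forest_joined_deg_lt j (x : spider (ell j)) d :
  x \in spider_cover (ell j) -> deg x <= d -> forall v : induced (~: B), deg v < d.
Proof.
move=> xT dx; apply: (@joined_deg_lt F G B jB freeG leFL (forest_cover ell) (gin x)).
- exact: forest_coverP.
- by rewrite in_gset.
- exact: leq_trans (deg_gin _) dx.
- by rewrite (card_forest_cover ntF) cB subn1 leqSpred.
Qed.

Lemma forest_joined_nonisolated j (S : {set spider (ell j)}) M :
    leaves_matching S M -> #|S|.+1 = spider_tau (ell j) ->
    (forall v : induced (~: B), deg v <= 1) -> 0 < M ->
  #|nonisolated (induced (~: B))| <= M.-1.*2.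
Proof.
move=> lm c dL M0; have [S' [lm' c']] := forest_leaves_matching ntF lm c.
have nS' := leaves_matching_nonisolated lm'; have [iS' mS' _] := lm'.
apply: (joined_nonisolated_lt jB freeG leFL iS') => //.
  by rewrite cB -c' subn1.
exact/induced_deg_le1.
Qed.

End ForestExtremal.

Lemma tau13_count ls : 0 < size ls -> (forall l, l \in ls -> l = 1 \/ l = 3) ->
  spider_tau ls + count_mem 1 ls = (size ls).+1.
Proof.
move=> sz legs13; rewrite (tau13 legs13 sz) sum_half_legs addnAC addn1; congr _.+1.
rewrite -sum1_count -sum1_size [X in _ + X]big_mkcond -big_split.
rewrite !big_seq; apply: eq_bigr => l /legs13[] -> //.
Qed.

Lemma iso_join_edgeless b n :
  iso (gjoin (complete b) (matching n 0)) (gjoin (complete b) (edgeless n)).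
Proof.
exists id; first by exists id.
by move=> [i|x] [j|y] //=; rewrite /matching_adj /= !andbF.
Qed.

(* Indices j run over 0, ..., t-1, so "1 <= j <= s" reads j < s. *)
Theorem theorem4p8 (R : realType) (t : nat) (ell : 'I_t -> seq nat) (s : nat)
    (p : R) :
  let Fj := fun j : 'I_t => spider (ell j) in
  let F := gunion Fj in
  let kj := fun j : 'I_t => size (ell j) in
  let rj := fun j : 'I_t => count_mem 1 (ell j) in
  let k := \sum_(j < t) kj j in
  let m := nat_min (fun j : 'I_t => j < s) kj in
  let r := \sum_(j < t) rj j in
  let alpha := nat_min xpredT kj in
  let star_forest := forall j : 'I_t, is_star (Fj j) in
  let legs13 := forall (j : 'I_t) (l : nat), l \in ell j -> l = 1 \/ l = 3 in
  let case2 := [/\ legs13, 1 <= s, 2 <= m & r <= k - 1] in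
  let case3 := [/\ legs13, s = 0 & r <= k - 1] in
  let case4 :=
    exists j : 'I_t, mixed_parity (ell j) \/ is_odd_path (Fj j) in
  1 <= t ->
  (forall j : 'I_t, spider_notation (ell j)) ->
  ~ is_star F ->
  s <= t ->
  (forall j : 'I_t, j < s -> rj j <= 1) ->
  (forall j : 'I_t, s <= j -> 2 <= rj j) ->
  (1 < p)%R ->
  [/\ tau F = \sum_(j < t) tau (Fj j),
      forall j : 'I_t,
        (even_legged (ell j) -> tau (Fj j) = \sum_(l <- ell j) l %/ 2) /\
        (odd_legged (ell j) || mixed_parity (ell j) ->
          tau (Fj j) = \sum_(l <- ell j) l %/ 2 + 1),
      star_forest <-> r = k &
      exists n0 : nat,
        (forall (n : nat) (G : sgraph), n0 <= n -> extremal p n F G ->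
          [/\ star_forest -> in_calL n (t - 1) (alpha - 1) G,
              case2 ->
                iso G (gjoin (complete (t + k - r - 1))
                             (matching (n - (t + k - r - 1)) (m - 1))),
              case3 -> iso G (L1 n (t + k - r - 1)),
              case4 -> iso G (L0 n (tau F - 1)) &
              ~ star_forest -> ~ case2 -> ~ case3 -> ~ case4 ->
                iso G (Eplus n (tau F - 1))]) /\
        (star_forest ->
          forall (n : nat) (G : sgraph), n0 <= n ->
            in_calL n (t - 1) (alpha - 1) G -> extremal p n F G)].
Proof.
move=> Fj F kj rj k m r alpha star_forest legs13 case2 case3 case4.
move=> t1 ntF nstar st r_lt r_ge p1.
have szF j : 0 < size (ell j) by apply: legs_gt0.
have tau1 : 1 < tau F := tau_forest_gt1 t1 ntF nstar.
have starP : star_forest <-> forall j, all (pred1 1) (ell j).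
  by split=> h j; apply/(is_star_spider (ntF j)); apply: h.
have star_rk : star_forest <-> r = k := iff_trans starP (iff_sym (star_forestP ell)).
have odd_even j : odd_legged (ell j) -> even_legged (ell j) = false.
  by move=> od; apply/negP => /(even_legP (Ordinal (szF j))); rewrite odd_legP.
split=> //.
- by rewrite (tau_forest ntF); apply: eq_bigr => j _; rewrite tau_spider.
- move=> j; rewrite tau_spider // /spider_tau sum_half_legs.
  split=> [->|]; first by rewrite addn0.
  by case/orP=> [/odd_even ->|/andP[/negPf ->]].
have star_tau : (forall j, all (pred1 1) (ell j)) -> tau F = t.
  move=> ones; rewrite (tau_forest ntF) (eq_bigr (fun=> 1)) => [|j _].
    by rewrite sum1_card card_ord.
  by apply: spider_tau_star; rewrite ?ones.
have free_star : star_forest -> forall H : sgraph, (forall x : H, deg x <= alpha - 1) ->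
    Defs.free F (gjoin (complete (t - 1)) H).
  move=> /starP ones H; apply: (forest_free_stars ntF _ ones) => [|j].
    by rewrite -/F (star_tau ones) subn1 prednK.
  have [j0 _ e0] := @nat_min_attained _ xpredT kj j isT.
  rewrite subn1 prednK; first exact: (@nat_min_le _ xpredT kj j).
  by rewrite /alpha -e0 szF.
have [N hN] := forest_extremal_joined ntF p1 tau1.
set b := tau F - 1 in hN *.
have ltb : b < tau F by rewrite /b subn1 prednK // ltnW.
pose n0 := N + (b + (2 * (alpha - 1) + 2 + m.*2)).
suff main n G : n0 <= n -> extremal p n F G ->
    [/\ star_forest -> in_calL n (t - 1) (alpha - 1) G,
        case2 -> iso G (gjoin (complete (t + k - r - 1))
                             (matching (n - (t + k - r - 1)) (m - 1))),
        case3 -> iso G (L1 n (t + k - r - 1)),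
        case4 -> iso G (L0 n b) &
        ~ star_forest -> ~ case2 -> ~ case3 -> ~ case4 -> iso G (Eplus n b)].
  exists n0; split=> // sf n G len inL.
  apply: (near_regular_extremal (free_star sf) _ _ inL).
    have := leq_trans (leq_addl _ _) len; rewrite /b (star_tau (starP.1 sf)).
    by apply: leq_trans; apply: leq_addr.
  by move=> G' extG'; have [h _ _ _ _] := main n G' len extG'; apply: h.
move=> len ext; have [cG freeG _] := ext; have maxG := extremal_maximal ext.
have [B [cB jB leFL]] := hN n G (leq_trans (leq_addr _ _) len) ext.
have lenb : b + (2 * (alpha - 1) + 2 + m.*2) <= n := leq_trans (leq_addl _ _) len.
have leb : b <= n := leq_trans (leq_addr _ _) lenb.
have degL := forest_joined_deg_lt ntF freeG cB jB leFL.
have nisoL := forest_joined_nonisolated ntF freeG cB jB leFL.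
have finish e := @maximal_join_matching R p F p1 G B b n e cG leb jB cB maxG.
have tau_rk : legs13 -> tau F + r = t + k.
  move=> l13; rewrite (tau_forest ntF) /r -big_split /=.
  rewrite (eq_bigr (fun j => 1 + size (ell j))) => [|j _].
    by rewrite big_split /= sum1_card card_ord.
  by rewrite /rj (tau13_count (szF j) (l13 j)).
have le_rk : r <= k by apply: leq_sum => j _; apply: count_size.
have b_rk : legs13 -> t + k - r - 1 = b by move=> /tau_rk <-; rewrite addnK.
have k_gt0 : 0 < k by rewrite /k (bigD1 (Ordinal t1)) //= ltn_addr ?szF.
have deg13 : legs13 -> r <= k - 1 -> forall v : induced (~: B), deg v <= 1.
  move=> l13 ltr.
  have [j nj] : exists j, ~~ all (pred1 1) (ell j).
    apply/existsP; apply: contraLR ltr => /existsPn h.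
    rewrite -ltnNge subn1 prednK // [r](_ : _ = k) //.
    by apply/(star_forestP ell) => j; have := h j; rewrite negbK.
  case/allPn: nj => l lj nl1; have [e1|l3] := l13 j l lj; first by rewrite e1 in nl1.
  move/(nthP 0): (lj) => [i lti ei]; pose i' := Ordinal lti.
  have ei' : nth 0 (ell j) i' = 3 by rewrite /= ei.
  have od : odd_legged (ell j) by apply/allP => l' /(l13 j)[] ->.
  apply: (degL j (spos i' 2) 2); last by apply: deg_spos_le2; rewrite ei'.
  by rewrite /spider_cover odd_even // in_parity_class ?ei'.
split.
- move=> sf; have ones := starP.1 sf.
  have eb : b = t - 1 by rewrite /b star_tau.
  have [j0 _ e0] := @nat_min_attained _ xpredT kj (Ordinal t1) isT.
  rewrite -eb; apply: (maximal_join_near_regular p1 (b := b) _ cG _ jB cB maxG).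
  + by rewrite eb; apply: free_star.
  + by apply: leq_trans lenb; rewrite leq_add2l leq_addr.
  move=> v; rewrite subn1 -ltnS prednK; last by rewrite /alpha -e0 szF.
  apply: (degL j0 None alpha); last by rewrite /alpha -e0; apply: deg_center_le.
  rewrite /spider_cover odd_even ?inE //.
  by apply: sub_all (ones j0) => l /eqP ->.
- case=> l13 s1 m2 ltr; rewrite (b_rk l13).
  have [j0 j0s e0] := @nat_min_attained _ (fun j : 'I_t => j < s) kj (Ordinal t1) s1.
  have [S [lm c]] := legs13_leaves_matching (szF j0) (l13 j0) (r_lt j0 j0s).
  have dL := deg13 l13 ltr.
  apply: finish => //.
  + have := nisoL j0 S _ lm c dL (szF j0).
    by rewrite subn1 /m -e0.
  + rewrite leq_subRL //; apply: leq_trans lenb; rewrite leq_add2l.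
    by apply: leq_trans (leq_addl _ _); rewrite leq_double leq_subr.
  apply: (forest_free_matching13 ntF _ ltb l13).
    rewrite leq_subRL //; apply: leq_trans lenb; rewrite leq_add2l.
    by apply: leq_trans (leq_addl _ _); rewrite leq_double leq_subr.
  move=> j c1; have js : j < s by rewrite ltnNge; apply/negP => /r_ge; rewrite ltnNge c1.
  rewrite subn1 prednK ?(leq_trans _ m2) //.
  exact: (@nat_min_le _ (fun j : 'I_t => j < s) kj j js).
- case=> l13 s0 ltr; rewrite /L1 (b_rk l13).
  have dL := deg13 l13 ltr.
  have half : (n - b)./2.*2 <= n - b by rewrite -[leqRHS]odd_double_half leq_addl.
  apply: finish => //.
    have [e [lee isoL]] := matching_normal_form dL.
    rewrite (iso_nonisolated isoL) card_nonisolated_matching // leq_double.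
    by rewrite geq_half_double; apply: leq_trans lee _; rewrite card_induced cardsCs setCK cB cG.
  apply: (forest_free_matching13 ntF half ltb l13) => j.
  by rewrite leqNgt => /negP[]; apply: r_ge; rewrite s0.
- move=> [j h4].
  apply: iso_trans (iso_join_edgeless b (n - b)).
  have dL : forall v : induced (~: B), deg v < 1.
    case: h4 => [/andP[nev nod]|/(is_odd_path_spider (ntF j))[k1 ol]].
      have /allPn[l /(nthP 0)[i lti ei] el] := nod; pose i' := Ordinal lti.
      have hl : 0 < nth 0 (ell j) i' by apply: (leg_gt0 ntF i').
      apply: (degL j (spos i' (nth 0 (ell j) i')) 1); last exact: deg_spos_end.
      by rewrite /spider_cover (negPf nev) in_parity_class //= ei eqbF_neg.
    apply: (degL j None 1); last by rewrite -k1; apply: deg_center_le.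
    have -> : spider_cover (ell j) = parity_class (ell j) false; last by rewrite inE.
    congr parity_class; apply/negP => /(even_legP (Ordinal (szF j))).
    by rewrite /= ol.
  apply: finish => //; first by move=> v; apply: ltnW.
    rewrite leqn0 cards_eq0; apply/eqP/setP=> v; rewrite !inE.
    by apply/negbTE; rewrite -leqNgt -ltnS dL.
  exact: (@forest_free_edgeless _ _ ntF b (n - b) ltb).
move=> nsf n2 n3 n4; rewrite /Eplus.
have pure j : even_legged (ell j) \/ odd_legged (ell j) /\ 1 < size (ell j).
  have [|nev] := boolP (even_legged (ell j)); [by left|right].
  have od : odd_legged (ell j).
    by apply/negPn/negP => nod; apply: n4; exists j; left; rewrite /mixed_parity nev.
  split=> //; rewrite ltnNge; apply/negP => k1; apply: n4; exists j; right.
  apply/(is_odd_path_spider (ntF j)); split; first by apply/eqP; rewrite eqn_leq k1 szF.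
  exact: (odd_legP (Ordinal (szF j)) od).
have [j [i n13]] : exists j (i : 'I_(size (ell j))), ~~ ((nth 0 (ell j) i == 1) || (nth 0 (ell j) i == 3)).
  have [/forallP h|/forallPn[j]] := boolP [forall j, all (fun l => (l == 1) || (l == 3)) (ell j)].
    exfalso; have l13 : legs13.
      by move=> j l lj; have /allP/(_ l lj)/pred2P := h j.
    have ltr : r <= k - 1.
      rewrite subn1 -ltnS prednK // ltn_neqAle le_rk andbT; apply/eqP => e.
      by apply: nsf; apply/star_rk.
    have [s0|s1] := posnP s; first by apply: n3.
    apply: n2; split=> //.
    have [j0 j0s e0] := @nat_min_attained _ (fun j : 'I_t => j < s) kj (Ordinal t1) s1.
    rewrite /m -e0 ltnNge; apply/negP => k1; have [ev|[_]] := pure j0.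
      have := even_legP (Ordinal (szF j0)) ev.
      by have [] := l13 j0 _ (mem_nth 0 (szF j0)) => ->.
    by rewrite ltnNge k1.
  by case/allPn=> l /(nthP 0)[i lti ei] nl; exists j, (Ordinal lti); rewrite /= ei.
have l0 : 0 < nth 0 (ell j) i := leg_gt0 ntF i.
have [S [lm c]] : exists S : {set spider (ell j)}, leaves_matching S 2 /\ #|S|.+1 = spider_tau (ell j).
  have [ev|[od _]] := pure j; first exact: even_legged_leaves_matching.
  apply: (odd_legged_leaves_matching (i0 := i) od).
  by move: l0 n13 (odd_legP i od); case: (nth _ _ _) => [|[|[|[|[|]]]]].
have dL : forall v : induced (~: B), deg v <= 1.
  have len2 : 2 <= nth 0 (ell j) i.
    by move: l0 n13; case: (nth _ _ _) => [|[|]].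
  have [ev|[od _]] := pure j.
    apply: (degL j (spos i 1) 2); last by apply: deg_spos_le2; rewrite l0.
    by rewrite /spider_cover ev in_parity_class.
  apply: (degL j (spos i 2) 2); last by apply: deg_spos_le2; rewrite len2.
  by rewrite /spider_cover odd_even // in_parity_class.
have le2 : 1.*2 <= n - b.
  rewrite leq_subRL //; apply: leq_trans lenb; rewrite leq_add2l.
  by rewrite addnAC leq_addl.
apply: finish => //; first exact: (nisoL j S 2 lm c dL).
exact: forest_free_one_edge.
Qed.
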